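(* There is an absolute constant $C>0$ such that for all $n\geq 1$ and $r,d\geq 3$ the following holds. Let $G_n$ be a uniformly random simple $d$-regular graph on $n$ vertices, and let $\mathrm{CNBW}^{(n)}_k$ be the number of cyclically non-backtracking walks of length $k$ in $G_n$. Let $(C^{(\infty)}_k,\ k\geq 3)$ be independent Poisson random variables with $\mathbb{E}C^{(\infty)}_k=(d-1)^k/(2k)$, set $C^{(\infty)}_1=C^{(\infty)}_2=0$, and define $\mathrm{CNBW}^{(\infty)}_k=\sum_{j\mid k}2jC^{(\infty)}_j$. Then \[ d_{TV}\Big(\big(\mathrm{CNBW}^{(n)}_k,\ 1\leq k\leq r\big),\ \big(\mathrm{CNBW}^{(\infty)}_k,\ 1\leq k\leq r\big)\Big)\leq \frac{C\sqrt{r}(d-1)^{3r/2}}{n}. \]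
   Context: A random $d$-regular graph on $n$ vertices is chosen uniformly from all simple $d$-regular graphs on $\{1,\dots,n\}$ (with $n$ even when $d$ is odd). A walk is closed if it starts and ends at the same vertex; it is non-backtracking if it never traverses an edge and then immediately traverses the same edge back. A cyclically non-backtracking walk is a closed non-backtracking walk whose last step is not the reverse of its first step. Walks are counted as sequences of vertices (so starting point and direction matter). For random vectors $X,Y$ with values in $\mathbb{N}^m$, $d_{TV}(X,Y)=\sup_{A\subset \mathbb{N}^m}|\mathbb{P}[X\in A]-\mathbb{P}[Y\in A]|$. *)

(* Defs.v *)
From HB Require Import structures.
From mathcomp Require Import all_boot all_order all_algebra.
From mathcomp Require Import finmap.
From mathcomp Require Import all_classical all_reals all_analysis.

Set Implicit Arguments.
Unset Strict Implicit.
Unset Printing Implicit Defensive.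

Import Order.TTheory GRing.Theory Num.Theory.

Local Open Scope classical_set_scope.
Local Open Scope ring_scope.

(* A simple graph on 'I_n is given by its edge set: a set of 2-element subsets
   of 'I_n. *)
Definition adj (n : nat) (E : {set {set 'I_n}}) : rel 'I_n :=
  fun x y => [set x; y]%SET \in E.

Definition is_simple (n : nat) (E : {set {set 'I_n}}) : bool :=
  [forall e in E, #|e| == 2%N].

Definition is_regular (n d : nat) (E : {set {set 'I_n}}) : bool :=
  [forall x : 'I_n, #|[set y | adj E x y]%SET| == d].

Definition regular_graph (n d : nat) : Type :=
  {E : {set {set 'I_n}} | is_simple E && is_regular d E}.

Section walks.
Variables (V : eqType) (e : rel V).

(* A walk of length k is the sequence w_0, ..., w_k of its k.+1 vertices; its
   steps are the k ordered pairs (w_i, w_(i+1)). *)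
Definition steps (w : seq V) : seq (V * V) := zip w (behead w).

Definition rev_step (s : V * V) : V * V := (s.2, s.1).

Definition is_closed_walk (w : seq V) : bool :=
  if w is x :: p then path e x p && (last x p == x) else false.

Definition non_backtracking (w : seq V) : bool :=
  sorted (fun s t => t != rev_step s) (steps w).

Definition last_step_not_rev_first (w : seq V) : bool :=
  if steps w is s :: ss then last s ss != rev_step s else true.

Definition is_cnbw (w : seq V) : bool :=
  [&& is_closed_walk w, non_backtracking w & last_step_not_rev_first w].

End walks.

Definition CNBW (n d : nat) (G : regular_graph n d) (k : nat) : nat :=
  #|[set w : k.+1.-tuple 'I_n | is_cnbw (adj (sval G)) w]%SET|.

Definition CNBW_inf (T : Type) (C : nat -> T -> nat) (k : nat) (t : T) : nat :=
  (\sum_(j <- divisors k) 2 * j * C j t)%N.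

Definition uniformly_distributed (dT : measure_display) (T : measurableType dT)
    (R : realType) (P : probability T R) (F : finType) (X : T -> F) : Prop :=
  forall x : F, measurable (X @^-1` [set x]) /\
    P (X @^-1` [set x]) = (#|F|%:R^-1)%:E.

(* The product rule for every finite subfamily of (X i)_(i in D). *)
Definition mutually_independent (dT dU : measure_display)
    (T : measurableType dT) (U : measurableType dU) (R : realType)
    (P : probability T R) (I : choiceType) (D : set I)
    (X : I -> {RV P >-> U}) : Prop :=
  forall (s : {fset I}) (B : I -> set U),
    [set` s] `<=` D -> (forall i, measurable (B i)) ->
    P (\bigcap_(i in [set` s]) (X i @^-1` B i)) =
      (\prod_(i <- s) P (X i @^-1` B i))%E.

(* Only used for random vectors with values in the countable space N^m, where
   every subset A is an event. *)
Definition dTV (d1 d2 : measure_display) (T1 : measurableType d1)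
    (T2 : measurableType d2) (R : realType) (P1 : probability T1 R)
    (P2 : probability T2 R) (U : Type) (X : T1 -> U) (Y : T2 -> U) : \bar R :=
  ereal_sup [set `|P1 (X @^-1` A) - P2 (Y @^-1` A)|%E | A in [set: set U]].

(* Main.v *)
(** Write [q = d - 1]. Removing the closing edge of a [k]-cycle together with a
    far edge, and reconnecting the four endpoints, turns the cycle into a path
    with [k + 2] vertices. This switching is an involution on pairs (regular
    graph, [k + 2] vertices), and it changes the vector of short cycle counts by
    exactly [1] in coordinate [k] unless some short detour or second cycle is
    nearby. Hence, up to an error of order [k d q ^ (k + r)] on average, each
    graph has [n d q ^ k] paths to close and [2 k C_k n d] cycles to open, which
    is the Stein equation of independent Poisson variables with means
    [q ^ k / (2 k)]. Stein's method with test functions in which coordinates are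
    integrated out one at a time, and the bound [4 / sqrt lambda] on the solution
    of the one-dimensional equation, give the total variation distance for
    cycle counts. Finally a cyclically non-backtracking walk winds around a
    single cycle unless the graph contains a short subgraph with two independent
    cycles, which has probability [O (r ^ 3 q ^ (r + 1) / n)]. *)

Require Import Defs.
From mathcomp Require Import all_boot.
From mathcomp Require Import zify.
Set Implicit Arguments.
Unset Strict Implicit.
Unset Printing Implicit Defensive.

(** * Switchings *)

(** A tuple counts as good when the vector of cycle counts changes exactly as wanted, so the
    identity between the two sides of the switching has no error term. The upper bounds [n d q ^ k]
    and [2 k C_k n d] on good tuples hold in every graph; the deficits are therefore nonnegative,
    and only their means are needed. Each mean is a count of injective copies of a tree or forest
    with a few extra edges (chords). The tree is bounded greedily in every graph, and a chord
    between vertices already covered costs a factor [2 q ^ 2 / (n d)], by switching it away. With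
    [s] the square root of the [k]-th mean, coordinate [k] contributes a multiple of
    [q ^ r k s / n], and [k s] is at most [sqrt r q ^ (k / 2)]; the geometric sum over [k] gives the
    rate. By complements, an upper bound on the probability for graphs suffices. There the event may
    be replaced by the finitely many cycle vectors that occur, which loses Poisson mass only in the
    harmless direction. All this needs [n] at least a constant times [q ^ r]; below that the claimed
    bound is at least 1. *)

Lemma card_dep_pairs (T U : finType) (A : {set T}) (F : T -> {set U}) :
  #|[set p : T * U | (p.1 \in A) && (p.2 \in F p.1)]| = \sum_(u in A) #|F u|.
Proof.
rewrite -sum1dep_card (eq_bigr (fun u => \sum_(v in F u) 1)); last first.
  by move=> u _; rewrite sum1_card.
by rewrite (pair_big_dep (mem A) (fun u v => v \in F u) (fun _ _ => 1)).
Qed.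

Lemma card_fibers (T U : finType) (g : T -> U) (P : pred T) (H : {set U}) :
  #|[set p | P p && (g p \in H)]| = \sum_(f in H) #|[set p | P p && (g p == f)]|.
Proof.
rewrite -sum1dep_card (partition_big g (mem H)) /=; last by move=> p /andP[].
apply: eq_bigr => f fH; rewrite -sum1dep_card; apply: eq_bigl => p.
by rewrite -andbA; case: eqP => [->|]; rewrite ?fH ?andbF.
Qed.

Lemma set2_eq (T : finType) (x y z w : T) :
  ([set x; y] == [set z; w]) =
  ((x == z) && (y == w)) || ((x == w) && (y == z)).
Proof.
apply/eqP/orP => [eq_s|[/andP[/eqP-> /eqP->]|/andP[/eqP-> /eqP->]]] //; last first.
  exact: setUC.
have := set21 x y; have := set22 x y; have := set21 z w; have := set22 z w.
rewrite {1 2}eq_s -{1 2}eq_s !inE.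
case: (eqVneq x z) => [->|nxz]; case: (eqVneq y w) => [->|nyw]; rewrite ?eqxx ?orbT; auto.
- by rewrite !orbF /= => /eqP -> _ /eqP -> _; rewrite !eqxx; auto.
- by rewrite /= => _ /eqP -> _ /eqP ->; rewrite !eqxx; auto.
by rewrite /= !orbF => _ _ -> ->; auto.
Qed.

Lemma card_ordered_pairs (T : finType) (H : {set {set T}}) :
  {in H, forall f : {set T}, #|f| = 2} ->
  #|[set p : T * T | [set p.1; p.2] \in H]| = 2 * #|H|.
Proof.
move=> H2.
have -> : [set p : T * T | [set p.1; p.2] \in H] =
   [set p : T * T | true && ([set p.1; p.2] \in H)] by apply/setP => p; rewrite !inE.
rewrite (card_fibers (fun p : T * T => [set p.1; p.2]) xpredT H).
rewrite mulnC -sum_nat_const; apply: eq_bigr => f fH.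
have /eqP/cards2P[x [y [nxy ->]]] := H2 f fH.
have -> : [set p : T * T | true && ([set p.1; p.2] == [set x; y])] = [set (x, y); (y, x)].
  by apply/setP => -[u v]; rewrite !inE /= set2_eq !xpair_eqE.
by rewrite cards2 xpair_eqE (negPf nxy).
Qed.

Section Graphs.
Variables (n d : nat).
Local Notation V := 'I_n.
Implicit Types (E H : {set {set V}}) (x y a b c e u v : V).

Definition graphs := locked [set E : {set {set V}} | is_simple E && is_regular d E].

Lemma graphsE E : (E \in graphs) = is_simple E && is_regular d E.
Proof. by rewrite /graphs -lock inE. Qed.

Definition nbr E x := [set y | adj E x y].

Lemma adjC E x y : adj E x y = adj E y x.
Proof. by rewrite /adj setUC. Qed.

Lemma card_nbr E x : E \in graphs -> #|nbr E x| = d.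
Proof. by rewrite graphsE => /andP[_ /forallP/(_ x)/eqP]. Qed.

Lemma card_edge E f : E \in graphs -> f \in E -> #|f| = 2.
Proof. by rewrite graphsE => /andP[/forall_inP s _] /s/eqP. Qed.

Lemma adj_neq E x y : E \in graphs -> adj E x y -> x != y.
Proof. by move=> EG /(card_edge EG); rewrite cards2; case: eqP. Qed.

Lemma adjxx E x : E \in graphs -> adj E x x = false.
Proof. by move=> EG; apply/negP => /(adj_neq EG); rewrite eqxx. Qed.

(** The argument order makes the inverse the same operation with [b] and [c] exchanged, so one
    notion of validity serves both directions. *)
Definition sw E a b c e : {set {set V}} :=
  [set a; c] |: ([set b; e] |: (E :\ [set a; b] :\ [set c; e])).

Definition valid E a b c e :=
  [&& uniq [:: a; b; c; e], adj E a b, adj E c e, ~~ adj E a c & ~~ adj E b e].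

Lemma adj_sw E a b c e x y : adj (sw E a b c e) x y =
  [|| [set x; y] == [set a; c], [set x; y] == [set b; e] |
      [&& [set x; y] != [set c; e], [set x; y] != [set a; b] & adj E x y]].
Proof. by rewrite /adj !inE. Qed.

Lemma sw_inv E a b c e : valid E a b c e -> sw (sw E a b c e) a c b e = E.
Proof.
case/and5P=> _; rewrite /adj => ab ce ac be.
apply/setP => f; rewrite !inE.
case: (eqVneq f [set a; b]) => [->//|_] /=.
case: (eqVneq f [set c; e]) => [->//|_] /=.
case: (eqVneq f [set a; c]) => [->|_] /=; first by rewrite (negPf ac) andbF.
by case: (eqVneq f [set b; e]) => [->|_] //=; rewrite (negPf be).
Qed.

(** Together with [swC2] this generates a Klein four-group that moves any switched vertex to the
    first position; degrees then need checking only at [a]. *)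
Lemma swC1 E a b c e : sw E a b c e = sw E b a e c.
Proof.
by apply/setP => f; rewrite !inE orbCA ![[set b; a]]setUC ![[set e; c]]setUC.
Qed.

Lemma swC2 E a b c e : sw E a b c e = sw E c e a b.
Proof.
rewrite /sw [[set c; a]]setUC [[set e; b]]setUC; congr (_ |: (_ |: _)).
by apply/setP => f; rewrite !inE; case: eqP; case: eqP.
Qed.

Lemma validC1 E a b c e : valid E a b c e = valid E b a e c.
Proof.
rewrite /valid /= !inE !(adjC _ _ a) !(adjC _ _ b) (adjC _ c e).
rewrite !(eq_sym _ a) !(eq_sym _ b) !(eq_sym _ c).
by do !case: (_ == _) => //=; do !case: (adj _ _ _).
Qed.

Lemma validC2 E a b c e : valid E a b c e = valid E c e a b.
Proof.
rewrite /valid /= !inE !(adjC _ _ a) !(adjC _ _ b).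
rewrite !(eq_sym _ a) !(eq_sym _ b) !(eq_sym _ c).
by do !case: (_ == _) => //=; do !case: (adj _ _ _).
Qed.

Lemma card_nbr_sw E a b c e : E \in graphs -> valid E a b c e ->
  #|nbr (sw E a b c e) a| = d.
Proof.
move=> EG /and5P[U ab ce ac be].
have [nab nac nae] : [/\ a != b, a != c & a != e].
  by move: U; rewrite /= !inE !negb_or -!andbA => /andP[-> /andP[-> /andP[->]]].
have -> : nbr (sw E a b c e) a = c |: (nbr E a :\ b).
  apply/setP => y; rewrite !inE adj_sw !set2_eq eqxx (negPf nab) (negPf nac) (negPf nae) /=.
  by rewrite !orbF.
have cN : c \notin nbr E a :\ b by rewrite !inE (negPf ac) andbF.
rewrite cardsU1 cN /=.
by have := cardsD1 b (nbr E a); rewrite inE ab card_nbr.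
Qed.

Lemma sw_graphs E a b c e : E \in graphs -> valid E a b c e ->
  sw E a b c e \in graphs.
Proof.
move=> EG v; rewrite graphsE; apply/andP; split.
  have /and5P[U _ _ _ _] := v.
  move: U; rewrite /= !inE !negb_or -!andbA => /and5P[_ nac _ _ /andP[nbe _]].
  apply/forall_inP => f; rewrite !inE => /or3P[/eqP->|/eqP->|/and3P[_ _ fE]].
  - by rewrite cards2 nac.
  - by rewrite cards2 nbe.
  by apply/eqP; apply: (card_edge EG).
apply/forallP => x; apply/eqP; rewrite -/(nbr _ x).
case: (eqVneq x a) => [->|nxa]; first exact: card_nbr_sw.
case: (eqVneq x b) => [->|nxb].
  by rewrite swC1; apply: card_nbr_sw => //; rewrite -validC1.
case: (eqVneq x c) => [->|nxc].
  by rewrite swC2; apply: card_nbr_sw => //; rewrite -validC2.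
case: (eqVneq x e) => [->|nxe].
  by rewrite swC2 swC1; apply: card_nbr_sw => //; rewrite -validC1 -validC2.
rewrite -(card_nbr x EG); congr #|pred_of_set _|; apply/setP => y; rewrite !inE adj_sw !set2_eq.
by rewrite (negPf nxa) (negPf nxb) (negPf nxc) (negPf nxe).
Qed.

Lemma sw_valid E a b c e : valid E a b c e -> valid (sw E a b c e) a c b e.
Proof.
move=> v; have /and5P[U ab ce ac be] := v.
move: U; rewrite /valid /= !inE !negb_or -!andbA.
move=> /and5P[nab nac nae nbc /and3P[nbe nce _]].
rewrite !adj_sw !eqxx !orbT /= !set2_eq !eqxx (negPf nab) (negPf nac) (negPf nae) (eq_sym c b).
rewrite nce nbe (eq_sym c a) (eq_sym e a) (eq_sym e b) (negPf nac) (negPf nae) (negPf nbc) (negPf nbe).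
by rewrite /= andbF.
Qed.

Definition cnt H := #|[set E in graphs | H \subset E]|.

Lemma card_arcs E : E \in graphs -> #|[set p : V * V | adj E p.1 p.2]| = n * d.
Proof.
move=> EG; have -> : [set p : V * V | adj E p.1 p.2] =
  [set p : V * V | (p.1 \in setT) && (p.2 \in nbr E p.1)].
  by apply/setP => p; rewrite !inE.
rewrite card_dep_pairs (eq_bigr (fun=> d)) => [|u _]; last exact: card_nbr.
by rewrite sum_nat_const cardsT card_ord.
Qed.

(** Arcs unsuited for switching against [xy]: the [2 #|H|] arcs of [H], at most [4 d] arcs that
    start or end at [x] or [y], [d ^ 2] arcs that start next to [x] and [d ^ 2] that end next to
    [y]. *)
Lemma card_valid_ge E H x y : E \in graphs -> H \subset E -> adj E x y ->
  n * d <= #|[set p : V * V | valid E x y p.1 p.2 && ([set p.1; p.2] \notin H)]|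
           + (2 * #|H| + 4 * d + 2 * (d * d)).
Proof.
move=> EG HE xy; rewrite -(card_arcs EG).
set S := [set p : V * V | valid E x y p.1 p.2 && _].
pose B1 := [set p : V * V | [set p.1; p.2] \in H].
pose far (z : V) := [set p : V * V | (p.1 \in nbr E z) && (p.2 \in nbr E p.1)].
pose rev (A : {set V * V}) := [set (p.2, p.1) | p in A].
pose at_ (z : V) := [set p : V * V | (p.1 \in [set z]) && (p.2 \in nbr E p.1)].
have cB1 : #|B1| = 2 * #|H|.
  apply: card_ordered_pairs => f fH; apply: (card_edge EG); exact: (subsetP HE).
have cfar z : #|far z| = d * d.
  rewrite card_dep_pairs (eq_bigr (fun=> d)) => [|u _]; last exact: card_nbr.
  by rewrite sum_nat_const card_nbr.
have cat z : #|at_ z| = d.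
  by rewrite card_dep_pairs big_set1 card_nbr.
have crev A : #|rev A| <= #|A| by exact: leq_imset_card.
suff sub : [set p : V * V | adj E p.1 p.2] \subset
   S :|: (B1 :|: (at_ x :|: (at_ y :|: (rev (at_ x) :|: (rev (at_ y) :|:
    (far x :|: rev (far y))))))).
  apply: (leq_trans (subset_leq_card sub)).
  have U (A B : {set V * V}) k l : #|A| <= k -> #|B| <= l -> #|A :|: B| <= k + l.
    by move=> Ak Bl; rewrite cardsU (leq_trans (leq_subr _ _)) // leq_add.
  have le_at z : #|at_ z| <= d by rewrite cat.
  have le_rat z : #|rev (at_ z)| <= d by rewrite -(cat z) crev.
  have le_far z : #|far z| <= d * d by rewrite cfar.
  have le_rfar z : #|rev (far z)| <= d * d by rewrite -(cfar z) crev.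
  have := U _ _ _ _ (leqnn #|S|) (U _ _ _ _ (leqnn #|B1|) (U _ _ _ _ (le_at x)
    (U _ _ _ _ (le_at y) (U _ _ _ _ (le_rat x) (U _ _ _ _ (le_rat y)
    (U _ _ _ _ (le_far x) (le_rfar y))))))).
  by move/leq_trans; apply; rewrite cB1 leq_add2l; lia.
apply/subsetP => -[u v]; rewrite !inE /= => uv.
case: (boolP ([set u; v] \in H)) => uvH /=; rewrite ?orbT //.
case: (eqVneq u x) => [ux|nux] /=; first by rewrite uv !orbT.
case: (eqVneq u y) => [uy|nuy] /=; first by rewrite uv !orbT.
have memrev (A : {set V * V}) : ((u, v) \in rev A) = ((v, u) \in A).
  apply/imsetP/idP => [[[p q] pA [-> ->]]//|vuA].
  by exists (v, u).
rewrite !memrev !inE /= !(adjC E v u) uv !andbT.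
case: (eqVneq v x) => [|nvx] /=; rewrite ?orbT //.
case: (eqVneq v y) => [|nvy] /=; rewrite ?orbT //.
case: (boolP (adj E x u)) => [|xu] /=; rewrite ?orbT //.
case: (boolP (adj E y v)) => [|yv] /=; rewrite ?orbT //.
rewrite /valid uv xy xu yv /= !inE !negb_or !(eq_sym x) !(eq_sym y) nux nvx nuy nvy.
by rewrite (adj_neq EG xy) (adj_neq EG uv).
Qed.

(* Conditionally on containing [H], the edge [xy] is present with probability
   at most [2 (d - 1) ^ 2 / (n d)]: switch [xy] against a random edge. *)
Lemma cnt_chord H x y x' y' :
  [set x; y] \notin H -> [set x; x'] \in H -> [set y; y'] \in H ->
  2 * (2 * #|H| + 4 * d + 2 * (d * d)) <= n * d ->
  cnt ([set x; y] |: H) * (n * d) <= 2 * (d - 1) ^ 2 * cnt H.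
Proof.
move=> xyH xx' yy' big.
set A := [set E in graphs | ([set x; y] |: H) \subset E].
set B := [set E in graphs | H \subset E].
pose F E := [set p : V * V | valid E x y p.1 p.2 && ([set p.1; p.2] \notin H)].
pose F' E := setX [set u | adj E x u && ([set x; u] \notin H)]
                  [set u | adj E y u && ([set y; u] \notin H)].
pose S := [set p : {set {set V}} * (V * V) | (p.1 \in A) && (p.2 \in F p.1)].
pose T := [set p : {set {set V}} * (V * V) | (p.1 \in B) && (p.2 \in F' p.1)].
(* By [big] at least half of the [n * d] arcs are available in each graph that contains [xy]; this
   is the factor 2. *)
have cS : cnt ([set x; y] |: H) * (n * d) <= 2 * #|S|.
  rewrite card_dep_pairs big_distrr /= -sum_nat_const.
  apply: leq_sum => E; rewrite inE subUset sub1set => /and3P[EG xyE HE].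
  have := card_valid_ge EG HE xyE; rewrite -/(F E); clear -big.
  by move: #|F E| #|H| big => f h; lia.
(* The edge of [H] at [z] takes up one of its [d] neighbours. This is why a chord costs
   [(d - 1) ^ 2] and not [d ^ 2]. *)
have degle z z' E : E \in B -> [set z; z'] \in H ->
    #|[set u | adj E z u && ([set z; u] \notin H)]| <= d - 1.
  rewrite inE => /andP[EG HE] zz'.
  have sub : [set u | adj E z u && ([set z; u] \notin H)] \subset nbr E z :\ z'.
    apply/subsetP => u; rewrite !inE => /andP[-> zu]; rewrite andbT.
    by apply: contraNneq zu => ->.
  apply: (leq_trans (subset_leq_card sub)).
  have := cardsD1 z' (nbr E z); rewrite inE card_nbr // /adj (subsetP HE) //= => ->.
  by rewrite addKn.
have cT : #|T| <= (d - 1) ^ 2 * cnt H.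
  rewrite card_dep_pairs mulnC -sum_nat_const; apply: leq_sum => E EB.
  by rewrite cardsX -mulnn; apply: leq_mul; [apply: degle xx'|apply: degle yy'].
suff ST : #|S| <= #|T|.
  apply: (leq_trans cS); rewrite -mulnA leq_mul2l /=; exact: leq_trans ST cT.
(* The arc [uv] is kept as second component, so the switching can be undone; in the new graph [xu]
   and [yv] are edges outside [H]. *)
pose phi (p : {set {set V}} * (V * V)) := (sw p.1 x y p.2.1 p.2.2, p.2).
have inj : {in S &, injective phi}.
  move=> [E [u v]] [E' [u' v']]; rewrite !inE /= => /and3P[_ v1 _] /and3P[_ v2 _].
  move=> [eqsw eu ev]; subst u' v'; congr (_, _).
  by rewrite -(sw_inv v1) -(sw_inv v2) eqsw.
rewrite -(card_in_imset inj); apply/subset_leq_card/subsetP => p /imsetP[[E [u v]]].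
rewrite !inE subUset sub1set /= => /andP[/and3P[EG xyE HE] /andP[vE uvH]] ->.
rewrite /= sw_graphs //=; have /and5P[_ _ uvE xu yv] := vE.
have HN (f : {set V}) : f \notin E -> f \notin H by apply: contraNN => /(subsetP HE).
rewrite !adj_sw !eqxx /= !(HN _ xu) !(HN _ yv) orbT !andbT.
apply/subsetP => f fH; rewrite !inE (subsetP HE) // andbT.
have -> : f != [set u; v] by apply: contraNneq uvH => <-.
by have -> : f != [set x; y] by [apply: contraNneq xyH => <-]; rewrite !orbT.
Qed.

End Graphs.

(** * Counting embedded trees with chords *)

Lemma card_rcons_tuple (T : finType) (L : nat) (P' P : pred (seq T))
    (F : seq T -> {set T}) :
  (forall v x, size v = L -> P' (rcons v x) = P v && (x \in F v)) ->
  #|[set v : L.+1.-tuple T | P' v]| = \sum_(v : L.-tuple T | P v) #|F v|.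
Proof.
move=> P'E.
pose g (p : L.-tuple T * T) : L.+1.-tuple T := [tuple of rcons p.1 p.2].
pose f (v : L.+1.-tuple T) : L.-tuple T * T :=
  ([tuple of belast (thead v) (behead v)], last (thead v) (behead v)).
have fK : cancel f g.
  move=> v; apply: val_inj; rewrite /= -lastI.
  by case/tupleP: v => x s; rewrite theadE.
have gK : cancel g f.
  move=> [v x]; have := fK (g (v, x)).
  move/(congr1 val) => /= /rcons_inj[e1 e2]; congr (_, _) => //.
  by apply: val_inj.
rewrite -sum1dep_card (reindex g) /=; last by exists f => ? _; [apply: gK|apply: fK].
rewrite (eq_bigl (fun p : L.-tuple T * T => P p.1 && (p.2 \in F p.1))); last first.
  by move=> p; rewrite P'E // size_tuple.
rewrite -(pair_big_dep (fun v : L.-tuple T => P v) (fun v x => x \in F v) (fun _ _ => 1)) /=.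
by apply: eq_bigr => v _; rewrite sum1_card.
Qed.

Section Embeddings.
Variables (n d : nat) (x0 : 'I_n).
Local Notation V := 'I_n.
Local Notation q := (d - 1).
Local Notation G := (graphs n d).
Local Notation nth := (nth x0).
Implicit Types (E H : {set {set V}}) (v : seq V) (tr cl : seq (nat * nat)).

(** A pattern graph is a list [tr] of pairs of positions, placed by sending position [i] to the
    [i]-th entry of [v]. Pairs are kept increasing (see [fit]), so that distinct pairs give distinct
    edges. *)
Definition edges_at tr v : {set {set V}} :=
  [set f | f \in [seq [set nth v p.1; nth v p.2] | p <- tr]].

Definition emb E tr v := uniq v && all (fun p => adj E (nth v p.1) (nth v p.2)) tr.

Lemma emb_edges E tr v : emb E tr v = uniq v && (edges_at tr v \subset E).
Proof.
rewrite /emb; congr (_ && _); apply/allP/subsetP => [h f|h p pt].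
  by rewrite inE => /mapP[p /h pE ->].
by apply: h; rewrite inE; apply/mapP; exists p.
Qed.

Lemma card_edges_at tr v : #|edges_at tr v| <= size tr.
Proof.
rewrite -(size_map (fun p => [set nth v p.1; nth v p.2]) tr).
rewrite /edges_at cardsE; exact: card_size.
Qed.

Definition fit tr k := all (fun p => (p.1 < p.2) && (p.2 < k)) tr.

Definition touches tr i := has (fun p => (p.1 == i) || (p.2 == i)) tr.

(** [cnt_chord] is applied to one chord after another. Both ends of a chord already lie on an edge
    of [tr], and [fit] with [uniq] makes the chord a new edge. *)
Lemma cnt_chords v tr cl :
  uniq v -> fit (tr ++ cl) (size v) -> uniq (cl ++ tr) ->
  all (fun p => touches tr p.1 && touches tr p.2) cl ->
  2 * (2 * (size tr + size cl) + 4 * d + 2 * (d * d)) <= n * d ->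
  cnt d (edges_at (cl ++ tr) v) * (n * d) ^ size cl <=
    (2 * q ^ 2) ^ size cl * cnt d (edges_at tr v).
Proof.
move=> uv; elim: cl => [|[i j] cl IH] /=; first by rewrite muln1 mul1n.
rewrite /fit all_cat /= => /and3P[ftr fij fcl] /andP[nij ucl] /andP[tij tcl] big.
have -> : edges_at ((i, j) :: cl ++ tr) v = [set nth v i; nth v j] |: edges_at (cl ++ tr) v.
  by apply/setP => f; rewrite !inE.
have {}IH := IH _ ucl tcl _; rewrite /fit all_cat ftr fcl in IH.
have {}IH := IH isT.
have inc a : touches tr a -> exists b, [set nth v a; nth v b] \in edges_at (cl ++ tr) v.
  case/hasP => -[b c] bc /= /orP[]/eqP<-; [exists c|exists b]; rewrite inE map_cat mem_cat;
    apply/orP; right; apply/mapP; exists (b, c) => //=; by rewrite setUC.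
case/andP: tij => /inc[b Hb] /inc[c Hc].
have notin : [set nth v i; nth v j] \notin edges_at (cl ++ tr) v.
  apply: contraNN nij; rewrite inE => /mapP[[a e] ae /= /eqP].
  have /andP[ltae lte] : (a < e) && (e < size v).
    have := ae; rewrite mem_cat => /orP[/(allP fcl)|/(allP ftr)] //.
  case/andP: fij => ltij ltj.
  have lta := ltn_trans ltae lte; have lti := ltn_trans ltij ltj.
  rewrite set2_eq !nth_uniq // => /orP[/andP[/eqP-> /eqP->]|/andP[/eqP ei /eqP ej]] //.
  by rewrite ei ej in ltij; have := ltn_trans ltij ltae; rewrite ltnn.
have ce := card_edges_at (cl ++ tr) v; rewrite size_cat in ce.
have := cnt_chord (d := d) notin Hb Hc _.
have -> : (2 * (2 * #|edges_at (cl ++ tr) v| + 4 * d + 2 * (d * d)) <= n * d) = true.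
  move: #|_| ce big => s; lia.
move=> /(_ isT) one.
have {}IH : cnt d (edges_at (cl ++ tr) v) * (n * d) ^ size cl <=
     (2 * q ^ 2) ^ size cl * cnt d (edges_at tr v) by apply: IH; lia.
rewrite 2![_ ^ (size cl).+1]expnS mulnA; apply: (leq_trans (leq_mul one (leqnn _))).
by rewrite -2![2 * q ^ 2 * _ * _]mulnA leq_mul2l IH orbT.
Qed.

Lemma sum_emb tr L :
  \sum_(E in G) #|[set v : L.-tuple V | emb E tr v]| =
  \sum_(v : L.-tuple V | uniq v) cnt d (edges_at tr v).
Proof.
under eq_bigr => E _ do rewrite -sum1dep_card.
rewrite (exchange_big_dep (fun v : L.-tuple V => uniq v)) /=; last first.
  by move=> E v _; rewrite emb_edges => /andP[].
apply: eq_bigr => v uv; rewrite /cnt -sum1dep_card; apply: eq_bigl => E.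
by rewrite emb_edges uv.
Qed.

Lemma sum_emb_chords L tr cl c :
  fit (tr ++ cl) L -> uniq (cl ++ tr) ->
  all (fun p => touches tr p.1 && touches tr p.2) cl ->
  2 * (2 * (size tr + size cl) + 4 * d + 2 * (d * d)) <= n * d ->
  (forall E, E \in G -> #|[set v : L.-tuple V | emb E tr v]| <= c) ->
  (\sum_(E in G) #|[set v : L.-tuple V | emb E (cl ++ tr) v]|) * (n * d) ^ size cl <=
  (2 * q ^ 2) ^ size cl * (#|G| * c).
Proof.
move=> fi un to big hc; rewrite sum_emb big_distrl /=.
apply: (@leq_trans ((2 * q ^ 2) ^ size cl * \sum_(v : L.-tuple V | uniq v) cnt d (edges_at tr v))).
  by rewrite big_distrr /=; apply: leq_sum => v uv; apply: cnt_chords => //; rewrite size_tuple.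
by rewrite leq_mul2l -sum_emb -sum_nat_const leq_sum ?orbT.
Qed.

(** Used with [par i < i], so that copies can be built vertex by vertex. *)
Definition tree (par : nat -> nat) L := [seq (par i, i) | i <- iota 1 L].

Lemma emb_tree_rcons E par v x : par (size v) < size v ->
  (forall i, 0 < i -> par i < i) -> E \in G ->
  emb E (tree par (size v)) (rcons v x) =
  emb E (tree par (size v).-1) v && (x \in nbr E (nth v (par (size v))) :\: [set y in v]).
Proof.
move=> lt parlt EG; rewrite /emb rcons_uniq !inE.
have -> : tree par (size v) = rcons (tree par (size v).-1) (par (size v), size v).
  rewrite /tree -map_rcons; congr map.
  by case: (size v) lt => // m _; have := iotaD 1 m 1; rewrite addn1 add1n cats1.
rewrite all_rcons /= nth_rcons lt nth_rcons ltnn eqxx.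
have -> : all (fun p => adj E (nth (rcons v x) p.1) (nth (rcons v x) p.2)) (tree par (size v).-1)
    = all (fun p => adj E (nth v p.1) (nth v p.2)) (tree par (size v).-1).
  apply: eq_in_all => p /mapP[i]; rewrite mem_iota => ii -> /=.
  have i0 : 0 < i by lia.
  have := parlt _ i0; rewrite !nth_rcons => lti.
  have -> : par i < size v by lia.
  by have -> : i < size v by lia.
by rewrite -!andbA; case: (x \in v) => /=; rewrite ?andbF //=; case: (uniq v) => //=; rewrite andbC.
Qed.

(** The root has [n] images and vertex 1 at most [d]. Every later vertex has at most [q], because
    the image of its parent already has a used neighbour. *)
Lemma card_emb_tree E par L : (forall i, 0 < i -> par i < i) -> E \in G -> 0 < L ->
  #|[set v : L.+1.-tuple V | emb E (tree par L) v]| <= n * d * q ^ (L - 1).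
Proof.
move=> parlt EG; have step M (v : M.+1.-tuple V) x : 
  emb E (tree par M.+1) (rcons v x) = emb E (tree par M) v &&
     (x \in nbr E (nth v (par M.+1)) :\: [set y in v]).
  have := @emb_tree_rcons E par v x; rewrite size_tuple => -> //; exact: parlt.
case: L => // L _; elim: L => [|L IH].
  rewrite (card_rcons_tuple (L := 1) (P := xpredT) (F := fun v => nbr E (nth v 0) :\: [set y in v])).
    rewrite expn0 muln1; apply: (@leq_trans (\sum_(v : 1.-tuple V) d)).
      by apply: leq_sum => v _; rewrite -(card_nbr (nth v 0) EG); apply/subset_leq_card/subsetDl.
    by rewrite sum_nat_const card_tuple card_ord expn1.
  move=> v x sv; have st := step 0 (Tuple (introT eqP sv)) x; rewrite /= in st; rewrite st.
  have -> : par 1 = 0 by have := parlt 1 isT; lia.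
  by rewrite /emb /=; case: v sv {st} => // a [|b] //.
rewrite (card_rcons_tuple (L := L.+2) (P := emb E (tree par L.+1))
   (F := fun v => nbr E (nth v (par L.+2)) :\: [set y in v])); last first.
  by move=> v x sv; apply: (step L.+1 (Tuple (introT eqP sv))).
apply: (@leq_trans (\sum_(v : L.+2.-tuple V | emb E (tree par L.+1) v) q)).
  apply: leq_sum => v /andP[uv ev].
  have adjp i : 0 < i < L.+2 -> adj E (nth v (par i)) (nth v i).
    by move=> ii; have := allP ev (par i, i); apply; apply/mapP; exists i => //; rewrite mem_iota.
  (* The used neighbour [w]: the image of vertex 1 if the parent is the root, otherwise the image of
     the parent's parent. *)
  have [w wv wa] : exists2 w, w \in (v : seq V) & adj E (nth v (par L.+2)) w.
    have := parlt L.+2 isT; case ep : (par L.+2) => [|p] ltp.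
      exists (nth v 1); first by rewrite mem_nth // size_tuple.
      by have := adjp 1 isT; have -> : par 1 = 0 by have := parlt 1 isT; lia.
    exists (nth v (par p.+1)).
      by rewrite mem_nth // size_tuple; have := parlt p.+1 isT; lia.
    by rewrite adjC; apply: adjp; lia.
  have -> : q = #|nbr E (nth v (par L.+2)) :\ w|.
    have := cardsD1 w (nbr E (nth v (par L.+2))); rewrite inE wa (card_nbr _ EG) /= => ->.
    by rewrite addKn.
  apply/subset_leq_card/subsetP => y; rewrite !inE => /andP[yv ->]; rewrite andbT.
  by apply: contraNneq yv => ->.
rewrite sum_nat_const -sum1_card; move: IH; rewrite -sum1dep_card => IH.
apply: (leq_trans (leq_mul IH (leqnn _))).
by rewrite -mulnA -expnSr !subn1.
Qed.

Definition upth E v := uniq v && sorted (adj E) v.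

Lemma upth_emb E v : upth E v = emb E (tree predn (size v).-1) v.
Proof.
rewrite /upth /emb; congr (_ && _); apply/(sortedP x0)/allP => [h p|h i ii].
  by move=> /mapP[i]; rewrite mem_iota => ii ->; rewrite /=; have := h i.-1; rewrite prednK; [apply|]; lia.
by apply: (h (i, i.+1)); apply/mapP; exists i.+1 => //; rewrite mem_iota; lia.
Qed.

Lemma predn_lt i : 0 < i -> i.-1 < i. Proof. by case: i. Qed.

Lemma card_upth E L : E \in G -> 0 < L ->
  #|[set v : L.+1.-tuple V | upth E v]| <= n * d * q ^ (L - 1).
Proof.
move=> EG L0; apply: leq_trans (card_emb_tree predn_lt EG L0).
by apply/subset_leq_card/subsetP => v; rewrite !inE upth_emb size_tuple.
Qed.

Lemma touches_tree par L i : (forall i, 0 < i -> par i < i) -> 0 < L -> i <= L ->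
  touches (tree par L) i.
Proof.
move=> parlt L0 iL; apply/hasP; case: i iL => [|i] iL.
  exists (par 1, 1); first by apply/mapP; exists 1 => //; rewrite mem_iota; lia.
  by have := parlt 1 isT; rewrite /=; case: (par 1).
exists (par i.+1, i.+1); last by rewrite eqxx orbT.
by apply/mapP; exists i.+1 => //; rewrite mem_iota; lia.
Qed.

Lemma size_tree par L : size (tree par L) = L.
Proof. by rewrite size_map size_iota. Qed.

Lemma sum_tree_chords par L cl : (forall i, 0 < i -> par i < i) -> 0 < L ->
  all (fun p => [&& p.1 < p.2, p.2 <= L & p.1 != par p.2]) cl -> uniq cl ->
  2 * (2 * (L + size cl) + 4 * d + 2 * (d * d)) <= n * d ->
  (\sum_(E in G) #|[set v : L.+1.-tuple V | emb E (cl ++ tree par L) v]|) *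
    (n * d) ^ size cl <=
  (2 * q ^ 2) ^ size cl * (#|G| * (n * d * q ^ (L - 1))).
Proof.
move=> parlt L0 acl ucl big; apply: sum_emb_chords.
- rewrite /fit all_cat; apply/andP; split.
    apply/allP => p /mapP[i]; rewrite mem_iota => ii -> /=; have := parlt i; lia.
  by apply: sub_all acl => p /= /and3P[-> pL _]; rewrite ltnS.
- rewrite cat_uniq ucl /= map_inj_in_uniq ?iota_uniq; last by move=> i j _ _ [].
  rewrite andbT; apply/hasPn => p /mapP[i _ ->]; apply/negP => /(allP acl) /=.
  by rewrite eqxx !andbF.
- apply: sub_all acl => p /= /and3P[p1 p2 _].
  by rewrite !touches_tree //; lia.
- by rewrite size_tree.
by move=> E EG; apply: card_emb_tree.
Qed.

(** A path whose end sees an earlier vertex again. For [i < L.-1] this is a lost extension of the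
    path; for [i = 0] it is a rooted cycle. *)
Definition rho E L i := #|[set v : L.+1.-tuple V | upth E v && adj E (nth v i) (nth v L)]|.

Lemma sum_rho L i : 0 < n * d -> 1 < L -> i < L.-1 ->
  2 * (2 * (L + 1) + 4 * d + 2 * (d * d)) <= n * d ->
  \sum_(E in G) rho E L i <= 2 * q ^ L.+1 * #|G|.
Proof.
move=> nd0 L1 iL big.
have := @sum_tree_chords predn L [:: (i, L)] predn_lt _ _ _ big.
rewrite /= expn1 => /(_ (ltnW L1)) h.
have {h} := h _ isT; rewrite andbT => h.
rewrite -(leq_pmul2r nd0); apply: (leq_trans _ (leq_trans (h _) _)); first 1 last.
- by apply/and3P; split => //; lia.
- have -> : q ^ L.+1 = q ^ 2 * q ^ (L - 1) by rewrite -expnD; congr (_ ^ _); lia.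
  by apply/eq_leq; rewrite !mulnA; lia.
rewrite leq_mul2r; apply/orP; right; apply: leq_sum => E EG.
apply/subset_leq_card/subsetP => v; rewrite !inE => /andP[uv a].
by move: uv; rewrite upth_emb size_tuple /emb /= => /andP[-> ->]; rewrite a.
Qed.

(** The last vertex has [d] neighbours: its predecessor, those further back on the path, counted by
    [rho], and the possible extensions. *)
Lemma card_upth_rec E L : E \in G -> 0 < L ->
  #|[set v : L.+2.-tuple V | upth E v]| + \sum_(i < L.-1) rho E L i =
  q * #|[set v : L.+1.-tuple V | upth E v]|.
Proof.
move=> EG L0.
rewrite (card_rcons_tuple (L := L.+1) (P := upth E) (F := fun v => nbr E (nth v L) :\: [set y in v])); last first.
  move=> v x sv; rewrite !upth_emb size_rcons /= sv.
  have := @emb_tree_rcons E predn v x; rewrite sv; apply => //.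
  exact: predn_lt.
have rhoE (i : 'I_L.-1) : rho E L i =
    \sum_(v : L.+1.-tuple V | upth E v) adj E (nth v i) (nth v L).
  rewrite /rho -sum1dep_card big_mkcondr; apply: eq_bigr => v _.
  by case: (adj _ _ _).
rewrite (eq_bigr _ (fun i _ => rhoE i)) exchange_big -big_split /=.
rewrite mulnC -[in RHS]sum1dep_card big_distrl /=.
apply: eq_bigr => v uv; rewrite mul1n.
have dE := card_nbr (nth v L) EG.
rewrite -(cardsID [set y in v]) in dE.
have cE : #|nbr E (nth v L) :&: [set y in v]| =
    (\sum_(i < L.-1) adj E (nth v i) (nth v L)).+1.
  have -> : #|nbr E (nth v L) :&: [set y in v]| = count (adj E (nth v L)) v.
    rewrite -size_filter -(card_uniqP _); last by rewrite filter_uniq //; case/andP: uv.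
    by apply: eq_card => y; rewrite !inE mem_filter.
  rewrite -sum1_count big_mkcond (big_nth x0) big_mkord size_tuple.
  case: L L0 v uv {rhoE dE} => // M _ v /andP[_ /(sortedP x0) so].
  rewrite !big_ord_recr /= (adjxx _ EG) addn0 adjC so ?size_tuple // addn1; congr (_.+1).
  by apply: eq_bigr => i _; rewrite adjC; case: (adj _ _ _).
by rewrite cE in dE; rewrite -dE addSn subn1 /= addnC.
Qed.

(** Iterating [card_upth_rec], the step from [L] to [L.+1] adds a mean loss of at most
    [2 L q ^ L.+2], and [L ^ 2 + L <= L.+1 ^ 2]. *)
Lemma sum_upth_ge L : 0 < n * d ->
  2 * (2 * (L + 1) + 4 * d + 2 * (d * d)) <= n * d ->
  #|G| * (n * d * q ^ L) <=
  \sum_(E in G) #|[set v : L.+2.-tuple V | upth E v]| + 2 * L ^ 2 * q ^ L.+1 * #|G|.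
Proof.
move=> nd0; elim: L => [|L IH] big.
  rewrite !expn0 muln1 -[in X in X <= _]sum_nat_const; apply: leq_trans (leq_addr _ _).
  apply: leq_sum => E EG; rewrite -(card_arcs EG).
  pose f (p : V * V) : 2.-tuple V := [tuple p.1; p.2].
  have fI : injective f by move=> [a b] [c e] [-> ->].
  rewrite -(card_imset _ fI); apply/subset_leq_card/subsetP => v /imsetP[[a b]].
  rewrite inE => ab ->; rewrite inE /upth /= inE ab !andbT.
  exact: (adj_neq EG ab).
have {}IH : #|G| * (n * d * q ^ L) <= \sum_(E in G) #|[set v : L.+2.-tuple V | upth E v]|
    + 2 * L ^ 2 * q ^ L.+1 * #|G| by apply: IH; lia.
have rec : q * \sum_(E in G) #|[set v : L.+2.-tuple V | upth E v]| <=
  \sum_(E in G) #|[set v : L.+3.-tuple V | upth E v]| + L * (2 * q ^ L.+2 * #|G|).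
  rewrite big_distrr /=.
  have -> : \sum_(E in G) q * #|[set v : L.+2.-tuple V | upth E v]| =
     \sum_(E in G) (#|[set v : L.+3.-tuple V | upth E v]| + \sum_(i < L) rho E L.+1 i).
    by apply: eq_bigr => E EG; rewrite card_upth_rec.
  rewrite big_split /= leq_add2l exchange_big /=.
  apply: (@leq_trans (\sum_(i < L) 2 * q ^ L.+2 * #|G|)); last by rewrite sum_nat_const card_ord.
  apply: leq_sum => i _.
  by apply: sum_rho => //; have := ltn_ord i; lia.
have -> : #|G| * (n * d * q ^ L.+1) = q * (#|G| * (n * d * q ^ L)) by rewrite expnS; lia.
apply: (leq_trans (leq_mul (leqnn q) IH)); rewrite mulnDr.
apply: (leq_trans (leq_add rec (leqnn _))); rewrite -addnA leq_add2l.
have -> : q * (2 * L ^ 2 * q ^ L.+1 * #|G|) = L ^ 2 * (2 * q ^ L.+2 * #|G|).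
  by rewrite [q ^ L.+2]expnS; lia.
have -> : 2 * L.+1 ^ 2 * q ^ L.+2 * #|G| = L.+1 ^ 2 * (2 * q ^ L.+2 * #|G|) by lia.
by rewrite -mulnDl leq_mul2r; apply/orP; right; lia.
Qed.

End Embeddings.

(** * Cycles as edge sets *)

Section CycleEdges.
Variables (V : finType) (x0 : V).
Local Notation nth := (nth x0).
Implicit Types (t s : seq V) (x y a b : V).

(** A cycle is its set of edges, which forgets root and direction; [next] wraps around at the end of
    [t]. *)
Definition cyc_edges t : {set {set V}} := [set f | f \in [seq [set x; next t x] | x <- t]].

Lemma mem_cyc_edges t x : x \in t -> [set x; next t x] \in cyc_edges t.
Proof. by move=> xt; rewrite inE; apply/mapP; exists x. Qed.

Lemma cyc_edges_rot i t : uniq t -> cyc_edges (rot i t) = cyc_edges t.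
Proof.
move=> ut; apply/setP => f; rewrite !inE; apply/mapP/mapP => -[x xt ->]; exists x;
  rewrite ?mem_rot ?next_rot //; by rewrite mem_rot in xt.
Qed.

Lemma cyc_edges_rev t : uniq t -> cyc_edges (rev t) = cyc_edges t.
Proof.
move=> ut; apply/setP => f; rewrite !inE; apply/mapP/mapP => -[x xt ->].
  exists (prev t x); first by rewrite mem_prev; rewrite mem_rev in xt.
  by rewrite next_rev // next_prev // setUC.
exists (next t x); first by rewrite mem_rev mem_next.
by rewrite next_rev // prev_next // setUC.
Qed.

Lemma next_next_neq t x : uniq t -> 2 < size t -> x \in t -> next t (next t x) != x.
Proof.
move=> ut st xt; have [i s rE] := rot_to xt.
have us : uniq (x :: s) by rewrite -rE rot_uniq.
have ss : 2 < size (x :: s) by rewrite -rE size_rot.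
rewrite -!(next_rot i ut) rE.
case: s us ss {rE} => [|y [|z s]] //= /and4P[]; rewrite !inE !negb_or.
move=> /and3P[xy xz xs] _ _ _ _.
by rewrite eqxx (eq_sym y x) (negPf xy) eqxx eq_sym.
Qed.

Lemma next_neq_prev t x : uniq t -> 2 < size t -> x \in t -> next t x != prev t x.
Proof.
move=> ut st xt; apply: contraNneq (next_next_neq ut st xt) => ->.
by rewrite next_prev.
Qed.

Lemma cyc_edges_nbr t x y : uniq t -> [set x; y] \in cyc_edges t ->
  [/\ x \in t, y \in t & y = next t x \/ y = prev t x].
Proof.
move=> ut; rewrite inE => /mapP[z zt /eqP]; rewrite set2_eq.
case/orP => /andP[/eqP-> /eqP->]; split; rewrite ?mem_next //; auto.
by right; rewrite prev_next.
Qed.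

Lemma card_cyc_edges t : uniq t -> 2 < size t -> #|cyc_edges t| = size t.
Proof.
move=> ut st; rewrite /cyc_edges cardsE -(size_map (fun x => [set x; next t x]) t).
apply/card_uniqP; rewrite map_inj_in_uniq // => x y xt yt /eqP.
rewrite set2_eq => /orP[/andP[/eqP //]|/andP[/eqP xE /eqP yE]].
by have := next_next_neq ut st yt; rewrite -xE yE eqxx.
Qed.

Lemma card_mem_cyc_edges t f : uniq t -> 2 < size t -> f \in cyc_edges t -> #|f| = 2.
Proof.
move=> ut st; rewrite inE => /mapP[x xt ->]; rewrite cards2.
case: eqP => // xE; have := next_next_neq ut st xt.
by rewrite -!xE eqxx.
Qed.

Lemma prev_head b s : uniq (b :: s) -> prev (b :: s) b = last b s.
Proof.
move=> us; rewrite prev_nth mem_head; have -> : index b s = size s.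
  by apply: memNindex; case/andP: us.
exact: nth_last.
Qed.

(** Rotate, after a reversal if [b] precedes [a]. Arguments about a cycle through a given edge start
    here, with that edge as the closing one. *)
Lemma cyc_edges_start t a b : uniq t -> [set a; b] \in cyc_edges t ->
  exists s, [/\ uniq (b :: s), size (b :: s) = size t,
    cyc_edges (b :: s) = cyc_edges t & last b s = a].
Proof.
have main t' : uniq t' -> a \in t' -> b = next t' a ->
    exists s, [/\ uniq (b :: s), size (b :: s) = size t',
    cyc_edges (b :: s) = cyc_edges t' & last b s = a].
  move=> ut at' bE; have bt : b \in t' by rewrite bE mem_next.
  have [i s rE] := rot_to bt; exists s; rewrite -rE rot_uniq size_rot cyc_edges_rot //.
  split => //; rewrite -prev_head; last by rewrite -rE rot_uniq.
  by rewrite -rE prev_rot // bE prev_next.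
move=> ut /(cyc_edges_nbr ut)[at_ bt [bE|bE]]; first exact: main.
have := main (rev t); rewrite rev_uniq mem_rev size_rev cyc_edges_rev // next_rev //.
by apply.
Qed.

Lemma nth_next t i : uniq t -> i.+1 < size t -> nth t i.+1 = next t (nth t i).
Proof.
move=> ut it; rewrite next_nth mem_nth; last by apply: ltnW.
case: t ut it => // y p ut it; rewrite index_uniq //; last by apply: ltnW.
by rewrite /= (set_nth_default y).
Qed.

Lemma next_last_head t : uniq t -> 0 < size t -> next t (nth t (size t).-1) = nth t 0.
Proof.
move=> ut st; rewrite next_nth mem_nth; last by rewrite prednK.
case: t ut st => // y p ut st; rewrite index_uniq //= nth_default //.
Qed.

(** Once a vertex and its predecessor agree, so does the successor: it is the other one of the two
    cycle neighbours, which are distinct because there are at least three vertices. *)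
Lemma cyc_edges_inj b s s' : uniq (b :: s) -> uniq (b :: s') -> 2 < size (b :: s) ->
  size s = size s' -> last b s = last b s' -> cyc_edges (b :: s) = cyc_edges (b :: s') ->
  s = s'.
Proof.
move=> us us' ss eqs eql eqc.
suff all_i i : i <= size s -> nth (b :: s) i = nth (b :: s') i /\
    prev (b :: s) (nth (b :: s) i) = prev (b :: s') (nth (b :: s') i).
  by apply: (@eq_from_nth _ x0) => // i /all_i[].
elim: i => [_|i IH lt_i]; first by split; rewrite // -[nth (b :: s) 0]/b -[nth (b :: s') 0]/b !prev_head.
have [e1 e2] := IH (ltnW lt_i).
have is' : i < size (b :: s') by rewrite /= -eqs; apply: ltnW.
have i1 : nth (b :: s) i.+1 = next (b :: s) (nth (b :: s) i) by apply: nth_next.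
have i1' : nth (b :: s') i.+1 = next (b :: s') (nth (b :: s') i).
  by apply: nth_next => //; rewrite /= -eqs.
set x := nth (b :: s) i in e1 e2 i1.
have xs : x \in b :: s by apply: mem_nth; apply: ltnW.
have xs' : x \in b :: s' by rewrite e1 mem_nth.
rewrite i1 i1' -e1 !prev_next //; split=> //.
have : [set x; next (b :: s') x] \in cyc_edges (b :: s) by rewrite eqc mem_cyc_edges.
case/(cyc_edges_nbr us) => _ _ [->//|nE].
have ss' : 2 < size (b :: s') by rewrite /= -eqs.
by have := next_neq_prev us' ss' xs'; rewrite nE e2 -e1 eqxx.
Qed.

Lemma cyc_edges_nth t i : uniq t -> i.+1 < size t ->
  [set nth t i; nth t i.+1] \in cyc_edges t.
Proof.
by move=> ut it; rewrite nth_next //; apply/mem_cyc_edges/mem_nth/ltnW.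
Qed.

Lemma cyc_edges_last t : uniq t -> 0 < size t ->
  [set nth t 0; nth t (size t).-1] \in cyc_edges t.
Proof.
move=> ut t0; rewrite -next_last_head // setUC; apply/mem_cyc_edges/mem_nth.
by rewrite prednK.
Qed.

Lemma cyc_edges_subset t (E : {set {set V}}) : uniq t ->
  (forall i, i.+1 < size t -> [set nth t i; nth t i.+1] \in E) ->
  [set nth t 0; nth t (size t).-1] \in E -> cyc_edges t \subset E.
Proof.
move=> ut h h0; apply/subsetP => f; rewrite inE => /mapP[x /(nthP x0)[i it <-] ->].
case: (ltnP i.+1 (size t)) => i1; first by rewrite -nth_next // h.
have t0 : 0 < size t by apply: leq_ltn_trans it.
have -> : i = (size t).-1 by apply/eqP; rewrite -eqSS prednK // eqn_leq it i1.
by rewrite next_last_head // setUC.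
Qed.

Definition is_cyc k (al : {set {set V}}) :=
  (2 < k) && [exists t : k.-tuple V, uniq t && (cyc_edges t == al)].

Lemma is_cycP k al : reflect (exists t : seq V, [/\ 2 < size t, size t = k, uniq t & cyc_edges t = al]) (is_cyc k al).
Proof.
apply: (iffP andP) => [[k2 /existsP[t /andP[ut /eqP ct]]]|[t [t2 tk ut ct]]].
  by exists t; split; rewrite ?size_tuple.
split; first by rewrite -tk.
by apply/existsP; exists (Tuple (introT eqP tk)); rewrite ut ct eqxx.
Qed.

Lemma card_is_cyc k al : is_cyc k al -> #|al| = k.
Proof. by case/is_cycP => t [t2 <- ut <-]; apply: card_cyc_edges. Qed.

(** A rooted directed cycle is determined by the arc formed by its last and first vertices, and all
    [2 * k] arcs of the cycle occur. *)
Lemma card_cyc_tuples k al : is_cyc k al ->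
  #|[set t : k.-tuple V | uniq t && (cyc_edges t == al)]| = 2 * k.
Proof.
move=> kal; have k2 : 2 < k by case/andP: kal.
have /is_cycP[t0 [t02 t0k ut0 ct0]] := kal.
rewrite -[in RHS](card_is_cyc kal) -card_ordered_pairs; last first.
  by move=> f; rewrite -ct0; apply: card_mem_cyc_edges.
pose f (t : k.-tuple V) := (nth t k.-1, nth t 0).
have fI : {in [set t : k.-tuple V | uniq t && (cyc_edges t == al)] &, injective f}.
  move=> t t'; rewrite !inE => /andP[ut /eqP ct] /andP[ut' /eqP ct'] [e1 e2].
  apply: val_inj; rewrite -[LHS]/(tval t) -[RHS]/(tval t').
  have := size_tuple t; have := size_tuple t'.
  move: ut ut' ct ct' e1 e2; case: (tval t) => [|b s]; first by move=> ? ? ? ? ? ? ?; rewrite /=; lia.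
  case: (tval t') => [|b' s']; first by move=> ? ? ? ? ? ?; rewrite /=; lia.
  move=> ut ut' ct ct' e1 /= e2 s1 s2; subst b'; congr (_ :: _).
  apply: (cyc_edges_inj ut ut') => //; rewrite ?ct ?ct' //=; try lia.
  move: e1; have -> : k.-1 = size s by lia.
  rewrite {2}(_ : size s = size s'); last by lia.
  by rewrite !nth_last.
rewrite -(card_in_imset fI); congr #|pred_of_set _|; apply/setP => -[a b].
apply/imsetP/idP => [[t]|].
  rewrite inE => /andP[ut /eqP <-] [-> ->]; rewrite inE /=.
  have e := next_last_head ut; rewrite size_tuple in e.
  rewrite -e; last by lia.
  by apply: mem_cyc_edges; rewrite mem_nth // size_tuple; lia.
rewrite inE /= -ct0 => /(cyc_edges_start ut0)[s [us ss cs ls]].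
have sk : size (b :: s) == k by rewrite ss t0k.
exists (Tuple sk); first by rewrite inE us cs ct0 eqxx.
by rewrite /f /= -ls; congr (_, _); rewrite -(eqP sk) /= nth_last.
Qed.

Definition cycle_count (E : {set {set V}}) k := #|[set al | is_cyc k al && (al \subset E)]|.

Lemma card_rooted_cycles (E : {set {set V}}) k : 2 < k ->
  #|[set t : k.-tuple V | uniq t && (cyc_edges t \subset E)]| = 2 * k * cycle_count E k.
Proof.
move=> k2; have -> : [set t : k.-tuple V | uniq t && (cyc_edges t \subset E)] =
   [set t : k.-tuple V | uniq t && (cyc_edges t \in [set al | is_cyc k al && (al \subset E)])].
  apply/setP => t; rewrite !inE; case: (boolP (uniq t)) => ut //=.
  suff -> : is_cyc k (cyc_edges t) by [].
  by apply/is_cycP; exists t; rewrite size_tuple.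
rewrite (card_fibers (fun t : k.-tuple V => cyc_edges t)) mulnC -sum_nat_const.
by apply: eq_bigr => al; rewrite inE => /andP[kal _]; apply: card_cyc_tuples.
Qed.

(** Only cycles through [f1] or [f2] can disappear and only those through [g1] or [g2] can appear.
    The two hypotheses on short cycles leave [al0] in the first class and nothing in the second. *)
Lemma cycle_count_switch (E E' : {set {set V}}) (f1 f2 g1 g2 : {set V}) k r al0 :
  E' = g1 |: (g2 |: (E :\ f1 :\ f2)) -> f1 != g1 -> f1 != g2 ->
  is_cyc k al0 -> al0 \subset E -> f1 \in al0 ->
  (forall j al, j <= r -> is_cyc j al -> al \subset E -> (f1 \in al) || (f2 \in al) -> al = al0) ->
  (forall j al, j <= r -> is_cyc j al -> al \subset E' -> (g1 \notin al) && (g2 \notin al)) ->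
  forall j, j <= r -> cycle_count E j = cycle_count E' j + (j == k).
Proof.
move=> E'E fg1 fg2 k0 s0 f0 h1 h2 j jr; rewrite /cycle_count.
have f1E' : f1 \notin E' by rewrite E'E !inE (negPf fg1) (negPf fg2) eqxx andbF.
have al0E' : ~~ (al0 \subset E') by apply: contraNN f1E' => /subsetP; apply.
have sub al : is_cyc j al -> (al \subset E) = (al \subset E') || (al == al0).
  move=> jal; apply/idP/orP => [alE|[alE'|/eqP->//]].
    case: (boolP ((f1 \in al) || (f2 \in al))) => [fa|]; first by right; apply/eqP/(h1 j).
    rewrite negb_or => /andP[n1 n2]; left; apply/subsetP => x xal; rewrite E'E !inE.
    rewrite (subsetP alE) // andbT; apply/orP; right; apply/orP; right.
    by apply/andP; split; [apply: contraNneq n2 => <-|apply: contraNneq n1 => <-].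
  have /andP[n1 n2] := h2 j al jr jal alE'.
  apply/subsetP => x xal; have := subsetP alE' _ xal; rewrite E'E !inE.
  case/or3P => [/eqP xe|/eqP xe|/and3P[] //]; first by rewrite -xe xal in n1.
  by rewrite -xe xal in n2.
case: (eqVneq j k) => [jk|njk]; last first.
  rewrite addn0; apply: eq_card => al; rewrite !inE; case: (boolP (is_cyc j al)) => //= jal.
  rewrite sub //; case: eqP => [alE|]; last by rewrite orbF.
  by rewrite -(card_is_cyc jal) -(card_is_cyc k0) alE eqxx in njk.
rewrite addn1 -jk in k0 *.
have -> : [set al | is_cyc j al & al \subset E] = al0 |: [set al | is_cyc j al & al \subset E'].
  apply/setP => al; rewrite !inE; case: (eqVneq al al0) => [->|na] /=; first by rewrite k0 s0.
  by case: (boolP (is_cyc j al)) => //= jal; rewrite sub // (negPf na) orbF.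
by rewrite cardsU1 inE (negPf al0E') andbF.
Qed.

End CycleEdges.

(** * Detours *)

Lemma geom_sum_le q t : 2 <= q -> q * \sum_(m < t) q ^ m <= 2 * q ^ t.
Proof.
move=> q2; elim: t => [|t IH]; first by rewrite big_ord0 muln0.
rewrite big_ord_recr /= mulnDr; have := leq_add IH (leqnn (q * q ^ t)).
move/leq_trans; apply; rewrite [q ^ t.+1]expnS [X in _ <= X]mul2n -addnn leq_add2r.
by rewrite leq_mul2r q2 orbT.
Qed.

Lemma geom_sum_desc q A r : 2 <= q ->
  \sum_(a < A) (if a < r then q ^ (r - a) else 0) <= 2 * q ^ r.
Proof.
move=> q2; elim: A r => [|A IH] r; first by rewrite big_ord0.
rewrite big_ord_recl /=; case: r => [|r].
  by rewrite big1 // => i _; rewrite /= ltn0.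
rewrite subn0 mul2n -addnn leq_add2l.
have -> : \sum_(i < A) (if bump 0 i < r.+1 then q ^ (r.+1 - bump 0 i) else 0) =
   \sum_(i < A) (if i < r then q ^ (r - i) else 0).
  by apply: eq_bigr => i _; rewrite /bump leq0n add1n ltnS subSS.
by apply: (leq_trans (IH r)); rewrite expnS leq_mul2r q2 orbT.
Qed.

Section Detours.
Variables (n d : nat) (x0 : 'I_n).
Local Notation V := 'I_n.
Local Notation q := (d - 1).
Local Notation G := (graphs n d).
Local Notation nth := (nth x0).
Implicit Types (E : {set {set V}}) (u v z : seq V).

(** [z] holds the inner vertices of an excursion from [u_a] to [u_b]; an empty [z] means a chord.
    The position [a] is charged against [r], since the cycles in question first follow [u] up to
    [u_a]; this makes the sum over [a] geometric. *)
Definition dcond (e : rel V) r u a b z :=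
  [&& a + (size z).+1 <= r, uniq (u ++ z), path e (nth u a) (rcons z (nth u b)), a != b
    & (z == [::]) ==> ((b != a.+1) && (a != b.+1))].

Definition detour (e : rel V) r u :=
  [exists a : 'I_(size u), [exists b : 'I_(size u), [exists m : 'I_r,
    [exists z : m.-tuple V, dcond e r u a b z]]]].

(* A simple path [p] that starts at [u_s], ends on [u] and is not a stretch of
   [u] leaves [u] and comes back to it. *)
Lemma detour_path (e : rel V) r u s p : uniq u -> s < size u ->
  path e (nth u s) p -> uniq (nth u s :: p) -> p != [::] -> last (nth u s) p \in u ->
  (0 < s -> nth u s.-1 != head x0 p) -> p != take (size p) (drop s.+1 u) ->
  s + size p <= r -> detour e r u.
Proof.
move=> uu; elim: p s => // x p IH s su pth up _ lst back fwd sr.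
(* While [p] follows [u] forwards, the common step is dropped and [s] grows. When it first deviates,
   the excursion lasts until the first index [j] at which [p] is back on [u]. *)
case: (boolP ((s.+1 < size u) && (x == nth u s.+1))) => [/andP[s1 /eqP xE]|nx].
  clear back; case: p IH pth up lst fwd sr => [|y p] IH pth up lst fwd sr.
    move: fwd; rewrite /= -cat1s; case: (drop s.+1 u) (drop_nth x0 s1) => // h t [hE _].
    by rewrite /= take0 xE hE eqxx.
  apply: (IH s.+1) => //.
  - by rewrite -xE; case/andP: pth.
  - by rewrite -xE; case/andP: up.
  - by move=> _; move: up; rewrite /= !inE !negb_or => /andP[/andP[_ /andP[]]].
  - apply: contraNneq fwd => pE; apply/eqP.
    by rewrite (drop_nth x0 s1) -xE /= -pE.
  - by move: sr; rewrite /=; lia.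
set P := x :: p in pth up lst back fwd sr *.
have hasu : has (mem u) P.
  by apply/hasP; exists (last (nth u s) P) => //; rewrite /= mem_last.
pose j := find (mem u) P.
have jP : j < size P by rewrite -has_find.
have ju : nth P j \in u by apply: (nth_find x0 hasu).
pose b := index (nth P j) u.
have bu : b < size u by rewrite index_mem.
have nb : nth u b = nth P j by rewrite nth_index.
have jr : j < r by lia.
have sz : size (take j P) == Ordinal jr by rewrite size_take jP.
apply/existsP; exists (Ordinal su); apply/existsP; exists (Ordinal bu).
apply/existsP; exists (Ordinal jr); apply/existsP; exists (Tuple sz).
rewrite /dcond /= nb; apply/and5P; split.
- by rewrite size_take jP; lia.
- rewrite cat_uniq uu /=; apply/andP; split; last first.
    by apply: take_uniq; case/andP: up.
  apply/hasPn => w wt; have /(nthP x0)[i] := wt; rewrite size_take jP => ij.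
  rewrite nth_take // => <-; have := before_find x0 ij; rewrite /= => h.
  by apply/negP => hh; rewrite hh in h.
- rewrite -take_nth //; have := pth; rewrite -{1}(cat_take_drop j.+1 P) cat_path.
  by case/andP.
- apply: contraTneq up => sb; rewrite cons_uniq sb nb mem_nth //.
rewrite -size_eq0 size_take jP; apply/implyP => /eqP j0.
have xb : x = nth u b by rewrite nb j0.
apply/andP; split.
  apply: contraNneq nx => bs; rewrite -bs bu xb /=; exact: eqxx.
apply: contraPneq back => sb; rewrite sb /= => /(_ isT).
by rewrite xb eqxx.
Qed.

(** Parent function of the path [0, ..., K] with a second branch [K + 1, K + 2, ...] that leaves it
    at [a]: a path with an excursion, before the return to [b], which is the chord. *)
Definition branch K a i := if i == K.+1 then a else i.-1.

Definition chord K a b m :=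
  if m == 0 then (if a < b then (a, b) else (b, a)) else (b, K + m).

Definition chords K (c : bool) a b m :=
  chord K a b m :: (if c then [:: (0, K)] else [::]).

(* With [c] set, the path [u] closes up to a cycle and the detour must not use
   its closing edge. *)
Definition drel E (c : bool) u : rel V := fun x y =>
  adj E x y && (c ==> ([set x; y] != [set nth u 0; nth u (size u).-1])).

Definition closes E (c : bool) u := c ==> adj E (nth u 0) (nth u (size u).-1).

(** Listing [u] and then [z] turns a path with a detour into a copy of a tree with one chord, or two
    if the path closes. That the chords are new and distinct follows from [dcond] and [drel], so it
    belongs to the conclusion. *)
Lemma detour_emb E c K r (u : K.+1.-tuple V) a b m (z : m.-tuple V) :
  1 < K -> a <= K -> b <= K -> upth E u -> closes E c u ->
  dcond (drel E c u) r u a b z ->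
  emb x0 E (chords K c a b m ++ tree (branch K a) (K + m)) (u ++ z) /\
  all (fun p => [&& p.1 < p.2, p.2 <= K + m & p.1 != branch K a p.2]) (chords K c a b m) &&
  uniq (chords K c a b m).
Proof.
move=> K1 aK bK /andP[uu su] cl /and5P[ar uz pz nab nz].
have szu : size u = K.+1 by rewrite size_tuple.
have szz : size z = m by rewrite size_tuple.
have nu i : i <= K -> nth (u ++ z) i = nth u i by move=> iK; rewrite nth_cat szu ltnS iK.
have nz' i : nth (u ++ z) (K.+1 + i) = nth z i.
  by rewrite nth_cat szu ltnNge leq_addr /= addKn.
have suP := sortedP x0 su; rewrite szu in suP.
have bK' i : i <= K -> branch K a i = i.-1 by rewrite /branch => iK; case: eqP => //; lia.
have pzP : forall i, i < m.+1 -> drel E c u (nth (nth u a :: rcons z (nth u b)) i)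
    (nth (rcons z (nth u b)) i).
  by move=> i im; have := pathP x0 pz i; apply; rewrite size_rcons szz.
split; last first.
  apply/andP; split; rewrite /chords /chord; case: eqP => [m0|m0] /=.
  - have zn : (z : seq V) == [::] by rewrite -size_eq0 szz m0.
    move: nz; rewrite zn /= => /andP[b1 a1].
    apply/andP; split; last by case: (c) => //=; rewrite bK' //; lia.
    by case: (ltnP a b) => ab /=; rewrite bK' //; lia.
  - apply/andP; split; last by case: (c) => //=; rewrite bK' //; lia.
    rewrite leqnn /=; apply/andP; split; first by lia.
    by rewrite /branch; case: (eqVneq (K + m) K.+1) => e; [rewrite eq_sym | lia].
  - case: c cl pz pzP => //= cl pz pzP; rewrite !inE andbT.
    have := pzP 0 isT; have zn : (z : seq V) = [::] by apply/nilP; rewrite /nilp szz m0.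
    rewrite zn /= /drel /= => /andP[_]; rewrite szu /=.
    by case: (ltnP a b) => _; apply: contraNneq => -[-> ->] //; rewrite setUC.
  - case: c {cl pz pzP} => //=; rewrite !inE andbT; apply/eqP => -[]; lia.
rewrite /emb uz /= all_cat; apply/and3P; split.
- rewrite /chord; case: eqP => [m0|m0] /=.
    have := pzP 0 isT; have zn : (z : seq V) = [::] by apply/nilP; rewrite /nilp szz m0.
    rewrite zn /= /drel => /andP[ab _]; rewrite cats0.
    by case: (ltnP a b) => _ //=; rewrite adjC.
  have := pzP m (leqnn _); rewrite nth_rcons szz ltnn eqxx /drel => /andP[ab _].
  have nthS (h : V) (w : seq V) k : k <> 0 -> nth (h :: w) k = nth w k.-1 by case: k.
  rewrite nu // adjC; move: ab; rewrite nthS // nth_rcons szz.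
  have -> : m.-1 < m by lia.
  have -> : K + m = K.+1 + m.-1 by lia.
  by rewrite nz'.
- case: c cl {pz pzP} => //=; rewrite /closes /= szu /= andbT !nu //.
apply/allP => p /mapP[i]; rewrite mem_iota => ii -> /=.
case: (leqP i K) => iK.
  rewrite bK' // !nu //; last by lia.
  by have := suP i.-1; rewrite prednK; [apply|]; lia.
have [j iE] : exists j, i = K.+1 + j by exists (i - K.+1); lia.
subst i; rewrite nz'.
have := pzP j; have -> : j < m.+1 by lia.
move=> /(_ isT) /andP[]; rewrite [in X in _ -> X]/branch; case: j ii iK => [|j] ii iK.
  by rewrite addn0 eqxx nu //= nth_rcons szz; have -> : 0 < m by lia.
have -> : (K.+1 + j.+1 == K.+1) = false by lia.
have -> : (K.+1 + j.+1).-1 = K.+1 + j by lia.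
rewrite nz' /= !nth_rcons szz.
have -> : j < m by lia.
by have -> : j.+1 < m by lia.
Qed.

Lemma branch_lt K a i : a <= K -> 0 < i -> branch K a i < i.
Proof. by rewrite /branch => aK i0; case: eqP => [->|_]; lia. Qed.

Variable r : nat.
Hypothesis d3 : 3 <= d.
Hypothesis big : 2 * (2 * (2 * r + 4) + 4 * d + 2 * (d * d)) <= n * d.
Hypothesis nd0 : 0 < n * d.

Lemma sum_detour_abm c K a b m : 1 < K -> K <= r.+1 -> a <= K -> b <= K -> a + m.+1 <= r ->
  (\sum_(E in G) #|[set u : K.+1.-tuple V | [&& upth E u, closes E c u &
     [exists z : m.-tuple V, dcond (drel E c u) r u a b z]]]|) * (n * d) ^ c <=
  2 ^ c.+1 * q ^ (K + m.+1 + 2 * c) * #|G|.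
Proof.
move=> K1 Kr aK bK amr.
pose S E := [set p : K.+1.-tuple V * m.-tuple V | [&& upth E p.1, closes E c p.1 &
    dcond (drel E c p.1) r p.1 a b p.2]].
pose ok := all (fun p => [&& p.1 < p.2, p.2 <= K + m & p.1 != branch K a p.2]) (chords K c a b m) &&
  uniq (chords K c a b m).
have leS E : #|[set u : K.+1.-tuple V | [&& upth E u, closes E c u &
     [exists z : m.-tuple V, dcond (drel E c u) r u a b z]]]| <= #|S E|.
  apply: leq_trans (leq_imset_card fst (S E)); apply/subset_leq_card/subsetP => u.
  rewrite inE => /and3P[u1 u2 /existsP[z hz]]; apply/imsetP; exists (u, z) => //.
  by rewrite inE u1 u2.
(* A shape whose chord is a tree edge, or repeats the closing edge, occurs in no graph, by
   [detour_emb]. *)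
case okE : ok; last first.
  rewrite big1 ?mul0n // => E _; apply/eqP; rewrite -leqn0; apply: leq_trans (leS E) _.
  rewrite leqn0 cards_eq0; apply/eqP/setP => -[u z]; rewrite !inE /=.
  apply/negP => /and3P[u1 u2 u3]; have [_] := detour_emb K1 aK bK u1 u2 u3.
  by rewrite -/ok okE.
case/andP: okE => ok1 ok2.
have sc : size (chords K c a b m) = c.+1 by rewrite /chords; case: (c).
have := @sum_tree_chords n d x0 (branch K a) (K + m) (chords K c a b m)
   (fun i => @branch_lt K a i aK) _ ok1 ok2 _.
rewrite sc => h; have {h} : (\sum_(E in G) #|[set v : (K + m).+1.-tuple V |
    emb x0 E (chords K c a b m ++ tree (branch K a) (K + m)) v]|) * (n * d) ^ c.+1 <=
  (2 * q ^ 2) ^ c.+1 * (#|G| * (n * d * q ^ (K + m - 1))).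
  by apply: h; [lia | case: (c) => /=; lia].
move=> h; rewrite -(leq_pmul2r nd0); apply: leq_trans (leq_trans h _).
  rewrite [(n * d) ^ c.+1]expnSr [X in _ <= X]mulnA leq_mul2r leq_mul2r; apply/orP; right; apply/orP; right.
  apply: leq_sum => E EG; apply: leq_trans (leS E) _.
  pose f (p : K.+1.-tuple V * m.-tuple V) : (K + m).+1.-tuple V := [tuple of p.1 ++ p.2].
  have fI : injective f.
    move=> [u z] [u' z'] /(congr1 val) /= /eqP.
    rewrite eqseq_cat ?size_tuple // => /andP[/eqP e1 /eqP e2].
    by congr (_, _); apply: val_inj.
  rewrite -(card_imset _ fI); apply/subset_leq_card/subsetP => v /imsetP[[u z]].
  rewrite [_ \in S E]inE => /and3P[u1 u2 u3] ->; rewrite inE /=.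
  by have [] := detour_emb K1 aK bK u1 u2 u3.
have -> : (2 * q ^ 2) ^ c.+1 = 2 ^ c.+1 * q ^ (2 * c.+1) by rewrite expnMn expnM.
have -> : q ^ (K + m.+1 + 2 * c) = q ^ (2 * c.+1) * q ^ (K + m - 1).
  by rewrite -expnD; congr (_ ^ _); case: (c) => /=; lia.
by apply/eq_leq; lia.
Qed.

(** The sums over the excursion length [m] and over the starting point [a] are geometric and cost a
    factor 2 each; only the choice of [b] costs a factor [K.+1]. *)
Lemma sum_detour c K : 1 < K -> K <= r.+1 ->
  (\sum_(E in G) #|[set u : K.+1.-tuple V | [&& upth E u, closes E c u &
     detour (drel E c u) r u]]|) * (n * d) ^ c <=
  2 ^ c.+3 * K.+1 * q ^ (K + r + 2 * c) * #|G|.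
Proof.
move=> K1 Kr.
pose D E a b m := #|[set u : K.+1.-tuple V | [&& upth E u, closes E c u &
     [exists z : m.-tuple V, dcond (drel E c u) r u a b z]]]|.
have D0 E a b m : r < a + m.+1 -> D E a b m = 0.
  move=> amr; apply/eqP; rewrite cards_eq0; apply/eqP/setP => u; rewrite !inE.
  apply/negP => /and3P[_ _ /existsP[z /and5P[]]]; rewrite size_tuple; lia.
have le1 E : #|[set u : K.+1.-tuple V | [&& upth E u, closes E c u &
     detour (drel E c u) r u]]| <= \sum_(a < K.+1) \sum_(b < K.+1) \sum_(m < r) D E a b m.
  rewrite pair_bigA /= pair_bigA /=.
  have sub : [set u : K.+1.-tuple V | [&& upth E u, closes E c u & detour (drel E c u) r u]]
     \subset \bigcup_(i : 'I_K.+1 * 'I_K.+1 * 'I_r) [set u : K.+1.-tuple V | [&& upth E u, closes E c u &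
     [exists z : i.2.-tuple V, dcond (drel E c u) r u i.1.1 i.1.2 z]]].
    apply/subsetP => u; rewrite inE => /and3P[u1 u2 /existsP[a /existsP[b /existsP[m hz]]]].
    have aK : a < K.+1 := leq_trans (ltn_ord a) (eq_leq (size_tuple u)).
    have bK : b < K.+1 := leq_trans (ltn_ord b) (eq_leq (size_tuple u)).
    by apply/bigcupP; exists (Ordinal aK, Ordinal bK, m) => //; rewrite inE u1 u2.
  apply: leq_trans (subset_leq_card sub) _.
  by apply: (big_ind2 (fun (A : {set K.+1.-tuple V}) s => #|A| <= s)) => //;
    [rewrite cards0 | move=> A1 s1 A2 s2 h1 h2; rewrite cardsU; apply: leq_trans (leq_subr _ _) (leq_add h1 h2)].
pose M a := if a < r then q ^ (r - a) else 0.
have abm (a b : 'I_K.+1) : (\sum_(E in G) \sum_(m < r) D E a b m) * (n * d) ^ c <=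
    2 ^ c.+2 * q ^ (K + 2 * c) * #|G| * M a.
  rewrite exchange_big /= big_distrl /=.
  apply: (@leq_trans (\sum_(m < r) (if m < r - a then 2 ^ c.+1 * q ^ (K + m.+1 + 2 * c) * #|G| else 0))).
    apply: leq_sum => m _; case: ltnP => am; last first.
      by rewrite big1 ?mul0n // => E _; apply: D0; lia.
    by apply: sum_detour_abm => //; have := ltn_ord a; have := ltn_ord b; lia.
  rewrite -big_mkcond /= (big_ord_narrow (leq_subr a r)) /=.
  rewrite /M; case: ltnP => ar; last first.
    by have -> : r - a = 0 by [lia]; rewrite big_ord0.
  have -> : \sum_(i < r - a) 2 ^ c.+1 * q ^ (K + i.+1 + 2 * c) * #|G| =
     2 ^ c.+1 * q ^ (K + 2 * c) * #|G| * (q * \sum_(i < r - a) q ^ i).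
    rewrite big_distrr /= big_distrr /=; apply: eq_bigr => i _; rewrite -expnS.
    have -> : K + i.+1 + 2 * c = (K + 2 * c) + i.+1 by lia.
    by rewrite expnD -!mulnA [#|G| * _]mulnC.
  have g : q * \sum_(i < r - a) q ^ i <= 2 * q ^ (r - a) by apply: geom_sum_le; lia.
  apply: leq_trans (leq_mul (leqnn _) g) _.
  rewrite [2 ^ c.+2]expnS; apply/eq_leq.
  by move: (2 ^ c.+1) (q ^ (K + 2 * c)) (q ^ (r - a)) #|G| => A B C N; lia.
apply: (@leq_trans (\sum_(a < K.+1) \sum_(b < K.+1) 2 ^ c.+2 * q ^ (K + 2 * c) * #|G| * M a)).
  apply: (@leq_trans ((\sum_(E in G) \sum_(a < K.+1) \sum_(b < K.+1) \sum_(m < r) D E a b m) * (n * d) ^ c)).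
    by rewrite leq_mul2r leq_sum ?orbT.
  rewrite exchange_big /= big_distrl /=; apply: leq_sum => a _.
  rewrite exchange_big /= big_distrl /=; apply: leq_sum => b _; exact: abm.
rewrite (eq_bigr (fun a : 'I_K.+1 => (2 ^ c.+2 * q ^ (K + 2 * c) * #|G| * K.+1) * M a)); last first.
  by move=> a _; rewrite sum_nat_const card_ord; lia.
rewrite -big_distrr /=.
have g : \sum_(a < K.+1) M a <= 2 * q ^ r by apply: geom_sum_desc; lia.
apply: leq_trans (leq_mul (leqnn _) g) _.
have -> : q ^ (K + r + 2 * c) = q ^ (K + 2 * c) * q ^ r by rewrite -expnD; congr (_ ^ _); lia.
rewrite [2 ^ c.+3]expnS; apply/eq_leq.
by move: (2 ^ c.+2) (q ^ (K + 2 * c)) (q ^ r) #|G| => A B C N; lia.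
Qed.

End Detours.

(** * Closing a path into a cycle *)

Section Switchings.
Variables (n d : nat) (x0 : 'I_n).
Local Notation V := 'I_n.
Local Notation q := (d - 1).
Local Notation G := (graphs n d).
Local Notation nth := (nth x0).
Implicit Types (E F : {set {set V}}) (u v z : seq V).

Lemma nth_inj (s : seq V) i j : uniq s -> i < size s -> j < size s ->
  nth s i = nth s j -> i = j.
Proof. by move=> us li lj /eqP; rewrite nth_uniq // => /eqP. Qed.

Lemma uniq_nths (s : seq V) (l : seq nat) : uniq s -> uniq l ->
  all (fun i => i < size s) l -> uniq [seq nth s i | i <- l].
Proof.
move=> us ui /allP li; rewrite map_inj_in_uniq // => i j /li li' /li lj'.
exact: nth_inj.
Qed.

Lemma nth_cons_last b (s : seq V) : nth (b :: s) (size s) = last b s.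
Proof. exact: (nth_last x0 (b :: s)). Qed.

Lemma cyc_path E b (s : seq V) : uniq (b :: s) -> cyc_edges (b :: s) \subset E ->
  path (adj E) b s.
Proof.
move=> us sub; apply/(pathP x0) => i is_.
by have /(subsetP sub) := cyc_edges_nth x0 us (is_ : i.+1 < size (b :: s)).
Qed.

Lemma cyc_path_sub E b (s : seq V) (F : {set {set V}}) (P : pred V) :
  uniq (b :: s) -> cyc_edges (b :: s) \subset E ->
  (forall i, i < size s -> ~~ P (nth (b :: s) i) ->
    [set nth (b :: s) i; nth s i] \in cyc_edges (b :: s) -> [set nth (b :: s) i; nth s i] \in F) ->
  ~~ P b -> has P s -> 
  exists p, [/\ path (adj F) b p, uniq (b :: p), 0 < size p <= size s, P (last b p)
    & p = take (size p) s].
Proof.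
move=> us sub h Pb hP; pose j := find P s.
have js : j < size s by rewrite -has_find.
have st : size (take j.+1 s) = j.+1 by rewrite size_takel.
exists (take j.+1 s); rewrite st; split => //.
- apply/(pathP x0) => i; rewrite st => ij.
  have is_ : i < size s by lia.
  have -> : nth (b :: take j.+1 s) i = nth (b :: s) i.
    by case: i ij is_ => //= i ij _; rewrite nth_take //; lia.
  rewrite nth_take //; apply: h => //; last exact: (cyc_edges_nth x0 us).
  by case: i ij is_ => //= i ij _; rewrite (before_find x0).
- by have := take_uniq j.+2 us.
rewrite (take_nth x0) // last_rcons; exact: nth_find.
Qed.

(* Follow a cycle of the switched graph from [c], away from the new edge [ac],
   until the next switched vertex. *)
Lemma switched_cycle_path E F j al a b c e :
  uniq [:: a; b; c; e] -> {subset F <= [set a; c] |: ([set b; e] |: E)} ->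
  is_cyc j al -> al \subset F -> [set a; c] \in al ->
  exists p, [/\ path (adj (E :&: F)) c p, uniq (c :: p), 0 < size p < j
     & last c p \in [:: a; b; e]].
Proof.
rewrite /= !inE !negb_or -!andbA => /and5P[nab nac nae nbc /and3P[nbe nce _]] sub.
case/is_cycP => t [t2 tj ut ct] alF aca.
rewrite -ct in alF aca; have [s [us ss cs ls]] := cyc_edges_start ut aca.
have hP : has (mem [:: a; b; e]) s.
  apply/hasP; exists a; last by rewrite /= inE eqxx.
  by rewrite -ls; case: (s) ss t2 => /= [<- //|x s' _ _]; rewrite mem_last.
have [|||p [p1 p2 p3 p4 _]] := @cyc_path_sub F c s (E :&: F) (mem [:: a; b; e]) us _ _ _ hP.
- by rewrite cs.
- move=> i is_ nP inc; have inF : [set nth (c :: s) i; nth s i] \in F.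
    by apply: (subsetP alF); rewrite -cs.
  rewrite inE inF andbT; have := sub _ inF; rewrite !inE => /or3P[|/eqP eE|//].
    rewrite set2_eq => /orP[/andP[/eqP e1 _]|/andP[/eqP e1 /eqP e2]].
      by rewrite /= !inE e1 eqxx in nP.
    have i0 : i = 0 by apply: (nth_inj us) => //; apply: ltnW.
    have : 1 = size s.
      rewrite i0 in e2 is_; apply: (nth_inj us) => //.
      by rewrite nth_cons_last ls.
    by move=> e1s; have := t2; rewrite -ss /= -e1s.
  have := set21 (nth (c :: s) i) (nth s i); rewrite eE !inE.
  by move=> /orP[]/eqP e1; rewrite /= !inE e1 eqxx ?orbT in nP.
- by rewrite /= !inE !negb_or (eq_sym c a) (eq_sym c b) nac nbc nce.
by exists p; split=> //; rewrite -tj -ss /= ltnS.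
Qed.

Variables (r : nat).

(** Walk around the cycle from [u_1], away from [u_0]. The walk ends at [u_0], which is not ahead of
    [u_1], so it is no stretch of [u] and [detour_path] applies. *)
Lemma detour_of_cycle E (u : seq V) j al : uniq u -> 1 < size u -> is_cyc j al ->
  j <= r -> al \subset E -> [set nth u 0; nth u 1] \in al -> detour x0 (drel x0 E false u) r u.
Proof.
move=> uu su /is_cycP[t [t2 tj ut ct]] jr alE; rewrite -ct => fa.
have [s [us ss cs ls]] := cyc_edges_start ut fa.
have sE : cyc_edges (nth u 1 :: s) \subset E by rewrite cs ct.
have s2 : 1 < size s by move: ss t2 => /=; lia.
have u0s : nth u 0 \in s by rewrite -ls; case: (s) s2 => // x s' _ /=; rewrite mem_last.
apply: (@detour_path n x0 (drel x0 E false u) r u 1 s) => //.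
- have -> : path (drel x0 E false u) (nth u 1) s = path (adj E) (nth u 1) s.
    by apply: eq_path => x y; rewrite /drel /= andbT.
  exact: cyc_path sE.
- by case: (s) s2.
- by rewrite ls mem_nth // ltnW.
- move=> _ /=; rewrite -ls; case: (s) s2 us => // x [|y s'] //= _ /and3P[_ xs _].
  by apply: contraNneq xs => <-; rewrite mem_last.
- apply: contraTneq u0s => ->; apply/negP => /mem_take h.
  have : nth u 0 \in drop 1 u by rewrite (drop_nth x0) // inE h orbT.
  move: uu h {fa ls sE us cs}; case: (u) su => // x [|y u'] //= _ /andP[xu _] _.
  by rewrite (negPf xu).
- by rewrite add1n -[(size s).+1]/(size (nth u 1 :: s)) ss tj.
Qed.

(** Both sides of the switching use the same tuple [u_0, ..., u_{k+1}], with [u_1, ..., u_k] the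
    future or present cycle. The pairs [u_0 u_1], [u_k u_{k+1}] are exchanged for [u_1 u_k],
    [u_0 u_{k+1}], and the inner edges stay. *)
Definition inner k E u := all (fun i => adj E (nth u i) (nth u i.+1)) (iota 1 k.-1).

Definition path_side k E u :=
  [&& uniq u, inner k E u & valid E (nth u 1) (nth u 0) (nth u k) (nth u k.+1)].

Definition cycle_side k E u :=
  [&& uniq u, inner k E u & valid E (nth u 1) (nth u k) (nth u 0) (nth u k.+1)].

Definition close_path k E u := sw E (nth u 1) (nth u 0) (nth u k) (nth u k.+1).
Definition unclose k E u := sw E (nth u 1) (nth u k) (nth u 0) (nth u k.+1).

(** No switched pair consists of consecutive inner positions; for the pair [1, k] this needs
    [2 < k]. *)
Lemma inner_sw k E u a b c e : uniq u -> size u = k.+2 -> 2 < k ->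
  (a, b, c, e) = (1, 0, k, k.+1) \/ (a, b, c, e) = (1, k, 0, k.+1) ->
  inner k (sw E (nth u a) (nth u b) (nth u c) (nth u e)) u = inner k E u.
Proof.
move=> uu su k2 abce; apply: eq_in_all => i; rewrite mem_iota => ii.
have ik : i < k by move: ii; clear -k2; lia.
have i0 : 0 < i by case/andP: ii.
have nu l : l < k.+2 -> (nth u i == nth u l) = (i == l).
  by move=> lk; rewrite nth_uniq ?su // ltnS ltnW // ltnW.
have nu1 l : l < k.+2 -> (nth u i.+1 == nth u l) = (i.+1 == l).
  by move=> lk; rewrite nth_uniq ?su // !ltnS ltnW.
rewrite adj_sw !set2_eq; move: (adj E _ _) => A; move: ik i0; clear -k2 nu nu1 abce.
by case: abce => -[-> -> -> ->]; rewrite !nu ?nu1 ?ltnS ?leqnSn //; clear -k2; case: A; lia.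
Qed.

Lemma close_cycle_side k E u : size u = k.+2 -> 2 < k ->
  path_side k E u -> cycle_side k (close_path k E u) u /\ unclose k (close_path k E u) u = E.
Proof.
move=> su k2 /and3P[uu iu vu]; split; last exact: sw_inv.
by rewrite /cycle_side uu /close_path inner_sw //; auto; rewrite iu sw_valid.
Qed.

Lemma unclose_path_side k E u : size u = k.+2 -> 2 < k ->
  cycle_side k E u -> path_side k (unclose k E u) u /\ close_path k (unclose k E u) u = E.
Proof.
move=> su k2 /and3P[uu iu vu]; split; last exact: sw_inv.
by rewrite /path_side uu /unclose inner_sw //; auto; rewrite iu sw_valid.
Qed.

(** Goodness is the desired effect on the counts and not a geometric condition, which makes the
    switching identity exact; geometry enters only when bad tuples are counted. *)
Definition good k E u :=
  [forall j : 'I_r.+1, cycle_count (close_path k E u) j == cycle_count E j + (j == k :> nat)].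

Definition good_paths k E := [set u : k.+2.-tuple V | path_side k E u && good k E u].
Definition good_cycles k E :=
  [set u : k.+2.-tuple V | cycle_side k E u && good k (unclose k E u) u].

(** For a fixed tuple [u], [close_path] and [unclose] are inverse bijections between the graphs on
    the two sides, so the sum over graphs can be reindexed. *)
Lemma switching_identity (T : Type) (idx : T) (op : Monoid.com_law idx) k
    (f : {set {set V}} -> T) : 2 < k ->
  \big[op/idx]_(E in G) \big[op/idx]_(u in good_cycles k E) f E =
  \big[op/idx]_(E in G) \big[op/idx]_(u in good_paths k E) f (close_path k E u).
Proof.
move=> k2.
rewrite (exchange_big_dep xpredT) //= [RHS](exchange_big_dep xpredT) //=.
apply: eq_bigr => u _; have su := size_tuple u.
rewrite (reindex_onto (fun E => close_path k E u) (fun E => unclose k E u)) /=; last first.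
  by move=> E /andP[_]; rewrite inE => /andP[/(unclose_path_side su k2)[]].
apply: eq_bigl => E; rewrite !inE; apply/andP/andP.
  case=> /and3P[EG cs gs] /eqP cE.
  have [ps _] := unclose_path_side su k2 cs; rewrite cE in ps gs.
  rewrite ps gs; split => //; rewrite -cE.
  by apply: sw_graphs => //; case/and3P: cs.
case=> EG /andP[ps gs]; have [cs ->] := close_cycle_side su k2 ps.
rewrite cs gs eqxx; split=> //; rewrite !andbT.
by apply: sw_graphs => //; case/and3P: ps.
Qed.

Definition inner_cycle k u := take k (behead u).

Lemma size_inner_cycle k u : size u = k.+2 -> size (inner_cycle k u) = k.
Proof. by move=> su; rewrite size_takel // size_behead su. Qed.

Lemma nth_inner_cycle k u i : i < k -> nth (inner_cycle k u) i = nth u i.+1.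
Proof. by move=> ik; rewrite nth_take // nth_behead. Qed.

Lemma uniq_inner_cycle k u : uniq u -> uniq (inner_cycle k u).
Proof. by move=> uu; apply: take_uniq; case: u uu => //= x u /andP[]. Qed.

Lemma inner_cycle_edges k E u : uniq u -> size u = k.+2 -> 2 < k ->
  inner k E u -> adj E (nth u 1) (nth u k) -> cyc_edges (inner_cycle k u) \subset E.
Proof.
move=> uu su k2 iu a1k; apply: (cyc_edges_subset (x0 := x0)).
- exact: uniq_inner_cycle.
- move=> i; rewrite size_inner_cycle // => ik; rewrite !nth_inner_cycle; try lia.
  by apply: (allP iu); rewrite mem_iota; lia.
rewrite size_inner_cycle // !nth_inner_cycle; try lia.
by rewrite prednK //; lia.
Qed.

(* Both switching directions reduce to conditions (I) and (II): no short cycle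
   other than the intended one is destroyed or created. *)
Lemma good_of_cycles k E E' u : size u = k.+2 -> 2 < k <= r ->
  cycle_side k E u -> E' = unclose k E u ->
  (forall j al, j <= r -> is_cyc j al -> al \subset E ->
    ([set nth u 1; nth u k] \in al) || ([set nth u 0; nth u k.+1] \in al) ->
    al = cyc_edges (inner_cycle k u)) ->
  (forall j al, j <= r -> is_cyc j al -> al \subset E' ->
     ([set nth u 1; nth u 0] \notin al) && ([set nth u k; nth u k.+1] \notin al)) ->
  good k E' u.
Proof.
move=> su /andP[k2 kr] cs E'E h1 h2.
have [_ clE] := unclose_path_side su k2 cs; rewrite -E'E in clE.
have /and3P[uu iu /and5P[_ a1k a0k _ _]] := cs.
apply/forallP => j; apply/eqP; rewrite clE.
have nu i l : i < k.+2 -> l < k.+2 -> (nth u i == nth u l) = (i == l).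
  by move=> il ll; rewrite nth_uniq ?su.
apply: (cycle_count_switch (k := k) (r := r) (al0 := cyc_edges (inner_cycle k u)) E'E) => //.
- by rewrite set2_eq !nu; lia.
- by rewrite set2_eq !nu; lia.
- apply/is_cycP; exists (inner_cycle k u); rewrite size_inner_cycle //; split=> //.
  exact: uniq_inner_cycle.
- exact: inner_cycle_edges.
- have := cyc_edges_last x0 (uniq_inner_cycle k uu).
  rewrite size_inner_cycle // !nth_inner_cycle ?prednK; try lia.
- by have := ltn_ord j; rewrite ltnS.
Qed.

(** A short cycle through [u_0 u_1] is a detour of [u], one through [u_k u_{k+1}] a detour of the
    reversed path: hence the two hypotheses. The chords that would make the switching invalid are
    detours too. *)
Lemma upth_good k E (u : k.+2.-tuple V) : E \in G -> 2 < k <= r -> upth E u ->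
  ~~ detour x0 (drel x0 E false u) r u ->
  ~~ detour x0 (drel x0 E false (rev u)) r (rev u) ->
  u \in good_paths k E.
Proof.
move=> EG /andP[k2 kr] /andP[uu su] nd nd'.
have szu := size_tuple u; have suP := sortedP x0 su; rewrite szu in suP.
have nu i l : i < k.+2 -> l < k.+2 -> (nth u i == nth u l) = (i == l).
  by move=> il ll; rewrite nth_uniq ?szu.
have edge_detour a b : a < b < k.+2 -> a.+1 != b -> a + 1 <= r -> adj E (nth u a) (nth u b) ->
    detour x0 (drel x0 E false u) r u.
  move=> ab nab ar adjab.
  have au : a < size u by rewrite szu; lia.
  have bu : b < size u by rewrite szu; lia.
  have r0 : 0 < r by lia.
  apply/existsP; exists (Ordinal au); apply/existsP; exists (Ordinal bu).
  apply/existsP; exists (Ordinal r0); apply/existsP; exists [tuple].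
  by rewrite /dcond /= cats0 uu /= /drel adjab /=; lia.
have ps : path_side k E u.
  apply/and3P; split => //.
    by apply/allP => i; rewrite mem_iota => ii; apply: suP; clear -ii k2; lia.
  apply/and5P; split.
  - apply: (uniq_nths (l := [:: 1; 0; k; k.+1]) uu); rewrite /= ?szu ?inE;
      by clear -k2; lia.
  - by rewrite adjC; apply: suP.
  - by apply: suP.
  - by apply: contraNN nd => /edge_detour; apply; lia.
  - by apply: contraNN nd => /edge_detour; apply; lia.
have [cs ucE] := close_cycle_side szu k2 ps.
rewrite inE ps /=; apply: (good_of_cycles szu _ cs (esym ucE)); first by rewrite k2.
  set F := close_path k E u in cs ucE *.
  have /and3P[_ _ vE] := ps; have /and5P[U _ _ _ _] := vE.
  have /and3P[_ _ /and5P[_ F1k F0k F10 Fkk]] := cs.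
  (* A short cycle of the closed graph through the new edge [u_0 u_{k+1}] leaves [u_0] by edges of
     [E] and comes back to [u]: a detour found from [u_0]. *)
  move=> j al jr jal alF; case: (boolP ([set nth u 0; nth u k.+1] \in al)) => [f2 _|f2].
    exfalso; move: nd; rewrite setUC in f2.
    have [||p [pp up sp lp]] := @switched_cycle_path E F j al (nth u k.+1) (nth u 1) (nth u 0) (nth u k) _ _ jal alF f2.
    - apply: (uniq_nths (l := [:: k.+1; 1; 0; k]) uu); rewrite /= ?szu ?inE;
        by clear -k2; lia.
    - move=> f; rewrite !inE [[set nth u k.+1; nth u 0]]setUC.
      by case/or3P => [->|->|/and3P[_ _ ->]]; rewrite ?orbT.
    apply/negP; rewrite negbK; apply: (@detour_path n x0 _ r u 0 p) => //.
    - by rewrite szu.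
    - apply: sub_path pp => x y; rewrite /adj inE => /andP[xy _]; by rewrite /drel /= andbT.
    - by case: (p) sp.
    - by move: lp; rewrite !inE => /or3P[]/eqP->; apply: mem_nth; rewrite szu.
    - apply: contraTneq pp => pE.
      have h0 : nth p 0 = nth u 1 by case/andP: sp => sp _; rewrite {1}pE nth_take // nth_drop.
      have -> : p = nth u 1 :: behead p by rewrite -h0; case: (p) sp.
      by rewrite /= /adj inE; move: F10; rewrite /adj setUC => /negPf->; rewrite andbF.
    - by case/andP: sp => _ spj; apply: leq_trans (ltnW spj) jr.
  (* A short cycle through [u_1 u_k] only uses old edges otherwise. Followed from [u_1] it gives a
     detour unless it runs along [u], and then it is the inner cycle. *)
  rewrite orbF => f1; apply/eqP; apply: contraNT nd => nal.
  have /is_cycP[t [t2 tj ut ct]] := jal; move: f1; rewrite -ct setUC => f1.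
  have [s [us ss cS ls]] := cyc_edges_start ut f1.
  have sF : cyc_edges (nth u 1 :: s) \subset F by rewrite cS ct.
  have sz1 : 1 < size s by rewrite -ltnS -[(size s).+1]/(size (nth u 1 :: s)) ss.
  have pE : path (adj (E :&: F)) (nth u 1) s.
    apply/(pathP x0) => i is_.
    have inal := cyc_edges_nth x0 us (is_ : i.+1 < size (nth u 1 :: s)).
    rewrite /= in inal.
    have inF := subsetP sF _ inal; rewrite /adj inE inF andbT.
    have := inF; rewrite /F /close_path /sw !inE => /or3P[||/and3P[] //].
      rewrite set2_eq => /orP[]/andP[/eqP e1 /eqP e2].
        have i0 : i = 0 by apply: (nth_inj us) => //; apply: ltnW.
        have : 1 = size s.
          rewrite i0 in e2 is_; apply: (nth_inj us) => //.
          by rewrite nth_cons_last ls.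
        by move=> e1s; rewrite -e1s in sz1.
      have : i = size s.
        by apply: (nth_inj us) => //; [exact: ltnW | rewrite nth_cons_last ls].
      by move=> is1; rewrite is1 ltnn in is_.
    move=> /eqP eE; rewrite eE cS ct in inal.
    by rewrite inal in f2.
  apply: (@detour_path n x0 _ r u 1 s) => //.
  - by rewrite szu.
  - apply: sub_path pE => x y; rewrite /adj inE => /andP[xy _]; by rewrite /drel /= andbT.
  - by case: (s) sz1.
  - by rewrite ls mem_nth // szu ltnS leqnSn.
  - move=> _ /=; case: (s) sz1 pE => //= x s' _ /andP[xF _].
    by apply: contraTneq xF => <-; rewrite /adj inE -/(adj F _ _) (negPf F10) andbF.
  - apply: contraNneq nal => sE.
    have nE i : i < size s -> nth s i = nth u i.+2.
      by move=> is_; rewrite {1}sE nth_take // nth_drop.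
    have szk : k = (size s).+1.
      have s0 : 0 < size s by apply: ltnW.
      apply: (nth_inj uu); rewrite ?szu ?ltnS ?leqnSn //.
        by rewrite {1}sE size_take_min size_drop szu subn2 geq_minr.
      rewrite -ls -[in RHS](prednK s0) -nE ?prednK // nth_last.
      by case: (s) s0.
    rewrite -ct -cS; apply/eqP; congr cyc_edges.
    apply: (@eq_from_nth _ x0); first by rewrite /= size_inner_cycle.
    move=> i is_; rewrite nth_inner_cycle; last by rewrite szk.
    by case: i is_ => //= i is_; rewrite nE.
  - by rewrite add1n -[(size s).+1]/(size (nth u 1 :: s)) ss tj.
move=> j al jr jal alE; apply/andP; split.
  apply: contraNN nd; rewrite setUC => f1.
  by apply: (detour_of_cycle _ _ jal) => //; rewrite szu.
apply: contraNN nd' => f1.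
apply: (detour_of_cycle _ _ jal) => //; rewrite ?rev_uniq ?size_rev ?szu //.
by rewrite !nth_rev ?szu // !subn1 subn2 /= setUC.
Qed.

Hypothesis d3 : 3 <= d.
Hypothesis big : 2 * (2 * (2 * r + 4) + 4 * d + 2 * (d * d)) <= n * d.
Hypothesis nd0 : 0 < n * d.

Lemma card_good_paths_le k E : E \in G -> 2 < k -> #|good_paths k E| <= n * d * q ^ k.
Proof.
move=> EG k2; have := @card_upth n d x0 E k.+1 EG isT; rewrite [k.+1 - 1]subn1 /=.
apply: leq_trans; apply/subset_leq_card/subsetP => u; rewrite !inE.
case/andP=> /and3P[uu iu /and5P[_ a10 akk _ _]] _; rewrite /upth uu /=.
apply/(sortedP x0) => i; rewrite size_tuple => ik.
case: (posnP i) => [->|i0]; first by rewrite adjC.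
case: (eqVneq i k) => [->//|nik].
by apply: (allP iu); rewrite mem_iota; lia.
Qed.

(** A path that is not good has a detour in one of its two directions, by [upth_good]; the
    coefficient 16 is twice the 8 of [sum_detour]. *)
Lemma sum_good_paths_ge k : 2 < k <= r ->
  #|G| * (n * d * q ^ k) <= \sum_(E in G) #|good_paths k E| +
    (2 * k ^ 2 * q ^ k.+1 + 16 * k.+2 * q ^ (k.+1 + r)) * #|G|.
Proof.
move=> /andP[k2 kr].
have b1 : 2 * (2 * (k + 1) + 4 * d + 2 * (d * d)) <= n * d by lia.
apply: leq_trans (sum_upth_ge x0 nd0 b1) _.
rewrite mulnDl addnA [X in _ <= X]addnAC leq_add2r.
have := @sum_detour n d x0 r d3 big nd0 false k.+1; rewrite expn0 muln1 muln0 addn0 => sd.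
have {}sd := sd _ _; rewrite ltnS in sd.
have {sd} := sd (ltnW (ltnW k2)) kr => sd.
pose D E := #|[set u : k.+2.-tuple V | [&& upth E u, closes x0 E false u &
     detour x0 (drel x0 E false u) r u]]|.
apply: (@leq_trans (\sum_(E in G) (#|good_paths k E| + 2 * D E))); last first.
  rewrite big_split /= leq_add2l -big_distrr /=.
  apply: leq_trans (leq_mul (leqnn 2) sd) _.
  have -> : 2 ^ false.+3 = 8 by [].
  by apply/eq_leq; move: (q ^ _) #|G| => A B; clear; lia.
apply: leq_sum => E EG.
pose D2 := [set u : k.+2.-tuple V | [&& upth E u, closes x0 E false u &
     detour x0 (drel x0 E false u) r u]].
pose rv (u : k.+2.-tuple V) : k.+2.-tuple V := [tuple of rev u].
have sub : [set u : k.+2.-tuple V | upth E u] \subset good_paths k E :|: (D2 :|: rv @: D2).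
  apply/subsetP => u; rewrite inE => up; rewrite !in_setU.
  case: (boolP (detour x0 (drel x0 E false u) r u)) => du.
    by apply/or3P/Or32; rewrite inE up /closes.
  case: (boolP (detour x0 (drel x0 E false (rev u)) r (rev u))) => du'.
    apply/or3P/Or33; apply/imsetP; exists (rv u); last by apply: val_inj; rewrite /= revK.
    rewrite inE du' /closes /= andbT; case/andP: up => uu su.
    rewrite /upth rev_uniq uu /= rev_sorted.
    by rewrite (eq_sorted (e' := adj E)) // => x y; rewrite adjC.
  by apply/or3P/Or31; apply: upth_good => //; rewrite k2.
apply: leq_trans (subset_leq_card sub) _.
rewrite cardsU; apply: leq_trans (leq_subr _ _) _; rewrite leq_add2l mul2n -addnn.
rewrite cardsU; apply: leq_trans (leq_subr _ _) _; rewrite leq_add2l.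
exact: leq_imset_card.
Qed.

End Switchings.

(** * Opening a cycle *)

Section CycleSide.
Variables (n d : nat) (x0 : 'I_n) (r : nat).
Local Notation V := 'I_n.
Local Notation q := (d - 1).
Local Notation G := (graphs n d).
Local Notation nth := (nth x0).
Implicit Types (E F : {set {set V}}) (v : seq V).

Lemma upth_rcons E v x : v != [::] ->
  upth E (rcons v x) = upth E v && (x \in nbr E (nth v (size v).-1) :\: [set y in v]).
Proof.
case: v => // y v _; rewrite /upth rcons_uniq !inE /= rcons_path (last_nth x0) /=.
by case: (_ \in _) => //=; rewrite ?andbF // -!andbA; do !bool_congr.
Qed.

Lemma upth_rev E v : upth E (rev v) = upth E v.
Proof.
rewrite /upth rev_uniq rev_sorted; congr (_ && _); apply: eq_sorted => x y; exact: adjC.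
Qed.

Lemma upth_take E v i : upth E v -> upth E (take i v).
Proof. by case/andP => uv sv; rewrite /upth take_uniq // take_sorted. Qed.

Lemma nth0_tuple1 (v : 1.-tuple V) x : (nth v 0 == x) = (v == [tuple x]).
Proof.
case: v => -[|a [|b s]] // sz; apply/idP/idP => [/eqP <-|/eqP/(congr1 val)[->]].
  by apply/eqP; apply: val_inj.
exact: eqxx.
Qed.

Lemma card_upth_from E x L : E \in G ->
  #|[set v : L.+2.-tuple V | upth E v && (nth v 0 == x)]| <= d * q ^ L.
Proof.
move=> EG.
have step M : #|[set v : M.+2.-tuple V | upth E v && (nth v 0 == x)]| =
    \sum_(v : M.+1.-tuple V | upth E v && (nth v 0 == x)) #|nbr E (nth v M) :\: [set y in v]|.
  apply: (card_rcons_tuple (P' := fun v => upth E v && (nth v 0 == x))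
    (P := fun v => upth E v && (nth v 0 == x)) (F := fun v => nbr E (nth v M) :\: [set y in v])).
  move=> v y sv; rewrite upth_rcons; last by rewrite -size_eq0 sv.
  by rewrite nth_rcons sv /= andbAC.
elim: L => [|L IH]; rewrite step.
  apply: (@leq_trans (\sum_(v : 1.-tuple V | nth v 0 == x) d)).
    rewrite big_mkcond [X in _ <= X]big_mkcond /=; apply: leq_sum => v _.
    case: (nth v 0 == x); rewrite ?andbF ?andbT //; case: (upth E v) => //.
    by rewrite -(card_nbr (nth v 0) EG); apply/subset_leq_card/subsetDl.
  by rewrite expn0 muln1 (big_pred1 [tuple x]) // => v; exact: nth0_tuple1.
apply: (@leq_trans (\sum_(v : L.+2.-tuple V | upth E v && (nth v 0 == x)) q)).
  apply: leq_sum => v /andP[/andP[uv sv] _].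
  have aL : adj E (nth v L.+1) (nth v L).
    by rewrite adjC; apply: (sortedP x0 sv); rewrite size_tuple.
  have -> : q = #|nbr E (nth v L.+1) :\ nth v L|.
    have := cardsD1 (nth v L) (nbr E (nth v L.+1)); rewrite inE aL (card_nbr _ EG) /= => ->.
    by rewrite addKn.
  apply/subset_leq_card/subsetP => y; rewrite !inE => /andP[yv ->]; rewrite andbT.
  by apply: contraNneq yv => ->; rewrite mem_nth // size_tuple.
rewrite sum_nat_const -sum1_card sum1dep_card.
by apply: leq_trans (leq_mul IH (leqnn _)) _; rewrite -mulnA -expnSr.
Qed.

Definition near E (t : seq V) : {set V} :=
  [set y | [exists L : 'I_r, [exists v : L.+1.-tuple V,
     [&& upth E v, nth v 0 \in t & nth v L == y]]]].

Lemma mem_near E t v : upth E v -> 0 < size v <= r -> nth v 0 \in t ->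
  nth v (size v).-1 \in near E t.
Proof.
move=> uv /andP[sv svr] v0; rewrite inE.
have lt : (size v).-1 < r by rewrite prednK.
apply/existsP; exists (Ordinal lt).
have sz : size v == (Ordinal lt).+1 by rewrite /= prednK.
by apply/existsP; exists (Tuple sz); rewrite uv v0 /= eqxx.
Qed.

Lemma mem_near_rev E t c p : upth E (c :: p) -> size p < r -> last c p \in t ->
  c \in near E t.
Proof.
move=> up sp lt; have := @mem_near E t (rev (c :: p)).
rewrite upth_rev size_rev nth_rev // subn1 -[(size (c :: p)).-1]/(size p) nth_cons_last.
by rewrite nth_rev // subnn; apply.
Qed.

(** From each vertex of [t] there is one path of length 0 and at most [d q ^ M] of length [M.+1].
    With [r = R.+1] the latter add up to at most [4 q ^ R], and [1 + 4 = 5]. *)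
Lemma card_near E (t : seq V) : E \in G -> 2 < d -> 0 < r ->
  #|near E t| <= size t * (5 * q ^ r).
Proof.
move=> EG d3 r0.
pose S L := [set v : L.+1.-tuple V | upth E v && (nth v 0 \in [set x in t])].
have le1 : #|near E t| <= \sum_(L < r) #|S L|.
  have sub : near E t \subset \bigcup_(L < r) [set nth v L | v : L.+1.-tuple V in S L].
    apply/subsetP => y; rewrite inE => /existsP[L /existsP[v /and3P[uv v0 /eqP <-]]].
    apply/bigcupP; exists L => //; apply/imsetP; exists v => //.
    by rewrite !inE uv.
  apply: leq_trans (subset_leq_card sub) _.
  apply: (big_ind2 (fun (A : {set V}) s => #|A| <= s)) => //; first by rewrite cards0.
    by move=> A1 s1 A2 s2 h1 h2; rewrite cardsU; apply: leq_trans (leq_subr _ _) (leq_add h1 h2).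
  by move=> L _; apply: leq_imset_card.
apply: leq_trans le1 _.
have SL L : #|S L| <= size t * (if L is M.+1 then d * q ^ M else 1).
  rewrite /S (card_fibers (fun v : L.+1.-tuple V => nth v 0)).
  apply: (@leq_trans (\sum_(x in [set x in t]) (if L is M.+1 then d * q ^ M else 1))).
    apply: leq_sum => x _; case: L => [|M]; last exact: card_upth_from.
    apply: (@leq_trans #|[set ([tuple x] : 1.-tuple V)]|); last by rewrite cards1.
    apply/subset_leq_card/subsetP => v.
    by rewrite !inE nth0_tuple1 => /andP[].
  rewrite sum_nat_const leq_mul2r cardsE card_size; exact: orbT.
apply: (@leq_trans (\sum_(L < r) size t * (if val L is M.+1 then d * q ^ M else 1))).
  by apply: leq_sum => L _; apply: SL.
rewrite -big_distrr /= leq_mul2l; apply/orP; right.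
case: r r0 => // R _; rewrite big_ord_recl /=.
have -> : \sum_(i < R) (if bump 0 i is M.+1 then d * q ^ M else 1) = d * \sum_(i < R) q ^ i.
  by rewrite big_distrr; apply: eq_bigr.
have q2 : 2 <= q by clear -d3; lia.
have g := geom_sum_le R q2.
have d2 : d <= 2 * q by clear -d3; lia.
have h1 : d * \sum_(i < R) q ^ i <= 2 * (q * \sum_(i < R) q ^ i).
  by rewrite mulnA leq_mul2r d2 orbT.
have qR : 0 < q ^ R by rewrite expn_gt0; apply/orP; left; apply: ltnW.
have qR1 : q ^ R <= q ^ R.+1 by rewrite leq_pexp2l //; apply: ltnW.
move: (q ^ R) (q ^ R.+1) g h1 qR qR1; move: (\sum_(i < R) _) => S1 A B.
by clear; move: (q * S1) (d * S1) => X Y; lia.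
Qed.

Lemma rooted_cycleE E (t : seq V) : uniq t -> 0 < size t ->
  (cyc_edges t \subset E) = sorted (adj E) t && adj E (nth t 0) (nth t (size t).-1).
Proof.
move=> ut st; apply/idP/andP => [sub|[so cl]].
  split; last by apply: (subsetP sub); apply: cyc_edges_last.
  apply/(sortedP x0) => i it; apply: (subsetP sub); exact: cyc_edges_nth.
by apply: (cyc_edges_subset (x0 := x0) ut _ cl) => i it; apply: (sortedP x0 so).
Qed.

Definition rooted k E := [set t : k.-tuple V | uniq t && (cyc_edges t \subset E)].

Definition disjoint_cycle k E (t : k.-tuple V) (c e : V) :=
  [exists j : 'I_r.+1, [exists w : j.-tuple V,
    [&& 2 < j, uniq (t ++ w), cyc_edges w \subset E, nth w 0 == c & nth w j.-1 == e]]].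

(** If [c] and [e] are far from [t], the switching creates no short cycle. It could still destroy
    too many: other short cycles through the closing edge of [t] give detours that avoid this edge,
    and short cycles through [ce] are disjoint from [t]. *)
Lemma rooted_good k E (t : k.-tuple V) c e : 2 < k <= r -> E \in G ->
  uniq t -> cyc_edges t \subset E -> adj E c e ->
  c \notin near E t -> e \notin near E t ->
  ~~ detour x0 (drel x0 E true t) r t -> ~~ disjoint_cycle E t c e ->
  [tuple of c :: rcons t e] \in good_cycles x0 r k E.
Proof.
move=> /andP[k2 kr] EG ut tE ce cN eN ndt ndisj.
have st := size_tuple t.
have tt0 : t != [::] :> seq V by rewrite -size_eq0 st; clear -k2; case: k k2.
have r0 : 0 < r by apply: leq_trans kr; apply: ltnW; apply: ltnW.
have k0 : 0 < k by apply: ltnW; apply: ltnW.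
set u : k.+2.-tuple V := [tuple of c :: rcons t e].
have u0 : nth u 0 = c by [].
have uk1 : nth u k.+1 = e by rewrite /= nth_rcons st ltnn eqxx.
have ui i : i < k -> nth u i.+1 = nth t i by move=> ik; rewrite /= nth_rcons st ik.
have u1 : nth u 1 = nth t 0 by rewrite ui.
have tk1 : k.-1 < k by rewrite prednK.
have uk : nth u k = nth t k.-1 by have := ui _ tk1; rewrite prednK.
have tin i : i < k -> nth t i \in (t : seq V) by move=> ik; rewrite mem_nth ?st.
have near_t x : x \in (t : seq V) -> x \in near E t.
  by move=> xt; apply: (@mem_near E t [:: x]) => //; rewrite /= r0.
have ct : c \notin t by apply: contraNN cN; apply: near_t.
have et : e \notin t by apply: contraNN eN; apply: near_t.
have cneq : c != e by apply: adj_neq EG ce.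
have uu : uniq u.
  by rewrite /= rcons_uniq et ut mem_rcons inE negb_or cneq ct.
have near_adj x y : x \in (t : seq V) -> adj E x y -> y \in near E t.
  move=> xt xy; apply: (@mem_near E t [:: x; y]) => //.
    by rewrite /upth /= inE xy !andbT; apply: adj_neq EG xy.
  by rewrite /=; apply: leq_trans kr; apply: ltnW.
have iu : inner x0 k E u.
  apply/allP => -[|i]; rewrite mem_iota // => /andP[_]; rewrite add1n prednK // => ik.
  have ik' : i < k by apply: ltnW.
  rewrite ui // ui //; apply: (subsetP tE); apply: cyc_edges_nth => //; by rewrite st.
have cl : adj E (nth t 0) (nth t k.-1).
  by have := cyc_edges_last x0 ut; rewrite st => /(_ k0) /(subsetP tE).
have cs : cycle_side x0 k E u.
  apply/and3P; split => //; rewrite u1 uk u0 uk1; apply/and5P; split => //.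
  - rewrite /= !inE !negb_or -!andbA cneq !andbT.
    have nx x i : i < k -> x \notin (t : seq V) -> nth t i != x.
      by move=> ik; apply: contraNneq => <-; apply: tin.
    rewrite (nx c 0) // (nx e 0) // (nx c k.-1) // (nx e k.-1) // !andbT nth_uniq ?st //.
    by clear -k2; lia.
  - by apply: contraNN cN; apply: near_adj; apply: tin.
  - by apply: contraNN eN; apply: near_adj; apply: tin.
have vE : valid E (nth t 0) (nth t k.-1) c e by move: cs => /and3P[_ _]; rewrite u1 uk u0 uk1.
(* A short cycle of [E] through [ce] meets [t], hence is near, or is disjoint. *)
have noce j al : j <= r -> is_cyc j al -> al \subset E -> [set c; e] \notin al.
  move=> jr /is_cycP[t' [t2 tj ut' ct']] alE; apply/negP; rewrite setUC -ct' => inal.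
  have [s [us ss cS ls]] := cyc_edges_start ut' inal.
  have sE : cyc_edges (c :: s) \subset E by rewrite cS ct'.
  have sj : size (c :: s) = j by rewrite ss.
  case: (boolP (has (mem (t : seq V)) (c :: s))) => [/(hasP)[y yw yt]|dis]; last first.
    move/negP: ndisj; apply.
    have jr1 : j < r.+1 by rewrite ltnS.
    apply/existsP; exists (Ordinal jr1).
    have sz : size (c :: s) == Ordinal jr1 by apply/eqP.
    apply/existsP; exists (Tuple sz) => /=; apply/and5P; split => //.
    - by rewrite -tj.
    - by rewrite cat_uniq ut us andbT.
    - by have := nth_cons_last x0 c s; rewrite -sj /= => ->; rewrite ls.
  move/negP: cN; apply; have /(nthP x0)[i iw yE] := yw.
  have upw : upth E (c :: s).
    by rewrite /upth us; have := sE; rewrite rooted_cycleE // => /andP[].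
  have is_ : i <= size s by rewrite -ltnS.
  apply: (@mem_near_rev E t c (take i s)).
  - exact: (upth_take i.+1 upw).
  - by rewrite size_takel //; apply: leq_trans jr; rewrite -sj.
  - rewrite -(nth_cons_last x0) size_takel // -[c :: take i s]/(take i.+1 (c :: s)) nth_take //.
    by rewrite yE.
(* A short cycle of the opened graph through a new edge [a c'], followed from [c'] by old edges,
   ends on [t], which makes [c'] near, or at [e'], and then the edge [c' e'] closes it to a short
   cycle of [E]. *)
have swp j al a b c' e' : j <= r -> uniq [:: a; b; c'; e'] -> is_cyc j al ->
    al \subset sw E a b c' e' -> [set a; c'] \in al -> a \in (t : seq V) -> b \in (t : seq V) ->
    c' \notin near E t -> adj E c' e' ->
    (forall j al, j <= r -> is_cyc j al -> al \subset E -> [set c'; e'] \notin al) -> False.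
  move=> jr U jal alF aca at_ bt c'N c'e' no.
  have [|p [pp up /andP[sp spj] lp]] := @switched_cycle_path n x0 E _ j al a b c' e' U _ jal alF aca.
    by move=> f; rewrite !inE; case/or3P => [->|->|/and3P[_ _ ->]]; rewrite ?orbT.
  have pE : path (adj E) c' p by apply: sub_path pp => x y; rewrite /adj inE => /andP[].
  have tcase : last c' p \in (t : seq V) -> False.
    move=> lt; move/negP: c'N; apply; apply: (@mem_near_rev E t c' p) => //.
      by rewrite /upth up.
    exact: leq_trans spj jr.
  move: lp; rewrite !inE => /or3P[/eqP lE|/eqP lE|/eqP lE]; [by apply: tcase; rewrite lE..|].
  have p2 : 1 < size p.
    case: (p) pp sp lE => // y [|z p'] //= /andP[h _] _ yE; rewrite yE in h.
    have := h; rewrite /adj inE => /andP[_]; rewrite -/(adj _ c' e') adj_sw eqxx /= orbF !set2_eq.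
    move: U; rewrite /= !inE !negb_or -!andbA => /and5P[nab nac nae nbc /and3P[nbe nce _]].
    rewrite (eq_sym c' a) (negPf nac) (eq_sym e' a) (negPf nae) (eq_sym c' b) (negPf nbc).
    by rewrite (eq_sym e' b) (negPf nbe) !andbF.
  have cE : cyc_edges (c' :: p) \subset E.
    rewrite rooted_cycleE //= pE nth_cons_last lE; exact: c'e'.
  have jal' : is_cyc (size p).+1 (cyc_edges (c' :: p)).
    by apply/is_cycP; exists (c' :: p).
  have := no _ _ (leq_trans spj jr) jal' cE.
  have := cyc_edges_last x0 up isT; rewrite /= nth_cons_last lE => h.
  by rewrite h.
rewrite inE cs /=.
have icE : inner_cycle k u = t.
  rewrite /inner_cycle /= -cats1 take_cat st ltnn subnn take0 cats0; exact: erefl.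
apply: (good_of_cycles (E := E)) => //; first by rewrite size_tuple.
- by rewrite k2.
- rewrite icE u1 uk u0 uk1 => j al jr jal alE /orP[f1|f2]; last first.
    by have := noce j al jr jal alE; rewrite f2.
  apply/eqP; apply: contraNT ndt => nal.
  have /is_cycP[t' [t2 tj ut' ct']] := jal; move: f1; rewrite -ct' setUC => f1.
  have [s [us ss cS ls]] := cyc_edges_start ut' f1.
  have sE : cyc_edges (nth t 0 :: s) \subset E by rewrite cS ct'.
  have sz1 : 1 < size s by rewrite -ltnS -[(size s).+1]/(size (nth t 0 :: s)) ss.
  have szj : (size s).+1 = j by rewrite -tj -ss.
  apply: (@detour_path n x0 _ r t 0 s) => //.
  - by rewrite st.
  - apply/(pathP x0) => i is_.
    have inal := cyc_edges_nth x0 us (is_ : i.+1 < size (nth t 0 :: s)).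
    have inE' := subsetP sE _ inal; rewrite /= in inE'.
    rewrite /drel /adj inE' st /=.
    rewrite set2_eq; apply/negP => /orP[]/andP[/eqP e1 /eqP e2].
      have i0 : i = 0 by apply: (nth_inj (x0 := x0) us) => //; apply: ltnW.
      have : 1 = size s.
        rewrite i0 in e2 is_; apply: (nth_inj (x0 := x0) us) => //.
        by rewrite nth_cons_last ls.
      by move=> e1s; rewrite -e1s in sz1.
    have : i = size s.
      by apply: (nth_inj (x0 := x0) us) => //; [exact: ltnW | rewrite nth_cons_last ls].
    by move=> is1; rewrite is1 ltnn in is_.
  - by case: (s) sz1.
  - by rewrite ls; apply: tin.
  - apply: contraNneq nal => sE'.
    have nE i : i < size s -> nth s i = nth t i.+1.
      by move=> is_; rewrite {1}sE' nth_take // nth_drop.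
    have szk : k.-1 = size s.
      have s0 : 0 < size s by apply: ltnW.
      apply: (nth_inj (x0 := x0) ut); rewrite ?st //.
        rewrite {1}sE' size_take_min size_drop st; apply: leq_ltn_trans (geq_minr _ _) _.
        by rewrite subn1 prednK.
      rewrite -ls -[in RHS](prednK s0) -nE ?prednK // nth_last.
      by case: (s) s0.
    rewrite -ct' -cS; apply/eqP; congr cyc_edges.
    apply: (@eq_from_nth _ x0); first by rewrite /= st -szk prednK.
    move=> i is_; case: i is_ => //= i is_; by rewrite nE.
  - by rewrite add0n -ltnS szj ltnW.
rewrite u1 uk u0 uk1 /unclose u1 uk u0 uk1 => j al jr jal alF; have /and5P[U _ _ _ _] := vE.
apply/andP; split; apply/negP => inal.
  by apply: (swp j al _ _ c e jr U jal alF inal) => //; apply: tin.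
rewrite swC1 in alF; apply: (swp j al _ _ e c jr _ jal alF inal) => //; try exact: tin.
- by move: vE; rewrite validC1 => /and5P[].
- by rewrite adjC.
- by move=> j' al' jr' jal' al'E; rewrite setUC; apply: noce j' al' jr' jal' al'E.
Qed.

End CycleSide.

(** * Mean number of good ways to open a cycle *)

Section CycleSideCount.
Variables (n d : nat) (x0 : 'I_n) (r : nat).
Local Notation V := 'I_n.
Local Notation q := (d - 1).
Local Notation G := (graphs n d).
Local Notation nth := (nth x0).
Implicit Types (E F : {set {set V}}) (v : seq V).
Hypothesis d3 : 3 <= d.
Hypothesis big : 2 * (2 * (2 * r + 4) + 4 * d + 2 * (d * d)) <= n * d.
Hypothesis nd0 : 0 < n * d.

Lemma mem_rooted k E (t : k.-tuple V) : 0 < k ->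
  (t \in rooted k E) = upth E t && adj E (nth t 0) (nth t k.-1).
Proof.
move=> k0; rewrite inE /upth -andbA; case: (boolP (uniq t)) => //= ut.
by rewrite (rooted_cycleE x0) ?size_tuple.
Qed.

(** A rooted [k]-cycle is a path on [k] vertices whose end sees its start, so this is [sum_rho] with
    [i = 0]. *)
Lemma sum_rooted k : 2 < k <= r -> \sum_(E in G) #|rooted k E| <= 2 * q ^ k * #|G|.
Proof.
case/andP; case: k => // L L2 Lr.
have L0 : 0 < L.-1 by clear -L2; lia.
have b1 : 2 * (2 * (L + 1) + 4 * d + 2 * (d * d)) <= n * d by clear -Lr big; lia.
have L1 : 1 < L by [].
apply: leq_trans (sum_rho x0 nd0 L1 L0 b1); apply: leq_sum => E _.
by apply/subset_leq_card/subsetP => t; rewrite mem_rooted // inE.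
Qed.

Definition two_paths k j :=
  tree predn k.-1 ++ [seq (k + i.-1, k + i) | i <- iota 1 j.-1].

Lemma two_paths_succ k j p : p \in two_paths k j -> p.2 = p.1.+1.
Proof.
rewrite mem_cat => /orP[]/mapP[i]; rewrite mem_iota => ii -> /=.
  by rewrite prednK //; case/andP: ii.
by case: i ii => // i _; rewrite addnS.
Qed.

Lemma emb_two_paths k j E (t : k.-tuple V) (w : j.-tuple V) : 0 < k -> 0 < j ->
  emb x0 E (two_paths k j) (t ++ w) = [&& uniq (t ++ w), upth E t & upth E w].
Proof.
move=> k0 j0; rewrite /emb; case: (boolP (uniq _)) => //=.
rewrite cat_uniq => /and3P[ut _ uw].
rewrite all_cat !(upth_emb x0) /emb !size_tuple ut uw /=; congr (_ && _).
  apply: eq_in_all => p /mapP[i]; rewrite mem_iota => ii -> /=.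
  have ik : i < k by move: ii; clear -k0; lia.
  by rewrite !nth_cat size_tuple ik (leq_ltn_trans (leq_pred i) ik).
rewrite /tree !all_map; apply: eq_in_all => i; rewrite mem_iota => ii /=.
by rewrite !nth_cat size_tuple !ltnNge !leq_addr /= !addKn.
Qed.

(** Two separate paths have at most [(n d) ^ 2 q ^ (k + j - 4)] copies; the two closing chords bring
    the factor [(2 q ^ 2 / (n d)) ^ 2], in which [n d] cancels. *)
Lemma sum_disjoint_cycles k j : 2 < k <= r -> 2 < j <= r ->
  \sum_(E in G) #|[set p : k.-tuple V * j.-tuple V | (p.1 \in rooted k E) &&
     (p.2 \in [set w : j.-tuple V | uniq (p.1 ++ w) && (cyc_edges w \subset E)])]|
  <= 4 * q ^ (k + j) * #|G|.
Proof.
move=> /andP[k2 kr] /andP[j2 jr].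
have k0 : 0 < k by apply: ltnW (ltnW _).
have j0 : 0 < j by apply: ltnW (ltnW _).
pose cl := [:: (0, k.-1); (k, k + j.-1)].
have fi : fit (two_paths k j ++ cl) (k + j).
  rewrite /fit all_cat; apply/andP; split; last by rewrite /= ; clear -k2 j2; lia.
  by apply/allP => p; rewrite mem_cat => /orP[]/mapP[i]; rewrite mem_iota => ii -> /=;
    move: ii; clear -k2 j2; lia.
have un : uniq (cl ++ two_paths k j).
  rewrite cat_uniq; apply/and3P; split.
  - by rewrite /= inE xpair_eqE andbT; clear -k2; lia.
  - apply/hasPn => p /two_paths_succ p2; rewrite !inE; apply/norP.
    by split; apply/eqP => pE; move: p2; rewrite pE /=; clear -k2 j2; lia.
  rewrite cat_uniq !map_inj_in_uniq ?iota_uniq //=; last first.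
  - by move=> i i' _ _ [].
  - by move=> i i' _ _ [_] /addnI.
  rewrite andbT; apply/hasPn => p /mapP[i]; rewrite mem_iota => ii ->.
  by apply/negP => /mapP[i']; rewrite mem_iota => ii' [_ e]; move: ii ii' e; clear -k2; lia.
have to : all (fun p => touches (two_paths k j) p.1 && touches (two_paths k j) p.2) cl.
  have tl i : i < k -> touches (two_paths k j) i.
    move=> ik; rewrite /touches has_cat; apply/orP; left.
    by apply: touches_tree; [exact: predn_lt | clear -k2; lia | clear -ik; lia].
  have tr i : i < j -> touches (two_paths k j) (k + i).
    move=> ij; rewrite /touches has_cat; apply/orP; right; apply/hasP.
    case: i ij => [|i] ij.
      exists (k + 0, k + 1); last by rewrite /= eqxx.
      by apply/mapP; exists 1 => //; rewrite mem_iota; clear -j2; lia.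
    exists (k + i, k + i.+1); last by rewrite /= eqxx orbT.
    by apply/mapP; exists i.+1 => //; rewrite mem_iota; clear -ij; lia.
  rewrite /= tl // tl ?prednK // -{2}[k]addn0 tr // tr ?prednK //.
have szt : size (two_paths k j) = k.-1 + j.-1 by rewrite size_cat !size_map !size_iota.
have b1 : 2 * (2 * (size (two_paths k j) + size cl) + 4 * d + 2 * (d * d)) <= n * d.
  by rewrite szt /=; clear -big kr jr k2 j2; lia.
have hc E : E \in G -> #|[set v : (k + j).-tuple V | emb x0 E (two_paths k j) v]| <=
    (n * d * q ^ (k - 2)) * (n * d * q ^ (j - 2)).
  move=> EG.
  pose A := [set t : k.-tuple V | upth E t]; pose B := [set t : j.-tuple V | upth E t].
  have cA m : 1 < m -> #|[set t : m.-tuple V | upth E t]| <= n * d * q ^ (m - 2).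
    case: m => [|[|m]] // _; have := card_upth x0 EG (isT : 0 < m.+1).
    by rewrite [m.+1 - 1]subn1 [m.+2 - 2]subn2.
  apply: (@leq_trans #|setX A B|); last by rewrite cardsX leq_mul // cA // ltnW.
  pose f (p : k.-tuple V * j.-tuple V) : (k + j).-tuple V := [tuple of p.1 ++ p.2].
  apply: leq_trans (leq_imset_card f (setX A B)).
  apply/subset_leq_card/subsetP => v; rewrite inE => ev.
  have s1 : size (take k v) == k by rewrite size_takel // size_tuple leq_addr.
  have s2 : size (drop k v) == j by rewrite size_drop size_tuple addKn.
  have vE : v = f (Tuple s1, Tuple s2) by apply: val_inj; rewrite /= cat_take_drop.
  apply/imsetP; exists (Tuple s1, Tuple s2) => //.
  have := emb_two_paths E (Tuple s1) (Tuple s2) k0 j0.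
  by rewrite /= cat_take_drop ev => /esym /and3P[_ u1 u2]; rewrite in_setX !inE u1 u2.
have := sum_emb_chords fi un to b1 hc; rewrite -[size cl]/2 => h.
have nd20 : 0 < (n * d) ^ 2 by rewrite expn_gt0 nd0.
rewrite -(leq_pmul2r nd20); apply: leq_trans (leq_trans h _); last first.
  have -> : k + j = 2 + 2 + (k - 2) + (j - 2) by clear -k2 j2; lia.
  rewrite !expnD; apply/eq_leq.
  by move: (q ^ 2) (q ^ (k - 2)) (q ^ (j - 2)) #|G| => A B C N; clear; rewrite -!mulnn; lia.
rewrite leq_mul2r; apply/orP; right; apply: leq_sum => E EG.
pose f (p : k.-tuple V * j.-tuple V) : (k + j).-tuple V := [tuple of p.1 ++ p.2].
have fI : injective f.
  move=> [u z] [u' z'] /(congr1 val) /= /eqP.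
  rewrite eqseq_cat ?size_tuple // => /andP[/eqP e1 /eqP e2].
  by congr (_, _); apply: val_inj.
rewrite -(card_imset _ fI); apply/subset_leq_card/subsetP => v /imsetP[[t w]].
rewrite [_ \in _]inE mem_rooted //= => /andP[/andP[upt adt]]; rewrite inE => /andP[utw wE] ->.
have uw : uniq w by move: utw; rewrite cat_uniq => /and3P[].
move: wE; rewrite (rooted_cycleE x0) ?size_tuple // => /andP[sw_ adw].
have e1 := emb_two_paths E t w k0 j0; rewrite utw upt /upth uw sw_ /= in e1.
rewrite inE /emb utw /= !nth_cat !size_tuple k0 ltnn subnn prednK // leqnn.
rewrite ltnNge leq_addr /= addKn adt adw /=.
by move: e1; rewrite /emb utw.
Qed.

Lemma card_good_cycles_le k E : E \in G -> 2 < k ->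
  #|good_cycles x0 r k E| <= #|rooted k E| * (n * d).
Proof.
move=> EG k2; rewrite -(card_arcs EG) -cardsX.
pose f (p : k.-tuple V * (V * V)) : k.+2.-tuple V := [tuple of p.2.1 :: rcons p.1 p.2.2].
apply: leq_trans (leq_imset_card f _); apply/subset_leq_card/subsetP => u.
rewrite inE => /andP[/and3P[uu iu /and5P[_ a1k a0k _ _]] _].
have su := size_tuple u.
have sz : size (inner_cycle k u) == k by rewrite size_inner_cycle.
apply/imsetP; exists (Tuple sz, (nth u 0, nth u k.+1)).
  rewrite in_setX !inE /= a0k andbT uniq_inner_cycle //=.
  by apply: (inner_cycle_edges (x0 := x0)).
apply: val_inj; rewrite /= /inner_cycle.
case: (tval u) su => // x u' [su'] /=; congr (_ :: _).
by rewrite -take_nth ?su' // take_oversize // su'.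
Qed.

(** A rooted cycle and an arc form a good pair unless an end of the arc is near, the cycle has a
    detour, or the arc lies on a disjoint short cycle. These cases contribute 20, 16 and 8, hence
    44. *)
Lemma sum_good_cycles_ge k : 2 < k <= r ->
  \sum_(E in G) #|rooted k E| * (n * d) <=
  \sum_(E in G) #|good_cycles x0 r k E| + 44 * k * d * q ^ (k + r) * #|G|.
Proof.
move=> kkr; have /andP[k2 kr] := kkr.
have k0 : 0 < k by apply: ltnW (ltnW _).
have r0 : 0 < r by apply: leq_trans kr.
pose Det E := [set t : k.-tuple V | (t \in rooted k E) && detour x0 (drel x0 E true t) r t].
pose Dis E j := [set p : k.-tuple V * j.-tuple V | (p.1 \in rooted k E) &&
     (p.2 \in [set w : j.-tuple V | uniq (p.1 ++ w) && (cyc_edges w \subset E)])].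
pose dis E j := if 2 < j then #|Dis E j| else 0.
pose bnd E := #|good_cycles x0 r k E| +
   (#|rooted k E| * (2 * d * (k * (5 * q ^ r))) + (#|Det E| * (n * d) + \sum_(j < r.+1) dis E j)).
have per E : E \in G -> #|rooted k E| * (n * d) <= bnd E.
  rewrite /bnd => EG.
  pose arcs := [set p : V * V | adj E p.1 p.2].
  pose P (t : k.-tuple V) := [set p : V * V | (p.1 \in near x0 r E t) && (p.2 \in nbr E p.1)].
  pose P' (t : k.-tuple V) := P t :|: [set (p.2, p.1) | p in P t].
  pose N := [set p : k.-tuple V * (V * V) | (p.1 \in rooted k E) && (p.2 \in P' p.1)].
  pose f (p : k.-tuple V * (V * V)) : k.+2.-tuple V := [tuple of p.2.1 :: rcons p.1 p.2.2].
  have fI : injective f.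
    move=> [t [c e]] [t' [c' e']] /(congr1 val) /= [-> /rcons_inj[e1 ->]].
    by congr (_, _); apply: val_inj.
  pose g j (p : k.-tuple V * j.-tuple V) : k.-tuple V * (V * V) :=
    (p.1, (nth p.2 0, nth p.2 j.-1)).
  pose D := \bigcup_(j < r.+1 | 2 < j) [set g j p | p in Dis E j].
  have sub : setX (rooted k E) arcs \subset
     (f @^-1: good_cycles x0 r k E) :|: (N :|: (setX (Det E) arcs :|: D)).
    apply/subsetP => -[t [c e]]; rewrite in_setX => /andP[tr]; rewrite inE /= => ce.
    have := tr; rewrite inE => /andP[ut tE].
    rewrite in_setU [X in _ || X]in_setU [X in _ || (_ || X)]in_setU in_setX.
    case: (boolP (c \in near x0 r E t)) => cN.
      apply/orP; right; apply/orP; left; rewrite inE tr /= in_setU; apply/orP; left.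
      by rewrite inE /= cN inE ce.
    case: (boolP (e \in near x0 r E t)) => eN.
      apply/orP; right; apply/orP; left; rewrite inE tr /= in_setU; apply/orP; right.
      apply/imsetP; exists (e, c) => //; rewrite inE /= eN inE adjC ce; exact: isT.
    case: (boolP (t \in Det E)) => tD.
      by apply/orP; right; apply/orP; right; apply/orP; left; rewrite inE.
    case: (boolP (disjoint_cycle x0 r E t c e)) => dc.
      apply/orP; right; apply/orP; right; apply/orP; right.
      have /existsP[j /existsP[w /and5P[j2 utw wE /eqP w0 /eqP wj]]] := dc.
      apply/bigcupP; exists j => //; apply/imsetP; exists (t, w); last by rewrite /g /= w0 wj.
      by rewrite inE /= tr inE utw wE.
    apply/orP; left; rewrite inE; apply: (rooted_good (d := d)) => //.
    by move: tD; rewrite inE tr.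
  have := subset_leq_card sub; rewrite cardsX (card_arcs EG) => /leq_trans; apply.
  have U (T : finType) (A B : {set T}) a b : #|A| <= a -> #|B| <= b -> #|A :|: B| <= a + b.
    by move=> ha hb; rewrite cardsU; apply: leq_trans (leq_subr _ _) (leq_add ha hb).
  apply: (@U _); last apply: (@U _); last apply: (@U _).
  - rewrite -(card_imset _ fI); apply/subset_leq_card/subsetP => u /imsetP[p pf ->].
    by rewrite inE in pf.
  - rewrite /N card_dep_pairs -sum_nat_const; apply: leq_sum => t tr.
    have cP : #|P t| <= d * (k * (5 * q ^ r)).
      rewrite /P card_dep_pairs.
      apply: (@leq_trans (\sum_(u in near x0 r E t) d)).
        by apply: leq_sum => u _; rewrite (card_nbr _ EG).
      rewrite sum_nat_const mulnC leq_mul2l.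
      by have := card_near x0 t EG d3 r0; rewrite size_tuple => ->; rewrite orbT.
    have := U _ _ _ _ _ cP (leq_trans (leq_imset_card (fun p : V * V => (p.2, p.1)) (mem (P t))) cP).
    by rewrite addnn -mul2n mulnA.
  - by rewrite cardsX (card_arcs EG).
  rewrite /dis /D [X in _ <= X](eq_bigr (fun j : 'I_r.+1 => if 2 < j then #|Dis E j| else 0)) //.
  rewrite -big_mkcond /=.
  apply: (big_ind2 (fun (A : {set k.-tuple V * (V * V)}) s => #|A| <= s)) => //.
  - by rewrite cards0.
  - by move=> A1 s1 A2 s2; apply: (@U _).
  - by move=> j _; apply: leq_imset_card.
apply: (@leq_trans (\sum_(E in G) bnd E)); first exact: leq_sum.
rewrite /bnd big_split /= leq_add2l big_split /= big_split /=.
have t1 : \sum_(E in G) #|rooted k E| * (2 * d * (k * (5 * q ^ r))) <= 20 * (k * d * q ^ (k + r)) * #|G|.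
  rewrite -big_distrl /=; apply: leq_trans (leq_mul (sum_rooted kkr) (leqnn _)) _.
  by rewrite expnD; apply/eq_leq; move: (q ^ k) (q ^ r) #|G| => A B N; clear; lia.
have qd : q <= d by apply: leq_subr.
have kE : k.-1.+1 = k by rewrite prednK.
have t2 : \sum_(E in G) #|Det E| * (n * d) <= 16 * (k * d * q ^ (k + r)) * #|G|.
  have k11 : 1 < k.-1 by clear -k2; lia.
  have k1r : k.-1 <= r.+1 by clear -kr; lia.
  have := @sum_detour n d x0 r d3 big nd0 true k.-1 k11 k1r; rewrite expn1 => h.
  rewrite -big_distrl /=; apply: leq_trans (leq_trans h _).
    rewrite leq_mul2r; apply/orP; right; apply: leq_sum => E EG.
    rewrite /Det; move: (kE) => kE'; clear -kE' k0; case: k k0 kE' => // K _ _ /=.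
    apply/subset_leq_card/subsetP => t; rewrite in_set mem_rooted // => /andP[/andP[ut ad] dt].
    by rewrite in_set ut dt size_tuple /= ad.
  (* The exponent is [k + r + 1]; the surplus factor [q] is bounded by [d]. *)
  rewrite kE; have -> : k.-1 + r + 2 * true = (k + r).+1 by clear -k0; lia.
  have -> : 2 ^ true.+3 = 16 by [].
  rewrite expnS -!mulnA leq_mul2l /=.
  rewrite leq_mul2l; apply/orP; right; rewrite !mulnA leq_mul2r leq_mul2r qd !orbT; exact: isT.
have t3 : \sum_(E in G) \sum_(j < r.+1) dis E j <= 8 * (k * d * q ^ (k + r)) * #|G|.
  rewrite exchange_big /=.
  apply: (@leq_trans (\sum_(j < r.+1) 4 * q ^ k * #|G| * q ^ j)).
    apply: leq_sum => j _; rewrite /dis; case: ltnP => j2; last by rewrite big1.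
    have jr : j <= r by rewrite -ltnS.
    apply: leq_trans (sum_disjoint_cycles kkr _) _; first by rewrite j2.
    by rewrite expnD; apply/eq_leq; move: (q ^ k) (q ^ j) #|G| => A B N; clear; lia.
  rewrite -big_distrr /=.
  have q2 : 2 <= q by clear -d3; lia.
  have g := geom_sum_le r.+1 q2; rewrite [q ^ r.+1]expnS mulnCA leq_pmul2l in g; last by apply: ltnW.
  apply: leq_trans (leq_mul (leqnn _) g) _.
  rewrite expnD; have kd : 1 <= k * d by rewrite muln_gt0 k0 /=; apply: leq_trans d3.
  have : 1 * (8 * q ^ k * q ^ r * #|G|) <= (k * d) * (8 * q ^ k * q ^ r * #|G|).
    by rewrite leq_mul2r kd orbT.
  by move: (q ^ k) (q ^ r) #|G| (k * d) => A B N C; clear; lia.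
have -> : 44 * k * d * q ^ (k + r) * #|G| = 20 * (k * d * q ^ (k + r)) * #|G| +
   (16 * (k * d * q ^ (k + r)) * #|G| + 8 * (k * d * q ^ (k + r)) * #|G|).
  by move: (q ^ _) #|G| => A N; clear; lia.
by apply: leq_add t1 (leq_add t2 t3).
Qed.

End CycleSideCount.

(** * Cyclically non-backtracking walks *)

Section PeriodicWalk.
Variables (n d : nat) (x0 : 'I_n) (r : nat).
Local Notation V := 'I_n.
Local Notation G := (graphs n d).
Local Notation nth := (nth x0).
Variable E : {set {set V}}.
Hypothesis EG : E \in G.

(** Both ends of a path send a chord back to it. For [i < j] this is a dumbbell, for [i = j] a
    figure eight, for [j < i] a theta graph; the third clause keeps the two chords distinct. *)
Definition two_chords L i j (v : seq V) :=
  [&& 1 < i <= L, j.+1 < L, (i != L) || (j != 0), size v == L.+1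
    & emb x0 E ([:: (0, i); (j, L)] ++ tree predn L) v].

Hypothesis no_two_chords : forall L i j v, L < r -> ~~ two_chords L i j v.
Variables (f : nat -> V) (k : nat).
Hypothesis k1 : 1 < k.
Hypothesis kr : k <= r.
Hypothesis fk : forall i, f (i + k) = f i.
Hypothesis fadj : forall i, adj E (f i) (f i.+1).
Hypothesis fnb : forall i, f i != f i.+2.

Lemma fkM i m : f (i + m * k) = f i.
Proof. by elim: m => [|m IH]; rewrite ?mul0n ?addn0 // mulSn addnCA addnC fk. Qed.

Lemma fmod i : f i = f (i %% k).
Proof. by rewrite {1}(divn_eq i k) addnC fkM. Qed.

Let P j := (0 < j) && [exists i : 'I_k, f i == f (i + j)].

Lemma f_neq1 i : f i != f i.+1.
Proof. by apply: (adj_neq EG). Qed.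

(* One step of a walk whose shortest return time is [j]: either it goes on
   following the cycle or the next return gives a second independent cycle. *)
Lemma return_step j a : 2 < j -> j <= k ->
  (forall i l, 0 < l < j -> f i != f (i + l)) -> f (a + j) = f a -> f (a.+1 + j) = f a.+1.
Proof.
move=> j2 jk fmin faj; apply/eqP; apply: contraT => ne1.
pose h s := f (a + s).
have hj : h j = h 0 by rewrite /h addn0.
have hj1 : h j.+1 != h 1 by rewrite /h addnS -addSn addn1.
have hadj s : adj E (h s) (h s.+1) by rewrite /h addnS.
have hnb s : h s != h s.+2 by rewrite /h !addnS.
have h1 s : h s != h s.+1 by rewrite /h addnS f_neq1.
have jk' : j < k.
  rewrite ltn_neqAle jk andbT; apply: contraNneq ne1 => ->.
  by rewrite fk.
(* The least such [s] is the first time after [j] at which the walk from [a] meets a vertex visited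
   before; the period [k] shows that there is one. *)
pose Q s := (j < s) && (h s \in [seq h i | i <- iota 0 s]).
have exQ : exists s, Q s.
  exists k; rewrite /Q jk'; apply/mapP; exists 0; first by rewrite mem_iota /= ltnW.
  by rewrite /h fk addn0.
case: (ex_minnP exQ) => s /andP[js /mapP[i0]]; rewrite mem_iota => /= i0s hs smin.
have sk : s <= k.
  apply: smin; rewrite /Q jk'; apply/mapP; exists 0; first by rewrite mem_iota /= ltnW.
  by rewrite /h fk addn0.
have hI i i' : i < i' -> i' < s -> i' != j -> h i != h i'.
  move=> ii' i's i'j; case: (ltngtP i' j) => [lt|gt|e]; last by rewrite e eqxx in i'j.
    have -> : h i' = f (a + i + (i' - i)) by rewrite /h; congr f; clear -ii'; lia.
    by apply: fmin; clear -ii' lt; lia.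
  apply: contraL i's => /eqP e; rewrite -leqNgt; apply: smin; rewrite /Q gt.
  by rewrite -e; apply/mapP; exists i => //; rewrite mem_iota.
(* The path [v] reads [h] backwards from [s - 1] down to [j + 1], which is [c] vertices, then
   forwards [h 0 = h j], [h 1], ..., [h j.-1]. Its first vertex is adjacent to [h s], its last one
   to [h 0]: these are the two chords. *)
pose c := s - j.+1.
have sE : s = c + j.+1 by rewrite subnK.
pose idx b := if b < c then s.-1 - b else b - c.
pose v := [seq h (idx b) | b <- iota 0 s.-1].
have szv : size v = s.-1 by rewrite size_map size_iota.
have nv b : b < s.-1 -> nth v b = h (idx b).
  by move=> bs; rewrite (nth_map 0) ?size_iota // nth_iota.
have uv : uniq v.
  rewrite map_inj_in_uniq ?iota_uniq // => b b'; rewrite !mem_iota /= => bs bs'.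
  have wl x y : x < y -> x < s -> y < s -> x != j -> y != j -> h x != h y.
    by move=> xy _ ys _ yj; apply: hI.
  have ib x : x < s.-1 -> (idx x < s) && (idx x != j).
    by rewrite /idx; case: (ltnP x c) => bc; clear -sE j2 bc; lia.
  have idxI x y : x < s.-1 -> y < s.-1 -> idx x = idx y -> x = y.
    by rewrite /idx; case: (ltnP x c) => xc; case: (ltnP y c) => yc; clear -sE j2 xc yc; lia.
  have /andP[i1 i2] := ib _ bs; have /andP[i1' i2'] := ib _ bs'.
  move=> e; have : idx b = idx b'.
    case: (ltngtP (idx b) (idx b')) => // lt.
      by have := wl _ _ lt i1 i1' i2 i2'; rewrite e eqxx.
    by have := wl _ _ lt i1' i1 i2' i2; rewrite e eqxx.
  exact: idxI.
have vc : nth v c = h 0 by rewrite nv /idx ?ltnn ?subnn //; clear -sE j2; lia.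
have vpath b : b.+1 < s.-1 -> adj E (nth v b) (nth v b.+1).
  move=> bs; rewrite !nv //; last by apply: ltnW.
  rewrite /idx; case: (ltngtP b.+1 c) => bc.
  - have -> : s.-1 - b = (s.-1 - b.+1).+1 by clear -bs; lia.
    by rewrite adjC.
  - have -> : b.+1 - c = (b - c).+1 by clear -bc; lia.
    exact: hadj.
  - have -> : s.-1 - b = j.+1 by clear -bc sE; lia.
    by rewrite bc subnn -hj adjC.
have v0 : nth v 0 = h s.-1.
  rewrite nv /idx; last by clear -sE j2; lia.
  case: (posnP c) => c0; last by rewrite subn0.
  by rewrite sub0n -hj; congr h; clear -sE c0; lia.
(* The first chord does not end at position 1, by non-backtracking, or by [hj1] when [c = 0]. *)
have v1 : nth v 1 != h s.
  rewrite nv /idx; last by clear -sE j2; lia.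
  case: (ltngtP 1 c) => c1.
  - have e : (s.-1 - 1).+2 = s by clear -c1 sE; lia.
    by have := hnb (s.-1 - 1); rewrite e.
  - have c0 : c = 0 by clear -c1; lia.
    by rewrite c0 subn0 eq_sym sE c0 add0n.
  - rewrite -c1 subnn -hj; have -> : s = j.+2 by clear -c1 sE; lia.
    exact: hnb.
have [b bs vb] : exists2 b, b < s.-1 & nth v b = h s.
  have inv i : i < s -> i != j -> exists2 b, b < s.-1 & nth v b = h i.
    move=> is_ ij; case: (ltnP i j) => lt.
      exists (c + i); first by clear -lt sE; lia.
      rewrite nv /idx; last by clear -lt sE; lia.
      by rewrite ltnNge leq_addr /= addKn.
    exists (s.-1 - i); first by clear -lt sE is_ ij j2; lia.
    rewrite nv /idx; last by clear -lt sE is_ ij j2; lia.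
    have -> : s.-1 - i < c by clear -lt sE is_ ij; lia.
    by congr h; clear -is_; lia.
  case: (eqVneq i0 j) => [e|ne]; last by rewrite hs; apply: inv.
  by rewrite hs e hj; apply: inv; clear -js j2; lia.
have b2 : 1 < b.
  case: b bs vb => [|[|b]] bs vb //; last by rewrite vb eqxx in v1.
  by have := h1 s.-1; rewrite prednK -?v0 ?vb ?eqxx //; clear -js; lia.
have vL : nth v s.-2 = h j.-1.
  rewrite nv /idx; last by clear -sE j2; lia.
  by have -> : (s.-2 < c) = false by [clear -sE j2; lia]; congr h; clear -sE; lia.
have Lr : s.-2 < r by clear -sk kr js; lia.
have /negP := @no_two_chords s.-2 b c v Lr; case.
apply/and5P; split.
- by clear -b2 bs; lia.
- by clear -sE j2; lia.
- case: (posnP c) => [c0|]; last by rewrite orbT.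
  rewrite /= orbF; apply/eqP => bE; have := hnb j.-1.
  rewrite -vL -bE vb; have -> : j.-1.+2 = s by clear -sE c0 j2; lia.
  by rewrite eqxx.
- by rewrite szv; clear -js j2; lia.
rewrite /emb uv /=; apply/and3P; split.
- rewrite v0 vb; have e : s.-1.+1 = s by clear -js; lia.
  by have := hadj s.-1; rewrite e.
- rewrite vc vL -hj adjC; have e : j.-1.+1 = j by clear -j2; lia.
  by have := hadj j.-1; rewrite e.
apply/allP => p /mapP[i]; rewrite mem_iota => ii -> /=.
have e : i = i.-1.+1 by move: ii; clear; lia.
by have := vpath i.-1; rewrite -e; apply; move: ii; clear; lia.
Qed.

(** [j] is the least return time over all starting points. [return_step] carries the return from one
    starting point to all later ones, and periodicity to all. Leastness gives injectivity and,
    applied to [k %% j], divisibility. *)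
Lemma walk_period : exists j, [/\ 2 < j, j %| k, forall i, f (i + j) = f i &
  uniq [seq f i | i <- iota 0 j]].
Proof.
have exP : exists j, P j.
  exists k; rewrite /P ltnW //=; apply/existsP; exists (Ordinal (ltnW k1)).
  by rewrite fk eqxx.
case: (ex_minnP exP) => j /andP[j0 /existsP[i0 /eqP fi0]] jmin.
have fmin i l : 0 < l < j -> f i != f (i + l).
  move=> /andP[l0 lj]; apply: contraTneq lj => e; rewrite -leqNgt; apply: jmin.
  rewrite /P l0; apply/existsP; exists (Ordinal (ltn_pmod i (ltnW k1))).
  by rewrite /= -fmod e fmod [X in _ == X]fmod modnDml.
have jk : j <= k.
  apply: jmin; rewrite /P ltnW //=; apply/existsP; exists (Ordinal (ltnW k1)).
  by rewrite fk eqxx.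
have j2 : 2 < j.
  case: j j0 fi0 {jmin fmin jk} => [|[|[|j]]] // _ fi0.
    by have := f_neq1 i0; rewrite -addn1 -fi0 eqxx.
  by have := fnb i0; rewrite -addn2 -fi0 eqxx.
have per m : f (i0 + m + j) = f (i0 + m).
  elim: m => [|m IH]; first by rewrite addn0.
  by rewrite addnS; apply: return_step.
have fj i : f (i + j) = f i.
  rewrite -(fkM (i + j) i0) -(fkM i i0) addnAC.
  have i0k : i0 <= i + i0 * k.
    by apply: leq_trans (leq_addl _ _); rewrite leq_pmulr // ltnW.
  by rewrite -(subnKC i0k) per.
have fjM i m : f (i + m * j) = f i.
  by elim: m => [|m IH]; rewrite ?mul0n ?addn0 // mulSn addnCA addnC fj.
exists j; split => //; last first.
  rewrite map_inj_in_uniq ?iota_uniq // => i i'; rewrite !mem_iota /= => ij i'j.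
  have wl x y : x < y -> y < j -> f x != f y.
    by move=> xy yj; have := @fmin x (y - x); rewrite subnKC ?(ltnW xy) //; apply; clear -xy yj; lia.
  move=> e; case: (ltngtP i i') => // lt; first by have := wl _ _ lt i'j; rewrite e eqxx.
  by have := wl _ _ lt ij; rewrite e eqxx.
rewrite /dvdn; apply: contraT; rewrite -lt0n => m0.
have := @fmin 0 (k %% j); rewrite m0 ltn_pmod // => /(_ isT).
by rewrite add0n -(fjM (k %% j) (k %/ j)) addnC -divn_eq -[k]add0n fk eqxx.
Qed.

End PeriodicWalk.

(** * Cyclically non-backtracking walks as windings of a single cycle *)

Section CNBWCount.
Variables (n d : nat) (x0 : 'I_n) (r : nat).
Local Notation V := 'I_n.
Local Notation q := (d - 1).
Local Notation G := (graphs n d).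
Local Notation nth := (nth x0).
Implicit Types (E F : {set {set V}}) (v : seq V).

Definition bad_graph E := [exists L : 'I_r, [exists i : 'I_r, [exists j : 'I_r,
  [exists v : L.+1.-tuple V, two_chords x0 E L i j v]]]].

Lemma not_bad_graph E : ~~ bad_graph E ->
  forall L i j v, L < r -> ~~ two_chords x0 E L i j v.
Proof.
move=> nb L i j v Lr; apply: contraNN nb => tc; have /and5P[/andP[_ iL] jL _ sv _] := tc.
have ir : i < r by apply: leq_ltn_trans iL Lr.
have jr : j < r by apply: ltn_trans Lr; apply: ltnW.
apply/existsP; exists (Ordinal Lr); apply/existsP; exists (Ordinal ir).
by apply/existsP; exists (Ordinal jr); apply/existsP; exists (Tuple sv).
Qed.

(** There are at most [r ^ 3] shapes. Each is a path with [L < r] edges and two chords, so its mean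
    number of copies is at most [4 q ^ (L + 3) / (n d)]. *)
Lemma card_bad_graph : 3 <= d -> 0 < n * d ->
  2 * (2 * (2 * r + 4) + 4 * d + 2 * (d * d)) <= n * d ->
  #|[set E in G | bad_graph E]| * (n * d) <= 4 * r ^ 3 * q ^ (r + 2) * #|G|.
Proof.
move=> d3 nd0 big.
pose X E (L i j : 'I_r) := #|[set v : L.+1.-tuple V | two_chords x0 E L i j v]|.
have le1 : #|[set E in G | bad_graph E]| <=
    \sum_(E in G) \sum_(L < r) \sum_(i < r) \sum_(j < r) X E L i j.
  rewrite -sum1dep_card big_mkcondr /=; apply: leq_sum => E EG; case: ifP => // .
  case/existsP => L /existsP[i /existsP[j /existsP[v tc]]].
  rewrite (bigD1 L) //= (bigD1 i) //= (bigD1 j) //=.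
  apply: leq_trans (leq_addr _ _); apply: leq_trans (leq_addr _ _); apply: leq_trans (leq_addr _ _).
  by apply/card_gt0P; exists v; rewrite inE.
have each (L i j : 'I_r) : (\sum_(E in G) X E L i j) * (n * d) <= 4 * q ^ (r + 2) * #|G|.
  case: (boolP [&& 1 < i <= L, j.+1 < L & (i != L :> nat) || (j != 0 :> nat)]) => [/and3P[iL jL ij]|nc].
    have L0 : 0 < L by apply: leq_trans jL.
    have Lr := ltn_ord L.
    have acl : all (fun p => [&& p.1 < p.2, p.2 <= L & p.1 != predn p.2]) [:: (0, val i); (val j, val L)].
      by rewrite /=; clear -iL jL; lia.
    have ucl : uniq [:: (0, val i); (val j, val L)].
      by rewrite /= inE xpair_eqE andbT; clear -ij; lia.
    have b1 : 2 * (2 * (L + size [:: (0, val i); (val j, val L)]) + 4 * d + 2 * (d * d)) <= n * d.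
      by rewrite /=; clear -Lr big; lia.
    have h := sum_tree_chords x0 (@predn_lt) L0 acl ucl b1.
    rewrite -[size _]/2 in h.
    rewrite -(leq_pmul2r nd0); apply: leq_trans (leq_trans h _).
      rewrite -mulnA mulnn leq_mul2r; apply/orP; right; apply: leq_sum => E EG.
      by apply/subset_leq_card/subsetP => v; rewrite !inE => /and5P[].
    have le : q ^ 2 * q ^ 2 * q ^ (L - 1) <= q ^ (r + 2).
      by rewrite -!expnD leq_pexp2l //; clear -d3 L0 Lr; lia.
    have := leq_mul (leqnn (4 * #|G| * (n * d))) le.
    move: (q ^ 2) (q ^ (L - 1)) (q ^ (r + 2)) #|G| (n * d) => A B C N D; clear.
    by rewrite -[(2 * A) ^ 2]mulnn; lia.
  rewrite big1 // => E _; apply/eqP; rewrite cards_eq0; apply/eqP/setP => v; rewrite !inE.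
  by apply/negP => /and5P[h1 h2 h3 _ _]; rewrite h1 h2 h3 in nc.
apply: leq_trans (leq_mul le1 (leqnn _)) _.
rewrite exchange_big /= big_distrl /=.
apply: (@leq_trans (\sum_(L < r) \sum_(i < r) \sum_(j < r) 4 * q ^ (r + 2) * #|G|)).
  apply: leq_sum => L _; rewrite exchange_big /= big_distrl /=; apply: leq_sum => i _.
  by rewrite exchange_big /= big_distrl /=; apply: leq_sum => j _; apply: each.
rewrite !sum_nat_const !card_ord; apply/eq_leq.
by rewrite -[r ^ 3]/(r * (r * r)); move: (q ^ _) #|G| => A N; clear; lia.
Qed.

Lemma is_cnbwP k E (w : k.+1.-tuple V) : 1 < k ->
  reflect [/\ nth w k = nth w 0, forall i, i < k -> adj E (nth w i) (nth w i.+1),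
     forall i, i.+1 < k -> nth w i != nth w i.+2 & nth w k.-1 != nth w 1]
   (is_cnbw (adj E) w).
Proof.
move=> k1; have sw := size_tuple w.
have k0 : 0 < k by apply: ltnW.
case wE : (tval w) sw => [|x p] // [sp].
have szs : size (steps (x :: p)) = k by rewrite size_zip /= sp (minn_idPr (leqnSn k)).
have ns i : i < k -> seq.nth (x0, x0) (steps (x :: p)) i = (nth (x :: p) i, nth (x :: p) i.+1).
  by move=> ik; rewrite nth_zip_cond -/(steps (x :: p)) szs ik.
have lastE : last_step_not_rev_first (x :: p) = (nth (x :: p) k.-1 != nth (x :: p) 1) || (nth (x :: p) k != nth (x :: p) 0).
  have -> : last_step_not_rev_first (x :: p) = (seq.nth (x0, x0) (steps (x :: p)) k.-1 != rev_step (seq.nth (x0, x0) (steps (x :: p)) 0)).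
    rewrite /last_step_not_rev_first; case: (steps _) szs => [|s ss] /= sz; first by rewrite -sz in k0.
    by rewrite -sz -[(size ss).+1.-1]/(size (s :: ss)).-1 nth_last.
  rewrite !ns // ?prednK // /rev_step /= xpair_eqE negb_and; congr (_ || _).
have lastp : nth (x :: p) k = last x p by rewrite -sp; exact: (nth_last x0 (x :: p)).
have nbE : reflect (forall i, i.+1 < k -> nth (x :: p) i != nth (x :: p) i.+2) (non_backtracking (x :: p)).
  apply: (iffP (sortedP (x0, x0))) => h i; rewrite ?szs => ik.
    have := h i; rewrite szs => /(_ ik); rewrite !ns // ?(ltnW ik) //.
    by rewrite /rev_step xpair_eqE /= eqxx /= eq_sym.
  rewrite !ns // ?(ltnW ik) // /rev_step xpair_eqE /= eqxx /= eq_sym.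
  exact: h.
apply: (iffP and3P) => [[/andP[/(pathP x0) pth /eqP cl] /nbE nb ls]|[cl pth nb ls]].
  split => //; first by rewrite lastp cl.
    by move=> i ik; apply: pth; rewrite sp.
  by move: ls; rewrite lastE lastp cl eqxx orbF.
split.
- apply/andP; split; last by rewrite -lastp cl.
  by apply/(pathP x0) => i; rewrite sp => ik; apply: pth.
- exact/nbE.
by rewrite lastE ls.
Qed.

Definition unroll j k (t : seq V) : k.+1.-tuple V := [tuple of mkseq (fun i => nth t (i %% j)) k.+1].

Lemma nth_unroll j k t i : i <= k -> nth (unroll j k t) i = nth t (i %% j).
Proof. by move=> ik; rewrite nth_mkseq. Qed.

Lemma unroll_cnbw j k E (t : j.-tuple V) : 2 < j -> j %| k -> 1 < k -> t \in rooted j E ->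
  is_cnbw (adj E) (unroll j k t).
Proof.
move=> j2 jk k1 tr; have j0 : 0 < j by apply: ltnW (ltnW _).
have := tr; rewrite inE => /andP[ut _].
move: tr; rewrite (mem_rooted x0) // => /andP[/andP[_ /(sortedP x0) so] cl]; rewrite size_tuple in so.
have jlek : j <= k by apply: dvdn_leq => //; apply: ltnW.
have tadj i : adj E (nth t (i %% j)) (nth t (i.+1 %% j)).
  rewrite -addn1 -modnDml addn1; have := ltn_pmod i j0; move: (i %% j) => m mj.
  case: (ltnP m.+1 j) => mj1; first by rewrite modn_small // so.
  have -> : m.+1 = j by apply/eqP; rewrite eqn_leq mj mj1.
  have -> : m = j.-1 by clear -mj mj1; lia.
  by rewrite modnn adjC.
have tnb i : nth t (i %% j) != nth t (i.+2 %% j).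
  rewrite nth_uniq ?size_tuple ?ltn_pmod // -addn2 -modnDml; have := ltn_pmod i j0; move: (i %% j) => m mj.
  case: (ltnP (m + 2) j) => mj2; first by rewrite modn_small //; clear; lia.
  have -> : m + 2 = (m + 2 - j) + j by clear -mj2; lia.
  by rewrite modnDr modn_small; clear -mj mj2 j2; lia.
apply/is_cnbwP => //; split.
- by rewrite !nth_unroll // mod0n (eqP jk).
- by move=> i ik; rewrite !nth_unroll // ltnW.
- by move=> i ik; rewrite !nth_unroll // ltnW // ltnW.
- rewrite !nth_unroll ?leq_pred //; last by apply: ltnW.
  have := tnb k.-1; have -> : k.-1.+2 = 1 + k by clear -k1; lia.
  by rewrite -modnDmr (eqP jk) addn0.
Qed.

(** The walk is read as a [k]-periodic function, to which [walk_period] applies; at the seam the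
    non-backtracking condition is the one on the last and first steps. *)
Lemma cnbw_unroll k E (w : k.+1.-tuple V) : E \in G -> ~~ bad_graph E -> 1 < k <= r ->
  is_cnbw (adj E) w ->
  exists2 j, (2 < j) && (j %| k) & exists2 t : j.-tuple V, t \in rooted j E & w = unroll j k t.
Proof.
move=> EG nb /andP[k1 kr] /(is_cnbwP _ _ k1)[cl wadj wnb wl].
have k0 : 0 < k by apply: ltnW.
pose f i := nth w (i %% k).
have fk i : f (i + k) = f i by rewrite /f modnDr.
have fadj i : adj E (f i) (f i.+1).
  rewrite /f -[i.+1]addn1 -modnDml addn1; have := ltn_pmod i k0; move: (i %% k) => m mk.
  case: (ltnP m.+1 k) => mk1; first by rewrite modn_small // wadj.
  have -> : m.+1 = k by apply/eqP; rewrite eqn_leq mk mk1.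
  have e : k = m.+1 by apply/eqP; rewrite eqn_leq mk mk1.
  by rewrite modnn -cl; have := wadj m mk; rewrite -e.
have fnb i : f i != f i.+2.
  rewrite /f -[i.+2]addn2 -modnDml addn2; have := ltn_pmod i k0; move: (i %% k) => m mk.
  case: (ltngtP m.+2 k) => mk2.
  - by rewrite modn_small // wnb // ltnW.
  - have -> : m = k.-1 by clear -mk mk2; lia.
    have -> : k.-1.+2 = 1 + k by clear -k0; lia.
    by rewrite modnDr modn_small.
  - rewrite mk2 modnn -cl; have := wnb m; rewrite mk2; apply; by clear -mk2; lia.
have [j [j2 jk fj uf]] := walk_period EG (not_bad_graph nb) k1 kr fk fadj fnb.
have j0 : 0 < j by apply: ltnW (ltnW _).
exists j; first by rewrite j2.
have sz : size [seq f i | i <- iota 0 j] == j by rewrite size_map size_iota.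
have nf i : i < j -> nth [seq f i | i <- iota 0 j] i = f i.
  by move=> ij; rewrite (nth_map 0) ?size_iota // nth_iota.
exists (Tuple sz).
  rewrite (mem_rooted x0) // /upth uf /= nf // nf ?prednK //; apply/andP; split.
    apply/(sortedP x0) => i; rewrite (eqP sz) => ij; rewrite !nf //; exact: ltnW.
  by rewrite -[f 0]fj add0n adjC; have := fadj j.-1; rewrite prednK.
have fjM i m : f (i + m * j) = f i.
  by elim: m => [|m IH]; rewrite ?mul0n ?addn0 // mulSn addnCA addnC fj.
apply: val_inj; apply: (@eq_from_nth _ x0); first by rewrite !size_tuple.
move=> i; rewrite size_tuple ltnS => ik; rewrite nth_unroll //= nf ?ltn_pmod //.
rewrite -(fjM _ (i %/ j)) addnC -divn_eq /f.
case: (ltnP i k) => ik'; first by rewrite modn_small.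
have -> : i = k by apply/eqP; rewrite eqn_leq ik ik'.
by rewrite modnn.
Qed.

(** The walks are the windings of rooted [j]-cycles with [j] dividing [k], and each [j]-cycle has
    [2 * j] rootings. Divisors up to 2 carry no cycle. *)
Lemma card_cnbw k E : E \in G -> ~~ bad_graph E -> 0 < k <= r ->
  #|[set w : k.+1.-tuple V | is_cnbw (adj E) w]| =
  \sum_(j <- divisors k) 2 * j * cycle_count E j.
Proof.
move=> EG nb /andP[k0 kr].
have cc0 j : j <= 2 -> cycle_count E j = 0.
  move=> j2; apply/eqP; rewrite cards_eq0; apply/eqP/setP => al; rewrite !inE /is_cyc.
  by rewrite ltnNge j2.
case: (ltnP 1 k) => k1; last first.
  have -> : k = 1 by apply/eqP; rewrite eqn_leq k1 k0.
  have -> : divisors 1 = [:: 1] by [].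
  rewrite big_seq1 cc0 // muln0; apply/eqP; rewrite cards_eq0; apply/eqP/setP => w.
  rewrite !inE; apply/negP => /and3P[]; case: w => -[|x [|y [|z s]]] //= _.
  by rewrite andbT => /andP[xy /eqP yx]; rewrite yx (adjxx _ EG) in xy.
pose cond j := (2 < j) && (j %| k).
pose Fj (j : 'I_k.+1) : {set k.+1.-tuple V} :=
  if cond j then [set unroll j k t | t : j.-tuple V in rooted j E] else set0.
have CNE : [set w : k.+1.-tuple V | is_cnbw (adj E) w] = \bigcup_j Fj j.
  apply/setP => w; rewrite inE; apply/idP/bigcupP.
    move=> cw; have [|j cj [t tr wE]] := cnbw_unroll EG nb _ cw; first by rewrite k1.
    have jk : j < k.+1 by rewrite ltnS dvdn_leq //; case/andP: cj.
    by exists (Ordinal jk) => //; rewrite /Fj /cond /= cj; apply/imsetP; exists t.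
  case=> j _; rewrite /Fj; case: ifP; rewrite ?inE // => /andP[j2 jk] /imsetP[t tr ->].
  exact: unroll_cnbw.
(* For [a < b] the entries 0 and [a] agree in a winding of an [a]-cycle and differ in one of a
   [b]-cycle. *)
have dis i j : i != j -> [disjoint Fj i & Fj j].
  move=> ij; rewrite -setI_eq0; apply/eqP/setP => w; rewrite !inE; apply/negP.
  have wl (a b : 'I_k.+1) : a < b -> w \in Fj a -> w \in Fj b -> False.
    rewrite /Fj => ab; case: ifP; rewrite ?inE // => /andP[a2 ak] /imsetP[t _ ->].
    case: ifP; rewrite ?inE // => /andP[b2 bk] /imsetP[t' /setIdP[ut' _]] /(congr1 (fun s : k.+1.-tuple V => (nth s 0, nth s a))).
    have ak1 : a <= k by rewrite -ltnS.
    rewrite !nth_unroll // modnn !mod0n [a %% b]modn_small // => -[-> /eqP].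
    rewrite nth_uniq ?size_tuple //; last by apply: leq_ltn_trans ab.
    by move/eqP => e; rewrite -e in a2.
  move=> /andP[wi wj]; case: (ltngtP i j) => lt; first exact: wl lt wi wj.
    exact: wl lt wj wi.
  by move/eqP: ij; apply; apply: val_inj.
rewrite CNE -sum1_card (partition_disjoint_bigcup _ _ dis) /=.
under eq_bigr => j _ do rewrite sum1_card.
have FE (j : 'I_k.+1) : #|Fj j| = if j %| k then 2 * j * cycle_count E j else 0.
  rewrite /Fj /cond; case: (ltnP 2 j) => j2 /=; last by rewrite cards0 cc0 // muln0 if_same.
  case: ifP => jk; last by rewrite cards0.
  rewrite card_in_imset; first by rewrite -card_rooted_cycles.
  move=> t t' _ _ /(congr1 val) e; apply: val_inj; apply: (@eq_from_nth _ x0).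
    by rewrite !size_tuple.
  move=> i; rewrite size_tuple => ij; have := congr1 (fun s => nth s i) e.
  have jk' : j <= k by rewrite -ltnS.
  by rewrite /= !nth_unroll ?modn_small //; apply: leq_trans (ltnW ij) jk'.
rewrite (eq_bigr _ (fun j _ => FE j)) -big_mkcond /=.
rewrite -(big_mkord (fun j => j %| k) (fun j => 2 * j * cycle_count E j)) -big_filter.
apply: perm_big; apply: uniq_perm; rewrite ?filter_uniq ?iota_uniq ?divisors_uniq //.
move=> j; rewrite mem_filter mem_iota -dvdn_divisors //= subn0 add0n.
by case: (boolP (j %| k)) => //= jk; rewrite ltnS dvdn_leq.
Qed.

End CNBWCount.

From mathcomp Require Import all_order all_algebra.
From mathcomp Require Import ring lra.
Import Order.TTheory GRing.Theory Num.Theory.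
Local Open Scope ring_scope.

(** * The Stein equation for one Poisson variable *)

Section TailSteps.
Variables (R : realFieldType) (s : R).
Hypothesis s1 : 1 <= s.
Local Notation lam := (s ^+ 2).

Let s0 : 0 < s. Proof. exact: lt_le_trans s1. Qed.
Let l0 : 0 < lam. Proof. by rewrite exprn_gt0. Qed.

(** Here [a], [b] are the weights at [x], [x + 1], and [S] is the sum of the weights up to [x]. At
    distance [s] or more from the mean [s ^ 2], the ratio of successive weights preserves the bound
    [s + 1] on tail over last weight; closer to the mean the bound grows by 1 per step. *)
Lemma lower_step_far (x a b S : R) : 0 < b -> b * (x + 1) = lam * a ->
  x + 1 <= lam - s -> S <= (s + 1) * a -> S + b <= (s + 1) * b.
Proof.
move=> b0 ab xs SB; rewrite -(ler_pM2l l0).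
have sb : 0 <= (s + 1) * b by rewrite mulr_ge0 ?(ltW b0) //; have := s1; lra.
have h1 := ler_wpM2l (ltW l0) SB; have h2 := ler_wpM2l sb xs.
have e1 : (s + 1) * (lam * a) = (s + 1) * (b * (x + 1)) by rewrite ab.
have h3 : 0 <= s * b by rewrite mulr_ge0 ?ltW ?s0.
by move: h1 h2 e1 h3; lra.
Qed.

Lemma lower_step_near (x a b S c : R) : 0 < b -> b * (x + 1) = lam * a ->
  x + 1 <= lam -> 0 <= c -> S <= c * a -> S + b <= (c + 1) * b.
Proof.
move=> b0 ab xl c0 SB; rewrite -(ler_pM2l l0).
have cb : 0 <= c * b by rewrite mulr_ge0 ?(ltW b0).
have h1 := ler_wpM2l (ltW l0) SB; have h2 := ler_wpM2l cb xl.
have e1 : c * (lam * a) = c * (b * (x + 1)) by rewrite ab.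
by move: h1 h2 e1; lra.
Qed.

Lemma upper_step (x a b S B B' : R) : 0 < a -> 0 < b -> 0 < x + 1 ->
  b * (x + 1) = lam * a -> (1 + B) * lam <= B' * (x + 1) ->
  S <= B * b -> b + S <= B' * a.
Proof.
move=> a0 b0 x0 ab hB SB; rewrite -(ler_pM2r x0).
have h1 := ler_wpM2r (ltW x0) SB; have h2 := ler_wpM2r (ltW a0) hB.
have e1 : (1 + B) * (lam * a) = (1 + B) * (b * (x + 1)) by rewrite ab.
by move: h1 h2 e1; lra.
Qed.

Lemma upper_step_far (x : R) : lam + s <= x + 1 ->
  (1 + (s + 1)) * lam <= (s + 1) * (x + 1).
Proof.
move=> xs; have s10 : 0 <= s + 1 by have := s1; lra.
by have := ler_wpM2l s10 xs; have := s0; lra.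
Qed.

End TailSteps.

Section SteinPoisson.
Variables (R : realFieldType) (s : R) (p : nat -> R).
Local Notation lam := (s ^+ 2).
Hypothesis s1 : 1 <= s.
Hypothesis p_gt0 : forall j, 0 < p j.
Hypothesis pS : forall j, p j.+1 * j.+1%:R = lam * p j.
(** This and the next hypothesis say without limits that the weights have sum 1, so that the
    argument runs in any ordered field. *)
Hypothesis p_sum_le1 : forall N, \sum_(i < N) p i <= 1.
Hypothesis p_sum_sup : forall B : R, (forall N, \sum_(i < N) p i <= B) -> 1 <= B.

Let s0 : 0 < s. Proof. exact: lt_le_trans s1. Qed.
Let p_ge0 j : 0 <= p j. Proof. exact: ltW. Qed.

(** The maximum counts the steps made within distance about [s] of the mean, each of which adds 1 to
    the bound; for [j <= lam] it is at most [s + 1]. *)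
Lemma lower_tail j : j%:R <= lam ->
  \sum_(i < j.+1) p i <= (s + 1 + Num.max 0 (j%:R - lam + s + 1)) * p j.
Proof.
elim: j => [|j IH] jl.
  rewrite big_ord_recl big_ord0 addr0 ler_peMl //.
  have : 0 <= Num.max 0 (0%:R - lam + s + 1) by rewrite le_max lexx.
  by move: (Num.max _ _) => x; have := s1; lra.
have jl' : j%:R <= lam by apply: le_trans jl; rewrite ler_nat.
have {IH jl'} := IH jl'; rewrite [\sum_(i < j.+2) p i]big_ord_recr /=.
have ab : p j.+1 * (j%:R + 1) = lam * p j by rewrite natr1 pS.
rewrite -natr1 in jl *; move: (j%:R) jl ab (\sum_(i < j.+1) p i) => x xl ab S SB.
case: (lerP (x + 1) (lam - s)) => xs.
  have m1 : Num.max 0 (x - lam + s + 1) = 0 by apply/max_idPl; lra.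
  have m2 : 0 <= Num.max 0 (x + 1 - lam + s + 1) by rewrite le_max lexx.
  rewrite m1 addr0 in SB; apply: le_trans (lower_step_far s1 (p_gt0 _) ab xs SB) _.
  by rewrite ler_wpM2r // lerDl.
have m1 : Num.max 0 (x - lam + s + 1) = x - lam + s + 1 by apply/max_idPr; lra.
have m2 : Num.max 0 (x + 1 - lam + s + 1) = x + 1 - lam + s + 1 by apply/max_idPr; lra.
rewrite m1 in SB; rewrite m2.
have -> : s + 1 + (x + 1 - lam + s + 1) = s + 1 + (x - lam + s + 1) + 1 by lra.
by apply: (lower_step_near s1 (p_gt0 _) ab xl _ SB); have := s1; lra.
Qed.

(** Mirror image of [lower_tail]. A finite stretch of the tail is built up from its far end, so the
    induction is on its length with [j] varying. *)
Lemma upper_tail m j : lam <= j%:R ->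
  \sum_(i < m) p (j + i.+1) <= (s + 1 + Num.max 0 (lam + s - j%:R)) * p j.
Proof.
elim: m j => [|m IH] j lj.
  rewrite big_ord0 mulr_ge0 //.
  have : 0 <= Num.max 0 (lam + s - j%:R) by rewrite le_max lexx.
  by move: (Num.max _ _) => x; have := s1; lra.
rewrite big_ord_recl /=.
have -> : \sum_(i < m) p (j + (bump 0 i).+1) = \sum_(i < m) p (j.+1 + i.+1).
  by apply: eq_bigr => i _; rewrite /bump leq0n add1n addnS addSn.
have lj1 : lam <= j.+1%:R by apply: le_trans lj _; rewrite ler_nat.
have {IH} := IH _ lj1; rewrite addn1.
have ab : p j.+1 * (j%:R + 1) = lam * p j by rewrite natr1 pS.
rewrite -natr1 in lj1 *; move: (j%:R) lj lj1 ab (\sum_(i < m) _) => x xl x1 ab S SB.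
have l0 : 0 < lam by rewrite exprn_gt0.
have x0 : 0 < x + 1 by apply: lt_le_trans x1.
apply: (upper_step (p_gt0 j) (p_gt0 j.+1) x0 ab _ SB).
have B'0 : 0 <= Num.max 0 (lam + s - x) by rewrite le_max lexx.
case: (lerP (lam + s) (x + 1)) => xs.
  have -> : Num.max 0 (lam + s - (x + 1)) = 0 by apply/max_idPl; lra.
  rewrite addr0; apply: le_trans (upper_step_far s1 xs) _.
  by rewrite ler_wpM2r ?(ltW x0) // lerDl.
have -> : Num.max 0 (lam + s - (x + 1)) = lam + s - (x + 1) by apply/max_idPr; lra.
have -> : Num.max 0 (lam + s - x) = lam + s - x by apply/max_idPr; lra.
have -> : 1 + (s + 1 + (lam + s - (x + 1))) = s + 1 + (lam + s - x) by lra.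
by rewrite ler_wpM2l //; have := s1; lra.
Qed.

Lemma tail_min j : Num.min (\sum_(i < j.+1) p i) (1 - \sum_(i < j.+1) p i) <= (2 * s + 2) * p j.
Proof.
case: (lerP j%:R lam) => jl.
  rewrite ge_min; apply/orP; left; apply: le_trans (lower_tail jl) _.
  have : Num.max 0 (j%:R - lam + s + 1) <= s + 1.
    by rewrite ge_max; apply/andP; split; have := s1; lra.
  by move: (Num.max _ _) => x xs; rewrite ler_wpM2r //; lra.
rewrite ge_min; apply/orP; right; rewrite lerBlDr.
apply: p_sum_sup => N; set B := (2 * s + 2) * p j.
have le_sum m : \sum_(i < m) p (j + i.+1) <= B.
  apply: le_trans (upper_tail m (ltW jl)) _.
  have : Num.max 0 (lam + s - j%:R) <= s.
    by rewrite ge_max; apply/andP; split; have := s1; lra.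
  by move: (Num.max _ _) => x xs; rewrite /B ler_wpM2r //; have := s1; lra.
have mono M : \sum_(i < N) p i <= \sum_(i < N + M) p i.
  by rewrite big_split_ord /= lerDl; apply: sumr_ge0 => i _.
apply: le_trans (mono j.+1) _; rewrite addnC big_split_ord /= addrC lerD2r.
have -> : \sum_(i < N) p (j.+1 + i) = \sum_(i < N) p (j + i.+1).
  by apply: eq_bigr => i _; rewrite addSnnS.
exact: le_sum.
Qed.

Variables (h : nat -> R) (M : nat).
Hypothesis h01 : forall j, 0 <= h j <= 1.
Hypothesis hM : forall j, (M <= j)%N -> h j = 0.

Definition pmean := \sum_(i < M) p i * h i.

(** The solution of the Stein-Chen equation [lam g (j + 1) - j g j = h j - pmean], whose left side
    telescopes after multiplication by [p j]. *)
Definition stein_sol j :=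
  if j is i.+1 then (\sum_(l < i.+1) p l * (h l - pmean)) / (lam * p i) else 0.

Lemma stein_solE j : lam * stein_sol j.+1 - j%:R * stein_sol j = h j - pmean.
Proof.
have sn : s != 0 by rewrite gt_eqF.
have pn i : p i != 0 by rewrite gt_eqF.
rewrite /stein_sol big_ord_recr /=; case: j => [|j].
  rewrite big_ord0 mul0r subr0 add0r; field; by rewrite pn sn.
have j1 : (j.+1%:R : R) != 0 by rewrite pnatr_eq0.
rewrite -(pS j); move: (\sum_(l < j.+1) _) => S; field.
by rewrite !pn sn andbT addrC natr1 j1.
Qed.

Lemma pmean_tail j :
  \sum_(l < j) p l * (h l - pmean) =
  (\sum_(l < j) p l * h l) * (1 - \sum_(l < j) p l) -
  (\sum_(l < j) p l) * (pmean - \sum_(l < j) p l * h l).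
Proof.
under eq_bigr do rewrite mulrBr.
rewrite sumrB -big_distrl /=; ring.
Qed.

(** With [F] the mass of the weights up to [j], [pmean_tail] writes the numerator as a difference of
    two terms between 0 and [F (1 - F)]. Its absolute value is thus at most the minimum of [F] and
    [1 - F], hence at most [(2 s + 2) p j <= 4 s p j]. *)
Lemma stein_sol_bound j : `|stein_sol j| <= 4 / s.
Proof.
case: j => [|j] /=; first by rewrite normr0 divr_ge0 // ltW.
rewrite normrM normfV [`|lam * p j|]gtr0_norm ?mulr_gt0 ?exprn_gt0 //.
rewrite ler_pdivrMr ?mulr_gt0 ?exprn_gt0 //.
set S := \sum_(l < j.+1) _.
suff hS : `|S| <= Num.min (\sum_(i < j.+1) p i) (1 - \sum_(i < j.+1) p i).
  apply: le_trans hS (le_trans (tail_min j) _).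
  have -> : 4 / s * (lam * p j) = 4 * s * p j by field; rewrite gt_eqF.
  by rewrite ler_wpM2r //; have := s1; lra.
rewrite /S pmean_tail.
set A := \sum_(l < j.+1) p l * h l; set F := \sum_(l < j.+1) p l.
have F1 : F <= 1 by apply: p_sum_le1.
have A0 : 0 <= A by apply: sumr_ge0 => i _; rewrite mulr_ge0 //; case/andP: (h01 i).
have AF : A <= F.
  by apply: ler_sum => i _; rewrite ler_piMr //; case/andP: (h01 i).
have meanE N : pmean <= \sum_(i < N + M) p i * h i.
  rewrite addnC big_split_ord /= lerDl; apply: sumr_ge0 => i _.
  by rewrite mulr_ge0 //; case/andP: (h01 (M + i)).
have meanE' N : \sum_(i < N) p i * h i <= pmean.
  have : \sum_(i < N) p i * h i <= \sum_(i < M + N) p i * h i.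
    rewrite addnC big_split_ord /= lerDl; apply: sumr_ge0 => i _.
    by rewrite mulr_ge0 //; case/andP: (h01 (N + i)).
  move/le_trans; apply; rewrite big_split_ord /= [X in _ + X]big1 ?addr0 // => i _.
  by rewrite hM ?mulr0 // leq_addr.
have B0 : 0 <= pmean - A by rewrite subr_ge0; apply: meanE'.
have BF : pmean - A <= 1 - F.
  have := meanE j.+1; rewrite big_split_ord /= -/A => h1.
  have := p_sum_le1 (j.+1 + M); rewrite big_split_ord /= -/F => h2.
  have : \sum_(i < M) p (j.+1 + i) * h (j.+1 + i) <= \sum_(i < M) p (j.+1 + i).
    by apply: ler_sum => i _; rewrite ler_piMr //; case/andP: (h01 (j.+1 + i)).
  by lra.
have F0 : 0 <= F by apply: le_trans AF.
rewrite le_min; move: (pmean - A) B0 BF => B B0 BF.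
have t1 : A * (1 - F) <= F * (1 - F) by rewrite ler_wpM2r ?subr_ge0.
have t2 : F * B <= F * (1 - F) by rewrite ler_wpM2l.
have t3 : 0 <= A * (1 - F) by rewrite mulr_ge0 ?subr_ge0.
have t4 : 0 <= F * B by rewrite mulr_ge0.
have t5 : F * (1 - F) <= F by rewrite ler_piMr //; lra.
have t6 : F * (1 - F) <= 1 - F by rewrite ler_piMl // subr_ge0.
by apply/andP; split; rewrite ler_norml; apply/andP; split; lra.
Qed.

End SteinPoisson.

Lemma eq_stein_sol (R : realFieldType) (s : R) p h h' M : h =1 h' ->
  stein_sol s p h M =1 stein_sol s p h' M.
Proof.
move=> hh' [|j] //=; congr (_ / _).
have e : pmean p h M = pmean p h' M by apply: eq_bigr => i _; rewrite hh'.
by apply: eq_bigr => i _; rewrite hh' e.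
Qed.

(** * Stein bound for vectors *)

Section SteinVector.
Variables (R : realFieldType) (m : nat).
Local Notation vec := {ffun 'I_m -> nat}.
Implicit Types (w : vec) (k : 'I_m) (K : seq 'I_m).

Definition upd w k j : vec := [ffun i => if i == k then j else w i].
Definition bump_at w k : vec := [ffun i => (w i + (i == k))%N].

Lemma upd_id w k : upd w k (w k) = w.
Proof. by apply/ffunP => i; rewrite ffunE; case: eqP => // ->. Qed.

Lemma upd_bump w k j : upd (bump_at w k) k j = upd w k j.
Proof. by apply/ffunP => i; rewrite !ffunE; case: eqP => // _; rewrite addn0. Qed.

Lemma bump_atE w k : bump_at w k k = (w k).+1.
Proof. by rewrite ffunE eqxx addn1. Qed.

Variables (s : 'I_m -> R) (p : 'I_m -> nat -> R) (K0 : pred 'I_m).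
Hypothesis s1 : forall k, K0 k -> 1 <= s k.
Hypothesis p_gt0 : forall k j, K0 k -> 0 < p k j.
Hypothesis pS : forall k j, K0 k -> p k j.+1 * j.+1%:R = s k ^+ 2 * p k j.
Hypothesis p_sum_le1 : forall k N, K0 k -> \sum_(i < N) p k i <= 1.
Hypothesis p_sum_sup : forall k (B : R), K0 k -> (forall N, \sum_(i < N) p k i <= B) -> 1 <= B.

Variables (A : seq vec) (M : nat).
Hypothesis uA : uniq A.
Hypothesis AM : forall w i, w \in A -> (w i < M)%N.

Definition agree K w w' := [forall i, (i \in K) || (w i == w' i)].

(* The test function in which the coordinates of [K] have been integrated out
   against their Poisson laws. *)
Definition htest K w : R := \sum_(w' <- A | agree K w w') \prod_(k <- K) p k (w' k).

Lemma htest_nil w : htest [::] w = (w \in A)%:R.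
Proof.
rewrite /htest; under eq_bigr do rewrite big_nil.
rewrite (eq_bigl (pred1 w)); last first.
  move=> w'; apply/forallP/eqP => [h|-> i]; last by rewrite eqxx orbT.
  by apply/ffunP => i; have := h i; rewrite in_nil => /eqP.
by rewrite big_const_seq iter_addr_0 count_uniq_mem // -(mulr_natr 1) mul1r.
Qed.

Lemma htest_cons k K w : k \notin K ->
  htest (k :: K) w = \sum_(j < M) p k j * htest K (upd w k j).
Proof.
move=> kK; under [RHS]eq_bigr do rewrite /htest big_distrr /= big_mkcond /=.
rewrite exchange_big /= /htest big_mkcond /= [LHS]big_seq [RHS]big_seq.
apply: eq_bigr => w' w'A.
have agE j : agree K (upd w k j) w' = agree (k :: K) w w' && (j == w' k).
  apply/forallP/andP => [h|[/forallP h /eqP jw] i].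
    split; last by have := h k; rewrite (negPf kK) ffunE eqxx.
    by apply/forallP => i; have := h i; rewrite inE ffunE; case: (i == k).
  by have := h i; rewrite inE ffunE; case: eqP => [->|_] //=; rewrite jw eqxx orbT.
rewrite [RHS](eq_bigr (fun i : 'I_M => if agree (k :: K) w w' && (i == w' k :> nat)
  then p k i * \prod_(k0 <- K) p k0 (w' k0) else 0)); last by move=> i _; rewrite agE.
case: (agree (k :: K) w w') => /=; last by rewrite big1.
rewrite [RHS](bigD1 (Ordinal (AM k w'A))) //= eqxx [X in _ + X]big1 ?addr0 ?big_cons // => j jne.
case: eqP => // je; case/eqP: jne; exact: val_inj.
Qed.

Lemma htest01 K w : uniq K -> all K0 K -> 0 <= htest K w <= 1.
Proof.
elim: K w => [|k K IH] w /=; first by rewrite htest_nil; case: (_ \in _); rewrite ?ler01 lexx.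
case/andP=> kK uK /andP[kK0 aK]; rewrite htest_cons //; apply/andP; split.
  apply: sumr_ge0 => j _; apply: mulr_ge0; first by apply/ltW/p_gt0.
  by case/andP: (IH (upd w k j) uK aK).
apply: le_trans (p_sum_le1 M kK0); apply: ler_sum => j _.
by rewrite ler_piMr ?(ltW (p_gt0 _ kK0)) //; case/andP: (IH (upd w k j) uK aK).
Qed.

(** The Stein solution in coordinate [k], with the coordinates of [K] integrated out and the others
    frozen at those of [w]; raising coordinate [k] of [w] does not change the equation. *)
Definition gsol k K w := stein_sol (s k) (p k) (fun j => htest K (upd w k j)) M (w k).

Lemma gsolE k K w : K0 k -> k \notin K -> uniq K -> all K0 K ->
  s k ^+ 2 * gsol k K (bump_at w k) - (w k)%:R * gsol k K w = htest K w - htest (k :: K) w.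
Proof.
move=> kK0 kK uK aK; rewrite /gsol bump_atE.
have -> : stein_sol (s k) (p k) (fun j => htest K (upd (bump_at w k) k j)) M (w k).+1 =
   stein_sol (s k) (p k) (fun j => htest K (upd w k j)) M (w k).+1.
  by apply: eq_stein_sol => j; rewrite upd_bump.
rewrite stein_solE //.
- by rewrite upd_id htest_cons.
- exact: s1.
- by move=> j; apply: p_gt0.
- by move=> j; apply: pS.
Qed.

Lemma gsol_bound k K w : K0 k -> k \notin K -> uniq K -> all K0 K -> `|gsol k K w| <= 4 / s k.
Proof.
move=> kK0 kK uK aK; apply: stein_sol_bound => //.
- exact: s1.
- by move=> j; apply: p_gt0.
- by move=> j; apply: pS.
- by move=> N; apply: p_sum_le1.
- by move=> B; apply: p_sum_sup.
- by move=> j; apply: htest01.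
- move=> j Mj; rewrite /htest big_seq_cond big1 // => w' /andP[w'A /forallP/(_ k)].
  rewrite (negPf kK) ffunE eqxx /= => /eqP jE.
  by have := AM k w'A; rewrite -jE ltnNge Mj.
Qed.

Variables (T : finType) (G : {set T}) (W : T -> vec).
(** [a k x] and [b k x] stand for the numbers of moves from [x] that raise or lower coordinate [k],
    and [c k] for the ideal number of lowering moves per unit of it; [balance] says that the moves
    are paired. *)
Variables (c : 'I_m -> R) (a b : 'I_m -> T -> R) (err : 'I_m -> R).
Hypothesis c_gt0 : forall k, K0 k -> 0 < c k.
Hypothesis a_le : forall k x, K0 k -> x \in G -> a k x <= c k * s k ^+ 2.
Hypothesis b_le : forall k x, K0 k -> x \in G -> b k x <= c k * (W x k)%:R.
Hypothesis balance : forall k (g : vec -> R), K0 k ->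
  \sum_(x in G) b k x * g (W x) = \sum_(x in G) a k x * g (bump_at (W x) k).
Hypothesis err_le : forall k, K0 k ->
  \sum_(x in G) (c k * s k ^+ 2 - a k x) + \sum_(x in G) (c k * (W x k)%:R - b k x) <= err k.

(** After multiplication by [c k], [balance] cancels the main terms of the Stein equation. What
    remains are the two deficits, nonnegative at every [x], times values of the bounded solution. *)
Lemma htest_step k K : K0 k -> k \notin K -> uniq K -> all K0 K ->
  \sum_(x in G) htest K (W x) - \sum_(x in G) htest (k :: K) (W x) <= 4 / s k * err k / c k.
Proof.
move=> kK0 kK uK aK; have ck := c_gt0 kK0.
rewrite ler_pdivlMr // -sumrB.
under eq_bigr => x _ do rewrite -gsolE //.
set g := gsol k K; set l := s k ^+ 2.
have sk : 0 < s k by apply: lt_le_trans (s1 kK0).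
have -> : (\sum_(x in G) (l * g (bump_at (W x) k) - (W x k)%:R * g (W x))) * c k =
    \sum_(x in G) (c k * l - a k x) * g (bump_at (W x) k) -
    \sum_(x in G) (c k * (W x k)%:R - b k x) * g (W x).
  have e1 : \sum_(x in G) (c k * l - a k x) * g (bump_at (W x) k) =
      \sum_(x in G) c k * l * g (bump_at (W x) k) - \sum_(x in G) a k x * g (bump_at (W x) k).
    by rewrite -sumrB; apply: eq_bigr => x _; rewrite mulrBl.
  have e2 : \sum_(x in G) (c k * (W x k)%:R - b k x) * g (W x) =
      \sum_(x in G) c k * (W x k)%:R * g (W x) - \sum_(x in G) b k x * g (W x).
    by rewrite -sumrB; apply: eq_bigr => x _; rewrite mulrBl.
  rewrite e1 e2 balance // big_distrl /=.
  have -> : \sum_(x in G) (l * g (bump_at (W x) k) - (W x k)%:R * g (W x)) * c k =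
     \sum_(x in G) c k * l * g (bump_at (W x) k) - \sum_(x in G) c k * (W x k)%:R * g (W x).
    by rewrite -sumrB; apply: eq_bigr => x _; ring.
  by ring.
have gb w := gsol_bound w kK0 kK uK aK; rewrite -/g in gb.
apply: le_trans (_ : _ <= 4 / s k * (\sum_(x in G) (c k * l - a k x) + \sum_(x in G) (c k * (W x k)%:R - b k x))) _.
  rewrite mulrDr; apply: lerD.
    rewrite big_distrr /=; apply: ler_sum => x xG; rewrite [X in _ <= X]mulrC.
    apply: ler_wpM2l; first by rewrite subr_ge0 a_le.
    exact: le_trans (ler_norm _) (gb _).
  rewrite -sumrN big_distrr /=; apply: ler_sum => x xG; rewrite [X in _ <= X]mulrC -mulrN.
  apply: ler_wpM2l; first by rewrite subr_ge0 b_le.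
  by apply: le_trans (ler_norm _) _; rewrite normrN.
apply: ler_wpM2l; first by rewrite divr_ge0 // ltW.
exact: err_le.
Qed.

Lemma stein_vector K : uniq K -> all K0 K ->
  \sum_(x in G) (W x \in A)%:R - \sum_(x in G) htest K (W x) <=
  \sum_(k <- K) 4 / s k * err k / c k.
Proof.
elim: K => [|k K IH] /=.
  rewrite big_nil; under [X in _ - X <= _]eq_bigr => x _ do rewrite htest_nil.
  by rewrite subrr.
case/andP=> kK uK /andP[kK0 aK]; rewrite big_cons.
have := IH uK aK; have := htest_step kK0 kK uK aK.
by lra.
Qed.

Lemma htest_agree K w : {in A, forall w', agree K w w'} ->
  htest K w = \sum_(w' <- A) \prod_(k <- K) p k (w' k).
Proof.
move=> ag; rewrite /htest big_mkcond /= [LHS]big_seq [RHS]big_seq.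
by apply: eq_bigr => w' w'A; rewrite ag.
Qed.

End SteinVector.

From mathcomp Require Import finmap.
From mathcomp Require Import all_classical all_reals all_analysis.

(** * Poisson weights *)

Section PoissonWeights.
Variables (R : realType) (lam : R).
Hypothesis lam0 : 0 < lam.

Definition pweight j : R := lam ^+ j * j`!%:R^-1 * expR (- lam).

Lemma pweight_gt0 j : 0 < pweight j.
Proof. by rewrite !mulr_gt0 ?exprn_gt0 ?invr_gt0 ?ltr0n ?fact_gt0 ?expR_gt0. Qed.

Lemma pweightS j : pweight j.+1 * j.+1%:R = lam * pweight j.
Proof.
rewrite /pweight factS natrM exprS.
have f0 : (j`!%:R : R) != 0 by rewrite pnatr_eq0 -lt0n fact_gt0.
have j0 : (j.+1%:R : R) != 0 by rewrite pnatr_eq0.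
by field; rewrite f0 addrC natr1 j0.
Qed.

Lemma sum_pweight N : \sum_(i < N) pweight i = series (exp_coeff lam) N * expR (- lam).
Proof. by rewrite /series /= big_mkord big_distrl. Qed.

Lemma sum_pweight_le1 N : \sum_(i < N) pweight i <= 1.
Proof.
rewrite sum_pweight expRN ler_pdivrMr ?expR_gt0 // mul1r.
apply: (nondecreasing_cvgn_le _ (is_cvg_series_exp_coeff lam)).
by apply: nondecreasing_series => i _ _; rewrite exp_coeff_ge0 // ltW.
Qed.

Lemma sum_pweight_sup (B : R) : (forall N, \sum_(i < N) pweight i <= B) -> 1 <= B.
Proof.
move=> hB; have : expR lam <= B * expR lam.
  apply: limr_le; first exact: is_cvg_series_exp_coeff.
  near=> N; have := hB N; rewrite sum_pweight expRN ler_pdivrMr ?expR_gt0 //.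
by rewrite -{1}[expR lam]mul1r ler_pM2r ?expR_gt0.
Unshelve. all: by end_near. Qed.

End PoissonWeights.

(** * Cycle counts of random regular graphs *)

Section CycleCounts.
Variables (R : realType) (n d r : nat) (x0 : 'I_n).
Hypothesis d3 : (3 <= d)%N.
Hypothesis r3 : (3 <= r)%N.
Hypothesis big : (2 * (2 * (2 * r + 4) + 4 * d + 2 * (d * d)) <= n * d)%N.
Hypothesis nd0 : (0 < n * d)%N.
Local Notation q := (d - 1)%N.
Local Notation G := (graphs n d).
Local Notation vec := {ffun 'I_r.+1 -> nat}.

Definition cycvec (E : {set {set 'I_n}}) : vec := [ffun i : 'I_r.+1 => cycle_count E i].

Definition cycle_rate (k : nat) : R := q%:R ^+ k / (2 * k%:R).
Definition sqrt_rate (k : nat) : R := Num.sqrt (cycle_rate k).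

Lemma q2 : (2 <= q)%N. Proof. by clear -d3; lia. Qed.

Lemma pow2_ge_dbl k : (2 < k)%N -> (2 * k <= 2 ^ k)%N.
Proof.
elim: k => // k IH; case: (ltnP 2 k) => k2 _; last first.
  by case: k k2 IH => [|[|[|k]]].
by rewrite expnS; have := IH k2; move: (2 ^ k)%N => A; clear -k2; lia.
Qed.

(** The one-dimensional Stein bound is proved for means at least 1; here this follows from
    [2 * k <= 2 ^ k]. *)
Lemma cycle_rate_ge1 k : (2 < k)%N -> 1 <= cycle_rate k.
Proof.
move=> k2; have k0 : (0 < k)%N by apply: ltnW (ltnW _).
rewrite /cycle_rate ler_pdivlMr ?mulr_gt0 ?ltr0n // mul1r -natrM -natrX ler_nat.
by apply: leq_trans (pow2_ge_dbl k2) _; rewrite leq_exp2r ?q2.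
Qed.

Lemma cycle_rate_gt0 k : (2 < k)%N -> 0 < cycle_rate k.
Proof. by move=> k2; apply: lt_le_trans (cycle_rate_ge1 k2). Qed.

Lemma sqrt_rate_sqr k : (2 < k)%N -> sqrt_rate k ^+ 2 = cycle_rate k.
Proof. by move=> k2; rewrite sqr_sqrtr // ltW // cycle_rate_gt0. Qed.

Lemma sqrt_rate_ge1 k : (2 < k)%N -> 1 <= sqrt_rate k.
Proof. by move=> k2; rewrite -[X in X <= _]sqrtr1 ler_sqrt ?cycle_rate_ge1 // ltW // cycle_rate_gt0. Qed.

Lemma cycle_countE k E : E \in G -> (2 < k)%N -> (#|rooted k E| = 2 * k * cycle_count E k)%N.
Proof. by move=> EG k2; rewrite -card_rooted_cycles. Qed.

Lemma cycvec_close k E (u : k.+2.-tuple 'I_n) (kr : (k < r.+1)%N) :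
  u \in good_paths x0 r k E -> cycvec (close_path x0 k E u) = bump_at (cycvec E) (Ordinal kr).
Proof.
rewrite inE => /andP[_ /forallP gd]; apply/ffunP => j; rewrite !ffunE.
by have /eqP -> := gd j; congr (_ + _)%N; rewrite -val_eqE.
Qed.

(** Absorbs the [k ^ 2] of the path count into the detour error: one factor [k] is paid for by
    [q ^ r]. *)
Lemma k_le_pow k : (k <= q ^ r)%N -> (2 * k ^ 2 * q ^ k.+1 + 16 * k.+2 * q ^ (k.+1 + r) <=
  (2 * k + 16 * k.+2) * q ^ (k.+1 + r))%N.
Proof.
move=> kq; rewrite mulnDl leq_add2r expnD -mulnn mulnA -!mulnA leq_mul2l /=.
by rewrite leq_mul2l; apply/orP; right; rewrite mulnC leq_mul2l kq orbT.
Qed.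

Definition long_idx : seq 'I_r.+1 := [seq k : 'I_r.+1 <- enum 'I_r.+1 | (2 < k)%N].

(** Instance of [stein_vector] in which good closings raise and good openings lower a coordinate. A
    [k]-cycle has [2 k] rootings and [n d] arcs to be opened against, which gives [c k]; the error
    constant is [78 = 34 + 44]. *)
Lemma sum_cycvec (A : seq vec) : uniq A ->
  (forall w (i : 'I_r.+1), w \in A -> (i <= 2)%N -> w i = 0%N) ->
  \sum_(E in G) (cycvec E \in A)%:R -
  #|G|%:R * (\sum_(w <- A) \prod_(k <- long_idx) pweight (cycle_rate k) (w k))
  <= \sum_(k <- long_idx)
     4 / sqrt_rate k * (78 * k%:R * d%:R * q%:R ^+ (k + r) * #|G|%:R) / (2 * k%:R * n%:R * d%:R) :> R.
Proof.
move=> uA A0; pose K := long_idx.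
pose M := (\sum_(w <- A) \sum_(i < r.+1) w i).+1.
have AM (w : vec) (i : 'I_r.+1) : w \in A -> (w i < M)%N.
  move=> wA; rewrite ltnS (big_rem w) //= (bigD1 i) //= -addnA; exact: leq_addr.
have K0 (k : 'I_r.+1) : k \in K -> (2 < k)%N by rewrite mem_filter => /andP[].
pose P0 := [pred k : 'I_r.+1 | (2 < k)%N].
pose c (k : 'I_r.+1) : R := 2 * k%:R * n%:R * d%:R.
have := @stein_vector R r.+1 (fun k => sqrt_rate k) (fun k => pweight (cycle_rate k)) P0
  _ _ _ _ _ A M uA AM _ G cycvec c (fun k E => #|good_paths x0 r k E|%:R)
  (fun k E => #|good_cycles x0 r k E|%:R)
  (fun k => 78 * k%:R * d%:R * q%:R ^+ (k + r) * #|G|%:R) _ _ _ _ _ K.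
have uK : uniq K by rewrite filter_uniq // enum_uniq.
have aK : all P0 K by rewrite filter_all.
move=> h; have {}h := h _ _ _ _ _ _ _ _ _ _ uK aK.
have agr : forall E, E \in G -> {in A, forall w', agree K (cycvec E) w'}.
  move=> E EG w' w'A; apply/forallP => i; rewrite mem_filter mem_enum andbT.
  case: (ltnP 2 i) => //= i2; rewrite (A0 _ _ w'A i2) ffunE; apply/eqP.
  apply/eqP; rewrite cards_eq0; apply/eqP/setP => al; rewrite !inE /is_cyc.
  by rewrite ltnNge i2.
have e1 : \sum_(E in G) htest (fun k => pweight (cycle_rate k)) A K (cycvec E) =
   #|G|%:R * (\sum_(w <- A) \prod_(k <- K) pweight (cycle_rate k) (w k)).
  rewrite mulr_natl -sumr_const; apply: eq_bigr => E EG.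
  by rewrite htest_agree //; apply: agr.
rewrite e1 in h; apply: h.
- by move=> k; apply: sqrt_rate_ge1.
- by move=> k j k2; apply: pweight_gt0; apply: cycle_rate_gt0.
- by move=> k j k2; rewrite sqrt_rate_sqr //; apply: pweightS; apply: cycle_rate_gt0.
- by move=> k N k2; apply: sum_pweight_le1; apply: cycle_rate_gt0.
- by move=> k B k2; apply: sum_pweight_sup; apply: cycle_rate_gt0.
- move=> k k2; rewrite /c -!mulrA -natrM !mulr_gt0 // ?ltr0n //; exact: ltnW (ltnW k2).
- move=> k E k2 EG; rewrite sqrt_rate_sqr // /c /cycle_rate.
  have k0 : k%:R != 0 :> R by rewrite pnatr_eq0 -lt0n; apply: ltnW (ltnW k2).
  have -> : 2 * k%:R * n%:R * d%:R * (q%:R ^+ k / (2 * k%:R)) = (n * d * q ^ k)%:R :> R.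
    by rewrite !natrM natrX; field.
  by rewrite ler_nat; apply: card_good_paths_le.
- move=> k E k2 EG; rewrite /c ffunE -!natrM ler_nat.
  have := card_good_cycles_le x0 r EG k2; rewrite cycle_countE //.
  by move/leq_trans; apply; apply/eq_leq; move: (cycle_count E k) => C; lia.
- move=> k g k2.
  have kE : Ordinal (ltn_ord k) = k by apply: val_inj.
  have sw_id := @switching_identity n d x0 r R 0 +%R k (fun E => g (cycvec E)) k2.
  rewrite (eq_bigr (fun E => \sum_(u in good_cycles x0 r k E) g (cycvec E))); last first.
    by move=> E _; rewrite sumr_const mulr_natl.
  rewrite sw_id; apply: eq_bigr => E EG.
  rewrite (eq_bigr (fun=> g (bump_at (cycvec E) k))); last first.
    by move=> u ug; rewrite (cycvec_close (ltn_ord k) ug) kE.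
  by rewrite sumr_const mulr_natl.
- move=> k k2; have k0 : (0 < k)%N by apply: ltnW (ltnW k2).
  have kr : (k <= r)%N by rewrite -ltnS.
  have kkr : (2 < k <= r)%N by rewrite kr andbT; exact: k2.
  have kn0 : k%:R != 0 :> R by rewrite pnatr_eq0 -lt0n.
  have t1 : \sum_(E in G) (c k * sqrt_rate k ^+ 2 - #|good_paths x0 r k E|%:R) <=
     34 * k%:R * d%:R * q%:R ^+ (k + r) * #|G|%:R.
    rewrite sumrB sumr_const sqrt_rate_sqr // /c /cycle_rate.
    have -> : 2 * k%:R * n%:R * d%:R * (q%:R ^+ k / (2 * k%:R)) = (n * d * q ^ k)%:R :> R.
      by rewrite !natrM natrX; field.
    have -> : 34 * k%:R * d%:R * q%:R ^+ (k + r) * #|G|%:R =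
        (34 * k * d * q ^ (k + r) * #|G|)%:R :> R by rewrite !natrM natrX.
    rewrite -natr_sum lerBlDr -mulrnA -natrD ler_nat [X in (X <= _)%N]mulnC.
    apply: leq_trans (sum_good_paths_ge x0 d3 big nd0 kkr) _.
    rewrite addnC leq_add2r leq_mul2r; apply/orP; right.
    have kq : (k <= q ^ r)%N.
      by apply: leq_trans kr _; apply: ltnW; apply: ltn_expl; apply: q2.
    apply: leq_trans (k_le_pow kq) _.
    rewrite addSn expnS mulnA leq_mul2r; apply/orP; right.
    have : (q <= d)%N by apply: leq_subr.
    have : (2 * k + 16 * k.+2 <= 34 * k)%N by move: k2; rewrite /=; clear; lia.
    by move=> h1 h2; apply: leq_mul.
  have t2 : \sum_(E in G) (c k * (cycvec E k)%:R - #|good_cycles x0 r k E|%:R) <=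
     44 * k%:R * d%:R * q%:R ^+ (k + r) * #|G|%:R.
    rewrite sumrB -natr_sum lerBlDr.
    rewrite (eq_bigr (fun E => (#|rooted k E| * (n * d))%:R)); last first.
      move=> E EG; rewrite cycle_countE // /c ffunE !natrM; ring.
    have -> : 44 * k%:R * d%:R * q%:R ^+ (k + r) * #|G|%:R =
        (44 * k * d * q ^ (k + r) * #|G|)%:R :> R by rewrite !natrM natrX.
    rewrite -natr_sum -natrD ler_nat addnC.
    exact: sum_good_cycles_ge.
  by apply: le_trans (lerD t1 t2) _; rewrite le_eqVlt; apply/orP; left; apply/eqP; ring.
Qed.

End CycleCounts.

(** * Total variation for counts of walks *)

(** The ratio [r ^ 6 / 2 ^ r] is largest at [r = 9], about 1038. From there on
    [(r + 1) / r <= 10 / 9], and [(10 / 9) ^ 6 < 2]. *)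
Lemma pow6_le r : (r ^ 6 <= 1100 * 2 ^ r)%N.
Proof.
case: (ltnP r 9) => [|r9].
  by do 9 (case: r => [_|r]; first by rewrite !expnS !expn0; lia).
elim: r r9 => // r IH; rewrite leq_eqVlt => /orP[/eqP <-|r9].
  by rewrite !expnS !expn0; lia.
have {}IH := IH r9.
have h : (r.+1 ^ 6 <= 2 * r ^ 6)%N.
  have : (9 * r.+1 <= 10 * r)%N by move: r9; clear; lia.
  rewrite -(@leq_exp2r _ _ 6) // !(expnMn _ _ 6); move: (r.+1 ^ 6)%N (r ^ 6)%N => a b.
  by rewrite !expnS !expn0; clear; lia.
by apply: leq_trans h _; rewrite (expnS 2) mulnCA leq_mul2l.
Qed.

Section RealBounds.
Variables (R : realType).

(** At ratio [4 / 3] the geometric sum costs [1 / (1 - 3 / 4) = 4]. The value [4 / 3] lies below the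
    square root of 2, the smallest ratio needed. *)
Lemma sum_powers_le (x : R) r : 4 / 3 <= x -> \sum_(k < r.+1) x ^+ k <= 4 * x ^+ r.
Proof.
move=> x43; have x0 : 0 < x by lra.
elim: r => [|r IH]; first by rewrite big_ord1 expr0; lra.
rewrite big_ord_recr /= exprS; have := exprn_gt0 r x0; move: IH.
by move: (\sum_(_ < _) _) (x ^+ r) => S y; nra.
Qed.

Lemma sqrt_ge43 (q : nat) : (2 <= q)%N -> 4 / 3 <= Num.sqrt (q%:R : R).
Proof.
move=> q2; have h : (2 : R) <= q%:R by rewrite ler_nat.
rewrite -[X in X <= _]ger0_norm; last by lra.
by rewrite -sqrtr_sqr ler_sqrt; nra.
Qed.

(** Makes the bad graphs no worse than the main error. After squaring it rests on [pow6_le] and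
    [4 * 1100 <= 67 ^ 2], where the 4 comes from [2 ^ r = 4 * 2 ^ (r - 2)]. *)
Lemma cube_le_sqrt_pow (q r : nat) : (2 <= q)%N -> (3 <= r)%N ->
  r%:R ^+ 3 * q%:R <= 67 * Num.sqrt (q%:R : R) ^+ r.
Proof.
move=> q2 r3; set x := Num.sqrt _.
have x2 : x ^+ 2 = q%:R by rewrite sqr_sqrtr ?ler0n.
have x0 : 0 <= x by apply: sqrtr_ge0.
rewrite -(@ler_pXn2r _ 2) ?nnegrE ?mulr_ge0 ?exprn_ge0 ?ler0n //.
have -> : (r%:R ^+ 3 * q%:R) ^+ 2 = (r ^ 6 * q ^ 2)%:R :> R by rewrite natrM !natrX; ring.
have -> : (67 * x ^+ r) ^+ 2 = 4489 * (x ^+ 2) ^+ r by rewrite -exprM mulnC exprM; ring.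
rewrite x2 -natrX -natrM ler_nat.
have -> : (q ^ r = q ^ (r - 2) * q ^ 2)%N by rewrite -expnD subnK // ltnW.
rewrite mulnA leq_mul2r; apply/orP; right.
apply: leq_trans (pow6_le r) _.
have -> : (2 ^ r = 2 ^ (r - 2) * 2 ^ 2)%N by rewrite -expnD subnK // ltnW.
have : (2 ^ (r - 2) <= q ^ (r - 2))%N.
  by rewrite leq_exp2r // subn_gt0.
by move: (2 ^ (r - 2))%N (q ^ (r - 2))%N => a b; clear; lia.
Qed.

End RealBounds.

(** * One-sided bound for the walk counts of uniform graphs *)

Section CNBWCountBound.
Variables (R : realType) (n d r : nat) (x0 : 'I_n).
Hypothesis d3 : (3 <= d)%N.
Hypothesis r3 : (3 <= r)%N.
Local Notation q := (d - 1)%N.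
Local Notation G := (graphs n d).
Local Notation vec := {ffun 'I_r.+1 -> nat}.
Local Notation rate := (cycle_rate R d).
Local Notation srate := (sqrt_rate R d).
Hypothesis nq : (2000 * q ^ r <= n)%N.

Let q2 : (2 <= q)%N. Proof. by clear -d3; lia. Qed.

Lemma large_n : (2 * (2 * (2 * r + 4) + 4 * d + 2 * (d * d)) <= n * d)%N.
Proof.
have rq : (r < q ^ r)%N by apply: ltn_expl.
have qq : (q <= q ^ r)%N by rewrite -{1}[q]expn1 leq_exp2l // ltnW // ltnW.
have dq : (d <= 2 * q ^ r)%N by clear -qq d3 q2; lia.
apply: leq_trans (_ : _ <= 2000 * q ^ r * d)%N _; last by rewrite leq_mul2r nq orbT.
move: (q ^ r)%N rq dq => Q rq dq; clear -rq dq d3; nia.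
Qed.

Lemma nd_gt0 : (0 < n * d)%N.
Proof.
rewrite muln_gt0 (leq_trans _ d3) // andbT; apply: leq_trans nq.
by rewrite muln_gt0 expn_gt0 (leq_trans _ q2).
Qed.

Definition cnbw_of_cycles (w : vec) : {ffun 'I_r -> nat} :=
  [ffun k : 'I_r => (\sum_(j <- divisors k.+1) 2 * j * w (inord j))%N].

Definition cnbw_vec (E : {set {set 'I_n}}) : {ffun 'I_r -> nat} :=
  [ffun k : 'I_r => #|[set w : k.+2.-tuple 'I_n | is_cnbw (adj E) w]|].

Lemma cnbw_vecE E : E \in G -> ~~ bad_graph x0 r E ->
  cnbw_vec E = cnbw_of_cycles (cycvec r E).
Proof.
move=> EG nb; apply/ffunP => k; rewrite !ffunE.
rewrite (card_cnbw (x0 := x0) (r := r) EG nb) ?ltn_ord //.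
rewrite [LHS]big_seq [RHS]big_seq; apply: eq_bigr => j; rewrite -dvdn_divisors // => jk.
by rewrite ffunE inordK // ltnS (leq_trans (dvdn_leq _ jk)).
Qed.

Local Notation x := (Num.sqrt (q%:R : R)).

(** Since [q ^ k = 2 k (srate k) ^ 2], the left side is [312 q ^ r k (srate k) / n] times the number
    of graphs, with [312 = 4 * 78]. The square of [k * srate k] is [k q ^ k / 2]: this is the source
    of the factor [sqrt r]. *)
Lemma cycle_err_le (k : nat) : (2 < k <= r)%N ->
  4 / srate k * (78 * k%:R * d%:R * q%:R ^+ (k + r) * #|G|%:R) / (2 * k%:R * n%:R * d%:R)
  <= 312 * Num.sqrt r%:R * q%:R ^+ r * #|G|%:R / n%:R * x ^+ k.
Proof.
case/andP=> k2 kr; have k0 : (0 < k)%N by apply: ltnW (ltnW _).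
have kn0 : k%:R != 0 :> R by rewrite pnatr_eq0 -lt0n.
have := nd_gt0; rewrite muln_gt0 => /andP[n0 d0].
have nn0 : n%:R != 0 :> R by rewrite pnatr_eq0 -lt0n.
have dn0 : d%:R != 0 :> R by rewrite pnatr_eq0 -lt0n.
have t0 : 0 < srate k by apply: lt_le_trans (sqrt_rate_ge1 R d3 k2).
have tn0 : srate k != 0 by rewrite gt_eqF.
have qk : q%:R ^+ k = 2 * k%:R * srate k ^+ 2.
  by rewrite sqrt_rate_sqr // /cycle_rate; field.
have x2 : x ^+ 2 = q%:R by rewrite sqr_sqrtr ?ler0n.
have key : k%:R * srate k <= Num.sqrt r%:R * x ^+ k.
  rewrite -(@ler_pXn2r _ 2) ?nnegrE ?mulr_ge0 ?exprn_ge0 ?ler0n ?sqrtr_ge0 ?(ltW t0) //.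
  have -> : (Num.sqrt r%:R * x ^+ k) ^+ 2 = Num.sqrt r%:R ^+ 2 * (x ^+ 2) ^+ k.
    by rewrite -exprM mulnC exprM; ring.
  rewrite sqr_sqrtr ?ler0n // x2 qk exprMn.
  have : (k%:R : R) <= r%:R by rewrite ler_nat.
  have : 0 < k%:R * srate k ^+ 2 by rewrite mulr_gt0 ?ltr0n ?exprn_gt0.
  move=> h1 h2; have : (k%:R + r%:R) * (k%:R * srate k ^+ 2) >= (k%:R + k%:R) * (k%:R * srate k ^+ 2).
    by rewrite ler_pM2r // lerD2l.
  by move: (ler0n R k) h1 h2; nra.
have -> : 4 / srate k * (78 * k%:R * d%:R * q%:R ^+ (k + r) * #|G|%:R) / (2 * k%:R * n%:R * d%:R)
   = 312 * q%:R ^+ r * #|G|%:R / n%:R * (k%:R * srate k).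
  by rewrite exprD qk; field; rewrite tn0 nn0 kn0 dn0.
have -> : 312 * Num.sqrt r%:R * q%:R ^+ r * #|G|%:R / n%:R * x ^+ k =
   312 * q%:R ^+ r * #|G|%:R / n%:R * (Num.sqrt r%:R * x ^+ k) by ring.
by apply: ler_wpM2l => //; rewrite !mulr_ge0 ?invr_ge0 ?exprn_ge0 ?ler0n.
Qed.

(** [A] consists of the finitely many cycle vectors of regular graphs whose walk counts, computed
    from the cycles, satisfy [B]. Other Poisson vectors may be dropped, as only an upper bound for
    graphs is claimed. The errors add up to [1248 + 268 <= 2000]. *)
Lemma cnbw_count_bound (B : pred {ffun 'I_r -> nat}) :
  exists A : seq vec,
  [/\ uniq A, (forall w, w \in A -> B (cnbw_of_cycles w)),
      (forall (w : vec) (i : 'I_r.+1), w \in A -> (i <= 2)%N -> w i = 0%N) &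
      \sum_(E in G) (B (cnbw_vec E))%:R <=
      #|G|%:R * (\sum_(w <- A) \prod_(k <- long_idx r) pweight (rate k) (w k)
        + 2000 * Num.sqrt r%:R * (q%:R ^+ r * x ^+ r) / n%:R)].
Proof.
pose A := undup [seq cycvec r E | E <- enum G & B (cnbw_of_cycles (cycvec r E))].
have A0 (w : vec) (i : 'I_r.+1) : w \in A -> (i <= 2)%N -> w i = 0%N.
  rewrite mem_undup => /mapP[E _ ->] i2; rewrite ffunE.
  by apply/eqP; rewrite cards_eq0; apply/eqP/setP => al; rewrite !inE /is_cyc ltnNge i2.
have uA : uniq A by apply: undup_uniq.
exists A; split => //.
  by move=> w; rewrite mem_undup => /mapP[E + ->]; rewrite mem_filter => /andP[].
have h1 := sum_cycvec R x0 d3 r3 large_n nd_gt0 uA A0.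
have := nd_gt0; rewrite muln_gt0 => /andP[n0 d0].
have n0R : 0 < n%:R :> R by rewrite ltr0n.
have d0R : 0 < d%:R :> R by rewrite ltr0n.
set N := #|G|%:R in h1 *; set s := Num.sqrt (r%:R : R).
have N0 : 0 <= N by rewrite ler0n.
have xr0 : 0 <= x ^+ r by rewrite exprn_ge0 ?sqrtr_ge0.
have qr0 : 0 <= q%:R ^+ r :> R by rewrite exprn_ge0 ?ler0n.
have s1 : 1 <= s by rewrite -[X in X <= _]sqrtr1 ler_sqrt ?ler1n ?ler0n // (leq_trans _ r3).
have h2 : \sum_(k <- long_idx r) 4 / srate k * (78 * k%:R * d%:R * q%:R ^+ (k + r) * N) / (2 * k%:R * n%:R * d%:R)
   <= 312 * s * q%:R ^+ r * N / n%:R * (4 * x ^+ r).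
  apply: le_trans (_ : _ <= 312 * s * q%:R ^+ r * N / n%:R * (\sum_(k < r.+1) x ^+ k)) _; last first.
    apply: ler_wpM2l; last by apply: sum_powers_le; apply: sqrt_ge43.
    by rewrite !mulr_ge0 ?invr_ge0 ?(ltW n0R) // (le_trans ler01 s1).
  rewrite big_filter big_enum_cond /= big_mkcond /= big_distrr /=; apply: ler_sum => k _.
  case: ifP => [k2|_]; first by apply: cycle_err_le; rewrite k2 -ltnS ltn_ord.
  by rewrite !mulr_ge0 ?invr_ge0 ?(ltW n0R) ?exprn_ge0 ?sqrtr_ge0 // (le_trans ler01 s1).
have h3 : \sum_(E in G) (bad_graph x0 r E)%:R <= 268 * (q%:R ^+ r * x ^+ r) * N / n%:R :> R.
  have := card_bad_graph x0 d3 nd_gt0 large_n.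
  rewrite -(ler_nat R) -sum1dep_card natrM [X in _ * X]natrM natr_sum.
  rewrite [X in X * _ <= _]big_mkcondr /= => hb.
  have e : \sum_(E in G) (bad_graph x0 r E)%:R = \sum_(E in G) (if bad_graph x0 r E then 1 else 0) :> R.
    by apply: eq_bigr => E _; case: (bad_graph _ _ _).
  have e2 : (4 * r ^ 3 * q ^ (r + 2) * #|G|)%:R = 4 * r%:R ^+ 3 * q%:R ^+ (r + 2) * N :> R.
    by rewrite !natrM natrX; ring.
  rewrite e2 in hb; rewrite ler_pdivlMr // -(ler_pM2r d0R) -[X in X <= _]mulrA e; apply: le_trans hb _.
  have qd : (q%:R : R) <= d%:R by rewrite ler_nat leq_subr.
  have hc := cube_le_sqrt_pow R q2 r3.
  have q0 : 0 <= q%:R :> R by rewrite ler0n.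
  rewrite exprD -/N.
  have c0 : 0 <= 4 * q%:R ^+ r * N by rewrite !mulr_ge0.
  have -> : 4 * r%:R ^+ 3 * (q%:R ^+ r * q%:R ^+ 2) * N = 4 * q%:R ^+ r * N * ((r%:R ^+ 3 * q%:R) * q%:R) by ring.
  have -> : 268 * (q%:R ^+ r * x ^+ r) * N * d%:R = 4 * q%:R ^+ r * N * ((67 * x ^+ r) * d%:R) by ring.
  by apply: ler_wpM2l => //; apply: ler_pM => //; rewrite mulr_ge0 // exprn_ge0 ?ler0n.
have h4 : \sum_(E in G) (B (cnbw_vec E))%:R <=
   \sum_(E in G) (cycvec r E \in A)%:R + \sum_(E in G) (bad_graph x0 r E)%:R :> R.
  rewrite -big_split /=; apply: ler_sum => E EG.
  case: (boolP (bad_graph x0 r E)) => [_|nb].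
    by case: (B _); case: (_ \in A) => /=; lra.
  rewrite cnbw_vecE // addr0 ler_nat; case: (boolP (B _)) => // Bw.
  have -> // : cycvec r E \in A.
  by rewrite mem_undup; apply/mapP; exists E => //; rewrite mem_filter Bw mem_enum.
have h5 : 268 * (q%:R ^+ r * x ^+ r) * N / n%:R <= 268 * s * (q%:R ^+ r * x ^+ r) * N / n%:R.
  rewrite ler_pM2r ?invr_gt0 //; apply: ler_wpM2r => //; apply: ler_wpM2r; first exact: mulr_ge0.
  by lra.
have h6 : 312 * s * q%:R ^+ r * N / n%:R * (4 * x ^+ r) + 268 * s * (q%:R ^+ r * x ^+ r) * N / n%:R
   <= N * (2000 * s * (q%:R ^+ r * x ^+ r) / n%:R).
  have : 0 <= s * (q%:R ^+ r * x ^+ r) * N / n%:R.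
    by rewrite !mulr_ge0 ?invr_ge0 ?(ltW n0R) // (le_trans ler01 s1).
  have -> : 312 * s * q%:R ^+ r * N / n%:R * (4 * x ^+ r) = 1248 * (s * (q%:R ^+ r * x ^+ r) * N / n%:R) by ring.
  have -> : 268 * s * (q%:R ^+ r * x ^+ r) * N / n%:R = 268 * (s * (q%:R ^+ r * x ^+ r) * N / n%:R) by ring.
  have -> : N * (2000 * s * (q%:R ^+ r * x ^+ r) / n%:R) = 2000 * (s * (q%:R ^+ r * x ^+ r) * N / n%:R) by ring.
  by move: (_ / n%:R) => z; lra.
rewrite mulrDr; move: h1 h2 h3 h4 h5 h6.
set T1 := \sum_(E in _) (B _)%:R; set T2 := \sum_(E in _) (_ \in A)%:R.
set T3 := N * \sum_(w <- A) _; set T4 := \sum_(_ <- long_idx r) _.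
set T5 := \sum_(_ in _) _; set T6 := N * _; set T7 := _ * (4 * _).
set T8 := 268 * _ * _ / _; set T9 := 268 * s * _ * _ / _.
by lra.
Qed.

End CNBWCountBound.

Local Open Scope classical_set_scope.

(** * Probability spaces *)

Lemma measurable_preimage_countType (dT : measure_display) (T : measurableType dT)
    (I : countType) (Z : T -> I) :
  (forall i, measurable (Z @^-1` [set i])) -> forall A, measurable (Z @^-1` A).
Proof.
move=> mZ A.
have -> : Z @^-1` A = \bigcup_i (if `[< A i >] then Z @^-1` [set i] else set0).
  apply/seteqP; split => [t At|t [i _]]; first by exists (Z t) => //; rewrite asboolT.
  by case: asboolP => // Ai zi; rewrite /preimage /= zi.
apply: countable_bigcupT_measurable => [|i]; first exact: countableP.
by case: asboolP.
Qed.

Lemma prob_preimage_seq (R : realType) (dT : measure_display) (T : measurableType dT)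
    (P : probability T R) (I : choiceType) (Z : T -> I) (s : seq I) : uniq s ->
  (forall i, measurable (Z @^-1` [set i])) ->
  P (Z @^-1` [set` s]) = (\sum_(i <- s) P (Z @^-1` [set i]))%E.
Proof.
move=> us mZ.
have -> : Z @^-1` [set` s] = \bigcup_(i in [set` s]) Z @^-1` [set i].
  apply/seteqP; split => [t zs|t [i si zi]]; first by exists (Z t).
  by rewrite /preimage /= zi.
rewrite measure_fin_bigcup //; last exact: trivIset_preimage1.
by rewrite (fsbig_seq _ _ us).
Qed.

Section ProbabilityDistance.
Variables (R : realType) (d1 d2 : measure_display) (T1 : measurableType d1)
  (T2 : measurableType d2) (P1 : probability T1 R) (P2 : probability T2 R).
Variables (A : set T1) (B : set T2).
Hypotheses (mA : measurable A) (mB : measurable B).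

Let P1E : exists a : R, P1 A = a%:E.
Proof. by exists (fine (P1 A)); rewrite fineK // fin_num_measure. Qed.

Let P2E : exists b : R, P2 B = b%:E.
Proof. by exists (fine (P2 B)); rewrite fineK // fin_num_measure. Qed.

(** The upper bound for the complement is a lower bound for the event itself. *)
Lemma abse_probB_le (e : R) : (P1 A <= P2 B + e%:E)%E ->
  (P1 (~` A) <= P2 (~` B) + e%:E)%E -> (`|P1 A - P2 B| <= e%:E)%E.
Proof.
have e1 : P1 (~` A) = (1 - P1 A)%E by exact: probability_setC.
have e2 : P2 (~` B) = (1 - P2 B)%E by exact: probability_setC.
have [a Pa] := P1E; have [b Pb] := P2E; rewrite e1 e2 Pa Pb.
rewrite -!EFinB -!EFinD !lee_fin /= => h1 h2.
by rewrite ler_norml; apply/andP; split; lra.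
Qed.

Lemma abse_probB_le1 : (`|P1 A - P2 B| <= 1)%E.
Proof.
have h1 : (P1 A <= 1)%E by exact: probability_le1.
have h2 : (P2 B <= 1)%E by exact: probability_le1.
have h3 : (0 <= P1 A)%E by exact: measure_ge0.
have h4 : (0 <= P2 B)%E by exact: measure_ge0.
move: h1 h2 h3 h4; have [a ->] := P1E; have [b ->] := P2E.
rewrite -EFinB !lee_fin /= => h1 h2 h3 h4.
by rewrite ler_norml; apply/andP; split; lra.
Qed.

End ProbabilityDistance.

(** * The distance between the two laws in the main range of [n] *)

Section OneSided.
Variables (R : realType) (n r d : nat) (x0 : 'I_n).
Hypothesis r3 : (3 <= r)%N.
Hypothesis d3 : (3 <= d)%N.
Hypothesis nq : (2000 * (d - 1) ^ r <= n)%N.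
Local Notation q := (d - 1)%N.
Local Notation vec := {ffun 'I_r.+1 -> nat}.
Local Notation eps :=
  (2000 * Num.sqrt r%:R * (q%:R ^+ r * Num.sqrt (q%:R : R) ^+ r) / n%:R : R).
Variables (d1 : measure_display) (T1 : measurableType d1) (P1 : probability T1 R).
Variable G : T1 -> regular_graph n d.
Hypothesis uG : uniformly_distributed P1 G.
Variables (d2 : measure_display) (T2 : measurableType d2) (P2 : probability T2 R).
Variable Cinf : nat -> {RV P2 >-> nat}.
Hypothesis C12 : forall t, Cinf 1%N t = 0%N /\ Cinf 2%N t = 0%N.
Hypothesis CP : forall k, (3 <= k)%N -> forall A : set nat,
  P2 (Cinf k @^-1` A) = poisson_prob ((d%:R - 1) ^+ k / (2 * k%:R) : R) 0%N A.
Hypothesis Cind : mutually_independent [set k : nat | (3 <= k)%N] Cinf.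

Local Notation X := (fun t => [ffun k : 'I_r => CNBW (G t) k.+1]).
Local Notation Y := (fun t => [ffun k : 'I_r => CNBW_inf (fun j => Cinf j) k.+1 t]).

(** Coordinate 0 is set to 0 as well, since [Cinf 0] is arbitrary; divisors are positive, so the
    limiting walk counts are still a function of this vector. *)
Definition poisson_vec (t : T2) : vec := [ffun i : 'I_r.+1 => if (2 < i)%N then Cinf i t else 0%N].

Lemma qE : (d%:R - 1 : R) = q%:R.
Proof. by rewrite natrB // (leq_trans _ d3). Qed.

Lemma Cinf_prob1 k m : (2 < k)%N ->
  P2 (Cinf k @^-1` [set m]) = (pweight (cycle_rate R d k) m)%:E.
Proof.
move=> k2; rewrite CP // qE -/(cycle_rate R d k) /poisson_prob.
have l0 := cycle_rate_gt0 R d3 k2.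
rewrite l0 esum_set1; first by rewrite /poisson_pmf l0.
by rewrite lee_fin /poisson_pmf l0 !mulr_ge0 ?exprn_ge0 ?invr_ge0 ?ler0n ?expR_ge0 // ltW.
Qed.

Lemma measurable_poisson_vec1 w : measurable (poisson_vec @^-1` [set w]).
Proof.
have -> : poisson_vec @^-1` [set w] =
    \bigcap_(i in [set: 'I_r.+1]) [set t | poisson_vec t i = w i].
  apply/seteqP; split => [t <- //|t h]; apply/ffunP => i; exact: h.
apply: fin_bigcap_measurable => [|i _]; first exact: finite_finset.
case: (boolP (2 < i)%N) => i2.
  have -> : [set t | poisson_vec t i = w i] = Cinf i @^-1` [set w i].
    by apply/seteqP; split => t /=; rewrite ffunE i2.
  exact: measurable_funPTI.
case: (eqVneq 0%N (w i)) => w0.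
  have -> : [set t | poisson_vec t i = w i] = setT; last exact: measurableT.
  by apply/seteqP; split => t //= _; rewrite ffunE (negPf i2).
have -> : [set t | poisson_vec t i = w i] = set0; last exact: measurable0.
apply/seteqP; split => t //=; rewrite ffunE (negPf i2) => e.
by rewrite e eqxx in w0.
Qed.

Lemma poisson_vec_prob1 (w : vec) : (forall i : 'I_r.+1, (i <= 2)%N -> w i = 0%N) ->
  P2 (poisson_vec @^-1` [set w]) =
  (\prod_(k <- long_idx r) pweight (cycle_rate R d k) (w k))%:E.
Proof.
move=> w0; pose l : seq nat := [seq val k | k <- long_idx r].
have ul : uniq l by rewrite (map_inj_uniq val_inj) filter_uniq ?enum_uniq.
have lP k : (k \in l) = (2 < k < r.+1)%N.
  apply/mapP/andP => [[i + ->]|[k2 kr]].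
    by rewrite mem_filter => /andP[i2 _]; rewrite i2 ltn_ord.
  by exists (Ordinal kr); rewrite // mem_filter k2 mem_enum.
have -> : poisson_vec @^-1` [set w] =
    \bigcap_(k in [set` [fset k in l]%fset]) (Cinf k @^-1` [set w (inord k)]).
  apply/seteqP; split => [t <- k|t h].
    by rewrite /= !inE lP => /andP[k2 kr]; rewrite ffunE inordK // k2.
  apply/ffunP => i; rewrite ffunE; case: ifPn => [i2|]; last by rewrite -leqNgt => /w0.
  by have := h i; rewrite /= !inE lP i2 ltn_ord inord_val; apply.
rewrite Cind => [|k|//]; last by rewrite /= !inE lP => /andP[].
rewrite (perm_big l) /=; last first.
  by apply: uniq_perm => // [|k]; [exact: fset_uniq | rewrite inE].
rewrite big_map -prodEFin [LHS]big_seq [RHS]big_seq; apply: eq_bigr => k.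
by rewrite mem_filter => /andP[k2 _]; rewrite Cinf_prob1 // inord_val.
Qed.

Lemma CNBW_infE t : Y t = cnbw_of_cycles (poisson_vec t).
Proof.
apply/ffunP => k; rewrite !ffunE /CNBW_inf [LHS]big_seq [RHS]big_seq.
apply: eq_bigr => j; rewrite -dvdn_divisors // => jk.
have jr : (j < r.+1)%N by rewrite ltnS (leq_trans (dvdn_leq _ jk)).
have j0 : (0 < j)%N by apply: dvdn_gt0 jk.
rewrite ffunE inordK //; case: ifPn => // j2; congr (_ * _)%N.
have [c1 c2] := C12 t.
by case: j j0 j2 {jk jr} => [|[|[|j]]].
Qed.

Lemma measurable_CNBW_inf A : measurable (Y @^-1` A).
Proof.
have -> : Y @^-1` A = poisson_vec @^-1` [set w | A (cnbw_of_cycles w)].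
  by apply/seteqP; split => t /=; rewrite CNBW_infE.
apply: measurable_preimage_countType; exact: measurable_poisson_vec1.
Qed.

Lemma measurable_CNBW A : measurable (X @^-1` A).
Proof.
have -> : X @^-1` A = G @^-1` [set F | A [ffun k : 'I_r => CNBW F k.+1]] by [].
by apply: measurable_preimage_countType => F; case: (uG F).
Qed.

Lemma card_regular_graph : #|{: regular_graph n d}| = #|graphs n d|.
Proof. by rewrite card_sig; apply: eq_card => E; rewrite inE graphsE. Qed.

(** The value of [G] at a point of the probability space is a regular graph, so the division by the
    number of graphs is legitimate. *)
Lemma graphs_gt0 : (0 < #|graphs n d|)%N.
Proof. by rewrite -card_regular_graph; apply/card_gt0P; exists (G point). Qed.

Lemma CNBW_prob A : P1 (X @^-1` A) =
  ((\sum_(E in graphs n d) `[< A (cnbw_vec r E) >]%:R) / #|graphs n d|%:R)%:E.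
Proof.
pose s := [seq F <- enum {: regular_graph n d} | `[< A (cnbw_vec r (sval F)) >]].
have us : uniq s by rewrite filter_uniq ?enum_uniq.
have -> : X @^-1` A = G @^-1` [set` s].
  apply/seteqP; split => t /=; rewrite mem_filter mem_enum andbT; first by move=> ?; apply/asboolP.
  by move/asboolP.
rewrite prob_preimage_seq // => [|F]; last by case: (uG F).
rewrite (eq_bigr (fun=> (#|graphs n d|%:R^-1)%:E)); last first.
  by move=> F _; case: (uG F) => _ ->; rewrite -card_regular_graph.
rewrite sumEFin; congr EFin.
rewrite big_const_seq iter_addr_0 count_predT -[LHS]mulr_natl; congr (_ * _).
rewrite -natr_sum; congr (_%:R).
transitivity (\sum_(E in graphs n d | `[< A (cnbw_vec r E) >]) 1)%N; last first.
  by rewrite big_mkcondr; apply: eq_bigr => E _; case: asboolP.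
rewrite sum1_card.
rewrite -(size_map sval) cardE; apply/perm_size/uniq_perm.
- by rewrite map_inj_uniq //; apply: val_inj.
- exact: enum_uniq.
- move=> E; transitivity ((E \in graphs n d) && `[< A (cnbw_vec r E) >]); last by rewrite mem_enum.
  rewrite graphsE; apply/mapP/andP => [[F + ->]|[EG AE]].
    by rewrite mem_filter => /andP[-> _]; split => //; exact: (svalP F).
  by exists (exist _ E EG); rewrite // mem_filter AE mem_enum.
Qed.

(** The Poisson event is shrunk to the finite set [S] of [cnbw_count_bound], on which its
    probability is a finite sum of products of weights. *)
Lemma CNBW_prob_le A : (P1 (X @^-1` A) <= P2 (Y @^-1` A) + eps%:E)%E.
Proof.
have [S [uS SA S0 h]] := cnbw_count_bound R x0 d3 r3 nq (fun v => `[< A v >]).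
have N0 : 0 < #|graphs n d|%:R :> R by rewrite ltr0n graphs_gt0.
apply: le_trans (_ : _ <= P2 (poisson_vec @^-1` [set` S]) + eps%:E)%E _; last first.
  rewrite leeD2r // le_measure ?inE //.
  - apply: measurable_preimage_countType; exact: measurable_poisson_vec1.
  - exact: measurable_CNBW_inf.
  - by move=> t /= tS; rewrite CNBW_infE; apply/asboolP/SA.
rewrite prob_preimage_seq //; last exact: measurable_poisson_vec1.
rewrite (_ : (\sum_(i <- S) _)%E =
   (\sum_(w <- S) \prod_(k <- long_idx r) pweight (cycle_rate R d k) (w k))%:E).
  by rewrite CNBW_prob -EFinD lee_fin ler_pdivrMr // mulrC.
rewrite -sumEFin [LHS]big_seq [RHS]big_seq; apply: eq_bigr => w wS.
by rewrite poisson_vec_prob1 // => i; apply: S0.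
Qed.

Lemma CNBW_prob_dist A : (`|P1 (X @^-1` A) - P2 (Y @^-1` A)| <= eps%:E)%E.
Proof.
apply: abse_probB_le; [exact: measurable_CNBW | exact: measurable_CNBW_inf | |].
- exact: CNBW_prob_le.
- exact: (CNBW_prob_le (~` A)).
Qed.

End OneSided.

Theorem theorem12 (R : realType) :
  exists C : R, 0 < C /\
  forall n r d : nat, (1 <= n)%N -> (3 <= r)%N -> (3 <= d)%N ->
  forall (d1 : measure_display) (T1 : measurableType d1)
    (P1 : probability T1 R) (G : T1 -> regular_graph n d),
  uniformly_distributed P1 G ->
  forall (d2 : measure_display) (T2 : measurableType d2)
    (P2 : probability T2 R) (Cinf : nat -> {RV P2 >-> nat}),
  (forall t, Cinf 1%N t = 0%N /\ Cinf 2%N t = 0%N) ->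
  (forall k, (3 <= k)%N -> forall A : set nat,
     P2 (Cinf k @^-1` A) =
       poisson_prob ((d%:R - 1) ^+ k / (2 * k%:R) : R) 0%N A) ->
  mutually_independent [set k : nat | (3 <= k)%N] Cinf ->
  (dTV P1 P2
     (fun t => [ffun k : 'I_r => CNBW (G t) k.+1])
     (fun t => [ffun k : 'I_r => CNBW_inf (fun j => Cinf j) k.+1 t])
   <= (C * Num.sqrt r%:R * (d%:R - 1) `^ (3 * r%:R / 2) / n%:R)%:E)%E.
Proof.
exists 2000; split; first by rewrite ltr0n.
move=> n r d n1 r3 d3 d1 T1 P1 G uG d2 T2 P2 Cinf C12 CP Cind.
have q1 : (1 : R) <= (d - 1)%:R by rewrite ler1n subn_gt0 (leq_trans _ d3).
(* The exponent [3 r / 2] is split as [r + r / 2], which leaves an integer power and an integer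
   power of a square root. *)
have -> : (d%:R - 1 : R) `^ (3 * r%:R / 2) =
    (d - 1)%:R ^+ r * Num.sqrt (d - 1)%:R ^+ r.
  rewrite qE // (_ : 3 * r%:R / 2 = r%:R + 2^-1 * r%:R); last by field.
  rewrite powRD; last by apply/implyP => _; rewrite gt_eqF // (lt_le_trans ltr01).
  by rewrite powR_mulrn // powRrM powR12_sqrt // powR_mulrn ?sqrtr_ge0.
apply: ge_ereal_sup => _ [A _ <-].
(* For [n] below [2000 q ^ r] the right side is at least 1 and the trivial bound is enough; the same
   2000 serves as constant and as threshold. *)
have [nq|nq] := leqP (2000 * (d - 1) ^ r) n.
  exact: (CNBW_prob_dist (Ordinal n1)).
have mX := measurable_CNBW (r := r) uG A.
have mY := measurable_CNBW_inf (r := r) C12 A.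
apply: le_trans (abse_probB_le1 P1 P2 mX mY) _.
rewrite lee_fin ler_pdivlMr ?ltr0n // mul1r.
have s1 : 1 <= Num.sqrt (r%:R : R).
  by rewrite -[X in X <= _]sqrtr1 ler_sqrt ?ler1n ?ler0n // (leq_trans _ r3).
have x1 : 1 <= Num.sqrt ((d - 1)%:R : R) ^+ r.
  by rewrite exprn_ege1 // -[X in X <= _]sqrtr1 ler_sqrt // ler0n.
have nle : n%:R <= 2000 * (d - 1)%:R ^+ r :> R.
  by rewrite -natrX -natrM ler_nat ltnW.
apply: le_trans nle _; rewrite -!mulrA ler_pM2l ?ltr0n //.
rewrite mulrCA ler_peMr ?exprn_ge0 ?ler0n //.
by rewrite -[X in X <= _]mulr1 ler_pM.
Qed.
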